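(* The values of $n_2(5,d,1)$ for $d=1,2,\dots,31$ are, in order, $10,10,12,12,17,18,19,20,24,25,27,28,30,30,32,32,37,38,41,42,45,46,47,48,52,54,55,56,59,60,62$; moreover $n_2(5,36,1)=72$ and $n_2(5,38,1)=76$; and $n_2(5,d,1)=n_2(5,d)$ for all other positive integers $d$ (i.e. for $d\in\{32,\dots,35\}\cup\{37\}$ and $d\ge 39$).
   Context: An $[n,k,d]_q$-code is a $k$-dimensional subspace of $\mathbb{F}_q^n$ with minimum Hamming distance at least $d$. $n_q(k,d)$ denotes the minimum length $n$ of an $[n,k,d]_q$-code. A linear code $C\subseteq\mathbb{F}_q^n$ has locality $r$ if for every coordinate $i$ there is a set $S_i\subseteq\{1,\dots,n\}\setminus\{i\}$ with $|S_i|\le r$ such that any two codewords agreeing on all coordinates in $S_i$ also agree in coordinate $i$. $n_q(k,d,r)$ denotes the minimum length $n$ of an $[n,k,d]_q$-code with locality $r$. *)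

(* Defs.v *)
From HB Require Import structures.
From mathcomp Require Export all_boot all_order all_algebra.

Set Implicit Arguments.
Unset Strict Implicit.
Unset Printing Implicit Defensive.

Section Codes.

Variable F : finFieldType.

Definition hamming_dist n (u v : 'rV[F]_n) : nat :=
  #|[set i | u 0%R i != v 0%R i]|.

Definition is_code n (k d : nat) (C : {vspace 'rV[F]_n}) : Prop :=
  \dim C = k /\
  (forall u v, u \in C -> v \in C -> u != v -> d <= hamming_dist u v).

Definition has_locality n (r : nat) (C : {vspace 'rV[F]_n}) : Prop :=
  forall i : 'I_n, exists S : {set 'I_n},
    [/\ i \notin S, #|S| <= r
      & forall u v, u \in C -> v \in C ->
          (forall j, j \in S -> u 0%R j = v 0%R j) -> u 0%R i = v 0%R i].

Definition is_minimum (P : nat -> Prop) (n : nat) : Prop :=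
  P n /\ forall m, P m -> n <= m.

(* [is_min_length k d n] reads n_q(k,d) = n, and [is_min_length_loc k d r n]
   reads n_q(k,d,r) = n, where q = #|F|; relations rather than functions because
   the minimum need not exist (for instance r = 0 and k > 0). *)
Definition is_min_length (k d n : nat) : Prop :=
  is_minimum
    (fun m => exists C : {vspace 'rV[F]_m}, is_code k d C) n.

Definition is_min_length_loc (k d r n : nat) : Prop :=
  is_minimum
    (fun m => exists C : {vspace 'rV[F]_m}, is_code k d C /\ has_locality r C) n.

End Codes.

(* Main.v *)
Require Import Defs.
From mathcomp Require Import zify.

Set Implicit Arguments.
Unset Strict Implicit.
Unset Printing Implicit Defensive.

Import GRing.Theory.

(* A binary code of dimension 5 is, up to equivalence, a multiplicity function m
   on F_2^5 (how often each vector occurs as a column of a generator matrix), and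
   it has distance at least d when every nonzero functional u satisfies
   sum_{u.p = 1} m(p) >= d.  A nonzero column is determined by one other
   coordinate only if it is repeated, so locality 1 means m(p) <> 1 for p <> 0.
   Upper bounds are explicit multiplicity functions; raising m by 2 off the origin
   turns (n, d) into (n + 62, d + 32) and keeps m <> 1, so finitely many of them
   settle all large d, where the Griesmer bound is attained.  Each remaining lower
   bound is the infeasibility of a small integer program in 31 variables; it is
   proved by a branch-and-bound tree whose leaves are Farkas certificates (with a
   parity rounding) and whose branchings are made up to linear symmetry. *)

(** The conflict with the Griesmer bound shows at [d = 16]: the bound 31 is met by the simplex code,
    in which every nonzero column occurs exactly once, and this is what locality 1 forbids. Two
    copies of the simplex code use every column twice, so from [d = 32] on the restriction almost
    disappears; only [d = 36] and [d = 38] miss their Griesmer values, 71 and 75, by one. The period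
    is 32 and not 16 because adding a single copy would turn the multiplicity 0 into 1. A linear
    relaxation does not see that the value 1 is missing. The certificates recover this twice: a
    bound [m <= 1] is sharpened to [m = 0], and a bound [m <= 2] makes [m] even, so that weights and
    length can be rounded to the right parity. The integer programs are invariant under GL(5,2), a
    group of order 9999360 that is transitive on nonzero points. A branching therefore concerns a
    whole set of equivalent points: either all of them have small multiplicity, or one of large
    multiplicity may be moved to a chosen place. *)

Local Notation F2 := ('F_2).
Local Notation point := ('rV['F_2]_5).

(** * Elements of F_2 as truth values *)

Lemma F2_cases (x : F2) : x = (x != 0%R)%:R%R.
Proof. by case: x => [[|[|[]]] Hx] //; apply: val_inj. Qed.

Lemma F2_neq0_add (x y : F2) : ((x + y != 0) = (x != 0) (+) (y != 0))%R.
Proof. by rewrite (F2_cases x) (F2_cases y); case: (x != 0%R); case: (y != 0%R). Qed.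

Lemma F2_nat_addb (a b : bool) : ((a (+) b)%:R = a%:R + b%:R :> F2)%R.
Proof. by case: a; case: b; apply: val_inj. Qed.

Lemma F2_natb_neq0 (b : bool) : (b%:R != 0 :> F2)%R = b.
Proof. by case: b. Qed.

Lemma card_set_sum (T : finType) (P : pred T) : #|[set x | P x]| = \sum_x P x.
Proof.
by rewrite -sum1dep_card big_mkcond; apply: eq_bigr => x _; case: (P x).
Qed.

(** * The Griesmer bound *)

(** This is the sum of [d / 2^i], rounded up, over [i < k]: repeated halving with rounding up agrees
    with a single rounding of [d / 2^i]. *)
Fixpoint griesmer (k d : nat) : nat :=
  if k is k'.+1 then d + griesmer k' (uphalf d) else 0.

Lemma griesmer_leq k d e : d <= e -> griesmer k d <= griesmer k e.
Proof.
elim: k d e => //= k IH d e le_de; apply: leq_add => //; apply: IH.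
by apply: uphalf_leq.
Qed.

(** Weights are measured on a set of coordinates so that a residual code stays in the same ambient
    space; deleting coordinates only shrinks [A]. *)
Definition weight_on N (A : {set 'I_N}) (c : 'rV[F2]_N) := #|[set j in A | c 0%R j != 0%R]|.

(** At a coordinate in the support of [c] exactly one of [e] and [c + e] is nonzero; elsewhere they
    coincide. Counting [c] itself, every coordinate of [A] contributes 0 or 2, whence the
    doubling. *)
Lemma weight_on_add N A (c e : 'rV[F2]_N) :
  weight_on A (c + e)%R + (weight_on A e + weight_on A c) =
  (weight_on (A :\: [set j | c 0%R j != 0%R]) e + weight_on A c).*2.
Proof.
rewrite -addnn /weight_on !card_set_sum -!big_split /=; apply: eq_bigr => j _.
rewrite !inE mxE F2_neq0_add.
by case: (j \in A); case: (c _ _ != _)%R; case: (e _ _ != _)%R.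
Qed.

(* Residual code: delete the support of a minimum-weight word c and keep a complement of
   <[c]>; the weights there are at least half that of c. *)
Lemma griesmer_bound N k d A (C : {vspace 'rV[F2]_N}) :
  \dim C = k -> (forall c, c \in C -> c != 0%R -> d <= weight_on A c) ->
  griesmer k d <= #|A|.
Proof.
elim: k d A C => // k IH d A C dimC dC.
have [c0 c0C] : exists2 c, c \in C & c != 0%R.
  exists (vpick C); first exact: memv_pick.
  by rewrite vpick0 -dimv_eq0 dimC.
move=> c0n.
pose P c := (c \in C) && (c != 0%R).
have Pc0 : P c0 by rewrite /P c0C c0n.
case: (@arg_minnP _ c0 P (weight_on A) Pc0) => c /andP[cC cn] cmin.
pose C' := (C :\: <[c]>)%VS.
have sub : (<[c]> <= C)%VS by rewrite -memvE.
have dimC' : \dim C' = k.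
  have := dimv_cap_compl C <[c]>%VS; rewrite (capv_idPr sub) dim_vline cn dimC.
  by rewrite -/C'; lia.
have := IH (uphalf (weight_on A c)) (A :\: [set j | c 0%R j != 0%R]) C' dimC' _.
set B := A :\: _; move=> IHC.
have cardA : #|A| = weight_on A c + #|B|.
  rewrite -(cardsID [set j | c 0%R j != 0%R] A); congr (_ + _).
  by apply: eq_card => j; rewrite !inE.
rewrite cardA.
(* The induction hypothesis was taken at the true minimum weight of the code on [A]; as the bound is
   monotone in the distance, it may replace [d]. *)
apply: leq_trans (leq_add (leqnn _) (IHC _)).
  apply: (@griesmer_leq k.+1); exact: dC.
move=> e eC' en.
have eC : e \in C by apply: subvP eC'; exact: diffvSl.
(* Needed to compare [c + e] with the minimum weight: a zero sum would put [e] on the line of [c],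
   which meets the complement trivially. *)
have cen : (c + e != 0)%R.
  apply: contra en => /eqP H.
  have ec : e \in <[c]>%VS.
    have -> : e = (- c)%R by apply/eqP; rewrite -addr_eq0 addrC H.
    by rewrite memvN memv_line.
  have : e \in (<[c]> :&: C')%VS by rewrite memv_cap ec eC'.
  by rewrite capvC capv_diff memv0.
have h1 : weight_on A c <= weight_on A (c + e)%R by apply: cmin; rewrite /P cen memvD.
have h2 : weight_on A c <= weight_on A e by apply: cmin; rewrite /P en eC.
(* Both [e] and [c + e] weigh at least as much as [c], so the left side of the identity is at least
   three times the weight of [c]; hence [e] keeps at least half of that weight off the support of
   [c]. *)
move: h1 h2 (weight_on_add A c e); rewrite -/B leq_uphalf_double.
move: (weight_on A (c + e)%R) (weight_on A e) (weight_on A c) (weight_on B e).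
by move=> x y z w; lia.
Qed.

Lemma griesmer_code (N d k : nat) (C : {vspace 'rV[F2]_N}) :
  is_code k d C -> griesmer k d <= N.
Proof.
case=> dimC dC; rewrite -[leqRHS](card_ord N) -cardsT.
apply: griesmer_bound dimC _ => c cC cn.
have := dC c 0%R cC (mem0v _) cn.
by rewrite /hamming_dist /weight_on; congr (_ <= _); apply: eq_card => j; rewrite !inE mxE.
Qed.

(** * Generator matrices and multiplicity functions *)

Definition dotp k (u p : 'rV[F2]_k) : bool := (u *m p^T)%R 0%R 0%R != 0%R.

Lemma dotp_delta k a (p : 'rV[F2]_k) :
  dotp (delta_mx 0%R a) p = (p 0%R a != 0%R).
Proof. by rewrite /dotp -rowE !mxE. Qed.

Lemma dotpDl k (u v p : 'rV[F2]_k) : dotp (u + v)%R p = dotp u p (+) dotp v p.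
Proof. by rewrite /dotp mulmxDl mxE F2_neq0_add. Qed.

Lemma dotp0r k (u : 'rV[F2]_k) : dotp u 0%R = false.
Proof. by rewrite /dotp trmx0 mulmx0 mxE eqxx. Qed.

(** If some coordinate is 1 at [p] and 0 at [q], it is the functional sought. Otherwise some
    coordinate is 0 at [p] and 1 at [q], and its sum with a coordinate in the support of [p] works.
    The purpose is to show that a nonzero column is not determined by a different one. *)
Lemma dotp_separate k (p q : 'rV[F2]_k) :
  p != 0%R -> p != q -> exists u, dotp u p && ~~ dotp u q.
Proof.
move=> /rV0Pn[b pb] /eqP pq.
have [a pqa] : exists a, p 0%R a != q 0%R a.
  apply/existsP; apply: contra_notT pq; rewrite negb_exists => /forallP h.
  by apply/rowP => a; apply/eqP; have := h a; rewrite negbK.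
have [qb|qb] := boolP (q 0%R b != 0%R); last first.
  by exists (delta_mx 0%R b); rewrite !dotp_delta pb qb.
have [pa|pa] := boolP (p 0%R a != 0%R).
  exists (delta_mx 0%R a); rewrite !dotp_delta pa /=.
  apply: contra pqa => qa; apply/eqP.
  by rewrite (F2_cases (p _ _)) (F2_cases (q _ _)) pa qa.
have qa : q 0%R a != 0%R by apply: contraNneq pqa => ->; apply/eqP/eqP; rewrite -[_ == _]negbK.
exists (delta_mx 0%R a + delta_mx 0%R b)%R.
by rewrite !dotpDl !dotp_delta pb qb (negPf pa) qa.
Qed.

Lemma sum_fibers (I T : finType) (f : I -> T) (Q : pred T) :
  \sum_(p | Q p) #|[set j | f j == p]| = #|[set j | Q (f j)]|.
Proof.
rewrite card_set_sum (eq_bigr (fun p => \sum_j (f j == p))); last first.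
  by move=> p _; rewrite card_set_sum.
rewrite exchange_big; apply: eq_bigr => j _ /=.
have [Qf|Qf] := boolP (Q (f j)).
  by rewrite (bigD1 (f j)) //= eqxx big1 // => p /andP[_]; rewrite eq_sym => /negPf->.
by rewrite big1 // => p Qp; case: eqP => // fp; rewrite fp Qp in Qf.
Qed.

(** Zero columns contribute to no weight and are dropped, so the length is an inequality. This also
    makes the property monotone in [n]: refuting it for one [n] refutes all shorter lengths. *)
Definition admissible (n d : nat) (m : point -> nat) : Prop :=
  [/\ m 0%R = 0, forall p, m p != 1, \sum_p m p <= n
    & forall u, u != 0%R -> d <= \sum_(p | dotp u p) m p].

(** Under a change of basis of the points, functionals transform by the inverse transpose, and the
    weight conditions are merely permuted. Every reduction by symmetry in the certificates rests on
    this. *)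
Lemma admissible_mulmx n d m (M : 'M[F2]_5) :
  M \in unitmx -> admissible n d m -> admissible n d (fun p => m (p *m M)%R).
Proof.
move=> uM [m0 m1 mn md]; split=> //; first by rewrite mul0mx.
  by rewrite (reindex_inj (can_inj (mulmxK uM))) in mn.
move=> u un.
have un' : (u *m (invmx M)^T != 0)%R.
  apply: contra un => /eqP h; rewrite -[u]mulmx1 -trmx1 -(mulmxV uM) trmx_mul.
  by rewrite mulmxA h mul0mx.
apply: leq_trans (md _ un') _.
rewrite (reindex_inj (can_inj (mulmxK uM))) /=.
rewrite (eq_bigl (dotp u)) // => p.
by rewrite /dotp trmx_mul mulmxA -(mulmxA u) -trmx_mul mulmxV // trmx1 mulmx1.
Qed.

(** Suppose a column [p != 0] occurs only at coordinate [j]. The recovery set of [j] carries at most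
    one column, and it differs from [p]. A functional that is 1 at [p] and 0 at that column yields a
    codeword agreeing with the zero word on the recovery set but not at [j]. *)
Lemma admissible_of_code N d (C : {vspace 'rV[F2]_N}) :
  0 < d -> is_code 5 d C -> has_locality 1 C -> exists m, admissible N d m.
Proof.
move=> d0 [dimC dC] loc.
have [b bC] : exists b : 5.-tuple 'rV[F2]_N, basis_of C b.
  by rewrite -dimC; exists (vbasis C); exact: vbasisP.
pose G : 'M[F2]_(5, N) := (\matrix_(i < 5) b`_i)%R.
have uG (u : point) : (u *m G = \sum_i u 0 i *: b`_i)%R.
  by rewrite mulmx_sum_row; apply: eq_bigr => i _; rewrite rowK.
have GC (u : point) : (u *m G)%R \in C.
  rewrite uG memv_suml // => i _; rewrite memvZ //.
  by rewrite (basis_mem bC) // mem_nth // size_tuple.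
have Gn (u : point) : u != 0%R -> (u *m G)%R != 0%R.
  apply: contra; rewrite uG => /eqP; move/freeP: (basis_free bC) => /[apply] h.
  by apply/eqP/rowP => i; rewrite h mxE.
pose pj j := (col j G)^T%R.
have dotG (u : point) j : dotp u (pj j) = ((u *m G)%R 0%R j != 0%R).
  by rewrite /dotp trmxK !mxE; congr (_ != _); apply: eq_bigr => i _; rewrite !mxE.
pose m p := if p == 0%R then 0 else #|[set j | pj j == p]|.
exists m; split; first by rewrite /m eqxx.
- move=> p; rewrite /m; case: ifP => // /negbT pn.
  apply/negP => /cards1P[j jE].
  have pjE : pj j = p by apply/eqP; have := set11 j; rewrite -jE inE.
  have [S [jS cS HS]] := loc j.
  have [u /andP[up uS]] : exists u, dotp u p && [forall k in S, ~~ dotp u (pj k)].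
    case: (set_0Vmem S) => [S0|[k kS]].
      (* Separating [p] from the zero point gives a functional that is 1 at [p]; an empty recovery
         set imposes nothing more. *)
      have [u /andP[up _]] := dotp_separate pn pn.
      by exists u; rewrite up; apply/forall_inP => k; rewrite S0 inE.
    have Sk : S = [set k] by apply/eqP; rewrite eq_sym eqEcard sub1set kS cards1.
    have pk : p != pj k.
      apply: contra jS => /eqP pk.
      have : k \in [set j | pj j == p] by rewrite inE pk.
      by rewrite jE inE Sk inE eq_sym.
    have [u /andP[up uk]] := dotp_separate pn pk.
    by exists u; rewrite up; apply/forall_inP => l; rewrite Sk inE => /eqP->.
  suff h : (u *m G)%R 0%R j = (0%R : 'rV_N) 0%R j.
    by move: up; rewrite -pjE dotG h mxE eqxx.
  apply: HS (GC u) (mem0v _) _ => k kS.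
  by move: uS => /forall_inP/(_ k kS); rewrite dotG negbK [RHS]mxE => /eqP.
- apply: (@leq_trans (\sum_p #|[set j | pj j == p]|)).
    by apply: leq_sum => p _; rewrite /m; case: ifP.
  rewrite (sum_fibers pj xpredT) -[leqRHS](card_ord N) -cardsT.
  by apply: subset_leq_card; apply/subsetP => j; rewrite inE.
(* Points with [u.p = 1] are nonzero, so the columns omitted from [m] do not enter this weight. *)
- move=> u un; rewrite (eq_bigr (fun p => #|[set j | pj j == p]|)); last first.
    by move=> p up; rewrite /m; case: eqP => // p0; rewrite p0 dotp0r in up.
  rewrite (sum_fibers pj (dotp u)).
  apply: leq_trans (dC _ 0%R (GC u) (mem0v _) (Gn _ un)) _.
  apply: subset_leq_card; apply/subsetP => j.
  by rewrite !inE dotG [X in _ != X -> _]mxE.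
Qed.

(** * Points of F_2^5 as binary numbers *)

(* The point with coordinates b_0, ..., b_4 is coded by the number sum_j b_j 2^j. *)
Definition bit (n j : nat) : bool := odd (iter j half n).

Lemma bitS n j : bit n j.+1 = bit n./2 j.
Proof. by rewrite /bit iterSr. Qed.

Fixpoint xorn (k a b : nat) : nat :=
  if k is k'.+1 then (odd a (+) odd b) + (xorn k' a./2 b./2).*2 else 0.

Lemma bit_xorn k a b j : j < k -> bit (xorn k a b) j = bit a j (+) bit b j.
Proof.
elim: k a b j => // k IH a b [|j] jk; last by rewrite !bitS /= half_bit_double IH.
by rewrite /bit /= oddD odd_double addbF; case: (odd a (+) odd b).
Qed.

Fixpoint dotn (k a b : nat) : bool :=
  if k is k'.+1 then (odd a && odd b) (+) dotn k' a./2 b./2 else false.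

Lemma dotnE k a b :
  ((dotn k a b)%:R = \sum_(j < k) (bit a j)%:R * (bit b j)%:R :> F2)%R.
Proof.
elim: k a b => [|k IH] a b; first by rewrite big_ord0.
rewrite big_ord_recl /= F2_nat_addb IH; congr (_ + _)%R.
  by rewrite /bit /=; case: (odd a); case: (odd b); rewrite ?mulr1 ?mulr0.
by apply: eq_bigr => j _; rewrite /= /bump /= add1n !bitS.
Qed.

Definition pt (i : nat) : point := (\row_(j < 5) (bit i j)%:R)%R.

Lemma dotp_pt u p : dotp (pt u) (pt p) = dotn 5 u p.
Proof.
rewrite /dotp mxE -[RHS]F2_natb_neq0 dotnE; congr (_ != _).
by apply: eq_bigr => j _; rewrite !mxE.
Qed.

Lemma pt0 : pt 0 = 0%R.
Proof. by apply/rowP => j; rewrite !mxE /bit iter_fix. Qed.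

(** The 32 bit lists are found distinct by computation; injectivity and equal cardinalities then
    give the bijection. *)
Lemma pt_bij : bijective (fun i : 'I_32 => pt i).
Proof.
apply: inj_card_bij; last by rewrite card_mx !card_ord.
move=> i j /rowP ij; apply: val_inj => /=.
have ub : uniq [seq [seq bit i j | j <- iota 0 5] | i <- iota 0 32] by [].
have sz (l : 'I_32) : l < size [seq [seq bit i j | j <- iota 0 5] | i <- iota 0 32].
  by rewrite size_map size_iota ltn_ord.
have := nth_uniq [::] (sz i) (sz j) ub.
rewrite !(nth_map 0) ?size_iota ?ltn_ord // !nth_iota ?ltn_ord // !add0n.
move=> h; apply/eqP; rewrite -h; apply/eqP/eq_in_map => k.
rewrite mem_iota /= add0n => k5; have := ij (Ordinal k5); rewrite !mxE /=.
by case: bit; case: bit.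
Qed.

(** Sums over points become sums over a list of numbers, the form in which the checker can evaluate
    them. *)
Lemma big_pt (P : pred point) (F : point -> nat) :
  \sum_(p | P p) F p = \sum_(i <- iota 0 32 | P (pt i)) F (pt i).
Proof.
rewrite (reindex _ (onW_bij _ pt_bij)) /=.
by rewrite -(big_mkord (fun i => P (pt i)) (fun i => F (pt i))).
Qed.

Lemma ptP (p : point) : exists2 i, i < 32 & p = pt i.
Proof. by have [g _ gK] := pt_bij; exists (g p). Qed.

(** * Linear maps of F_2^5 *)

(* [g] lists the codes of the images of the five basis vectors. *)
Fixpoint act (g : seq nat) (i : nat) : nat :=
  if g is a :: g' then
    if odd i then xorn 5 a (act g' i./2) else act g' i./2
  else 0.

Lemma pt_xorn a b : pt (xorn 5 a b) = (pt a + pt b)%R.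
Proof. by apply/rowP => j; rewrite !mxE bit_xorn // F2_nat_addb. Qed.

Lemma pt_act_sum g i :
  pt (act g i) = (\sum_(j < size g) (bit i j)%:R *: pt (nth 0%N g j))%R.
Proof.
elim: g i => [|a g IH] i /=; first by rewrite big_ord0 pt0.
rewrite big_ord_recl [bit i _]/bit /=.
under eq_bigr do rewrite bitS.
by rewrite -IH; case: (odd i); rewrite ?pt_xorn ?scale1r // scale0r add0r.
Qed.

Definition act_mx (g : seq nat) : 'M[F2]_5 := (\matrix_(j < 5) pt (nth 0%N g j))%R.

Lemma pt_act g i : size g = 5 -> pt (act g i) = (pt i *m act_mx g)%R.
Proof.
move=> sg; rewrite pt_act_sum sg mulmx_sum_row; apply: eq_bigr => j _.
by rewrite rowK mxE.
Qed.

Lemma pt_eq0 i : i < 32 -> (pt i == 0%R) = (i == 0).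
Proof.
move=> i32; have := inj_eq (bij_inj pt_bij) (Ordinal i32) ord0.
by rewrite /= pt0 => ->.
Qed.

Lemma xorn_lt k a b : xorn k a b < 2 ^ k.
Proof.
elim: k a b => //= k IH a b; rewrite expnS mul2n.
by have := IH a./2 b./2; case: (_ (+) _) => /=; lia.
Qed.

Lemma act_lt g i : all (ltn^~ 32) g -> act g i < 32.
Proof.
elim: g i => //= a g IH i /andP[_ /IH ltg].
by case: odd => //; exact: (@xorn_lt 5).
Qed.

(** Invertibility is tested as injectivity: no nonzero point is sent to 0. The range condition keeps
    the images among the codes of points. *)
Definition gl5 (g : seq nat) : bool :=
  [&& size g == 5, all (ltn^~ 32) g & all (fun i => act g i != 0) (iota 1 31)].

Lemma act_mx_unit g : gl5 g -> act_mx g \in unitmx.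
Proof.
case/and3P=> /eqP sg ltg nz; rewrite -row_free_unit; apply: inj_row_free => p.
have [i i32 ->] := ptP p; rewrite -pt_act // => /eqP.
rewrite pt_eq0 ?act_lt //; case: i i32 => [|i] i32; first by rewrite pt0.
by rewrite (negPf (allP nz _ _)) // mem_iota.
Qed.

(** * Branch-and-bound certificates *)

Definition incidence_row (u : nat) : seq bool := [seq dotn 5 u p | p <- iota 0 32].

(** Tabulated once, so that the checker looks rows up instead of recomputing scalar products. *)
Definition incidence : seq (seq bool) :=
  Eval vm_compute in [seq incidence_row u | u <- iota 0 32].

Lemma nth_incidence u : u < 32 -> nth [::] incidence u = incidence_row u.
Proof.
move=> u32; have -> : incidence = [seq incidence_row u | u <- iota 0 32] by vm_compute.
by rewrite (nth_map 0) ?size_iota // nth_iota.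
Qed.

(** * Bounds on multiplicities and parity rounding *)

Definition bounds := seq (nat * nat).

(** A bound is a pair of a lower and an upper limit. Locality 1 reaches the integer program through
    the excluded value 1. *)
Definition in_range (b : nat * nat) (x : nat) : bool := (b.1 <= x <= b.2) && (x != 1).

(* Since the value 1 is excluded, an upper bound at most 2 forces 0 or 2. *)
Definition parity_of (b : nat * nat) : option bool :=
  if b.1 == b.2 then Some (odd b.1) else if b.2 <= 2 then Some false else None.

Lemma parity_ofP b x y : in_range b x -> parity_of b = Some y -> odd x = y.
Proof.
case: b => lo hi; rewrite /in_range /parity_of /= => /andP[/andP[lx xh] x1].
case: eqP => [e [<-]|_]; first by congr odd; lia.
by case: ifP => // h [<-]; move: (leq_trans xh h) x1; move: (x) => [|[|[|]]].
Qed.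

Fixpoint parity_on (r : seq bool) (st : bounds) : option bool :=
  match r, st with
  | c :: r', b :: st' =>
      if c then
        match parity_of b, parity_on r' st' with
        | Some x, Some y => Some (x (+) y)
        | _, _ => None
        end
      else parity_on r' st'
  | _, _ => Some false
  end.

Lemma parity_onP r st ms x :
  all2 in_range st ms -> parity_on r st = Some x -> odd (sumn (mask r ms)) = x.
Proof.
elim: r st ms x => [|c r IH] [|b st] [|y ms] x //=; try by move=> _ [<-].
case/andP=> yb inb; case: c => /=; last exact: IH.
case E: (parity_of b) => [p|//]; case E': (parity_on r st) => [q|//] [<-].
by rewrite oddD (parity_ofP yb E) (IH _ _ _ inb E').
Qed.

(** An integral cut: once the parity of the bounded quantity is known, its bound moves to the
    nearest value of that parity. For [None] the bound stays. *)
Definition round_up (d : nat) (o : option bool) : nat :=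
  if o is Some x then d + (x (+) odd d) else d.

Definition round_down (n : nat) (o : option bool) : nat :=
  if o is Some x then n - (x (+) odd n) else n.

Lemma round_upP d o w :
  (forall x, o = Some x -> odd w = x) -> d <= w -> round_up d o <= w.
Proof.
case: o => //= x /(_ _ erefl) <-; rewrite leq_eqVlt => /predU1P[->|].
  by rewrite addbb addn0.
by case: (_ (+) _); rewrite ?addn1 ?addn0 // => /ltnW.
Qed.

Lemma round_downP n o w :
  (forall x, o = Some x -> odd w = x) -> w <= n -> w <= round_down n o.
Proof.
case: o => //= x /(_ _ erefl) <-; rewrite leq_eqVlt => /predU1P[->|].
  by rewrite addbb subn0.
by case: (_ (+) _) => h; lia.
Qed.

(** * Nonnegative combinations of the constraints *)

Fixpoint add_row (r : seq bool) (c : seq nat) : seq nat :=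
  match r, c with
  | b :: r', x :: c' => b + x :: add_row r' c'
  | _, _ => c
  end.

(** The entry at a point is its coefficient in the sum of the weight constraints: the number of
    functionals in [us], with repetition, that are 1 there. *)
Definition col_sums (us : seq nat) : seq nat :=
  foldr (fun u => add_row (nth [::] incidence u)) (nseq 32 0) us.

Fixpoint scalar (c ms : seq nat) : nat :=
  match c, ms with
  | x :: c', y :: ms' => x * y + scalar c' ms'
  | _, _ => 0
  end.

Lemma size_add_row r c : size (add_row r c) = size c.
Proof. by elim: r c => [|b r IH] [|x c] //=; rewrite IH. Qed.

Lemma size_col_sums us : size (col_sums us) = 32.
Proof. by elim: us => [|u us IH] //=; rewrite size_add_row. Qed.

Lemma scalar_add_row r c ms :
  size c = size ms -> scalar (add_row r c) ms = sumn (mask r ms) + scalar c ms.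
Proof.
elim: r c ms => [|b r IH] [|x c] [|y ms] //= [sz].
by rewrite IH //; case: b => /=; rewrite ?mulnDl ?mul1n ?mul0n; lia.
Qed.

Lemma scalar_nseq0 k ms : scalar (nseq k 0) ms = 0.
Proof. by elim: k ms => [|k IH] [|y ms] //=; rewrite IH. Qed.

Lemma scalar_col_sums us ms : size ms = 32 ->
  scalar (col_sums us) ms = sumn [seq sumn (mask (nth [::] incidence u) ms) | u <- us].
Proof.
move=> sz; elim: us => [|u us IH]; first exact: (scalar_nseq0 32).
by rewrite /= scalar_add_row ?size_col_sums ?sz // IH.
Qed.

(** Truncated subtraction selects the points whose coefficient falls below [s]; there the missing
    amount is supplied by the lower bound. Its counterpart [upper_loss] charges the excess over [s]
    to the upper bound. *)
Fixpoint lower_gain (s : nat) (c : seq nat) (st : bounds) : nat :=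
  match c, st with
  | x :: c', b :: st' => (s - x) * b.1 + lower_gain s c' st'
  | _, _ => 0
  end.

Fixpoint upper_loss (s : nat) (c : seq nat) (st : bounds) : nat :=
  match c, st with
  | x :: c', b :: st' => (x - s) * b.2 + upper_loss s c' st'
  | _, _ => 0
  end.

(** Termwise: for a coefficient [x] and a multiplicity [y], the excess [(x - s) * y] is largest at
    the upper bound when [x >= s], and the deficit [(s - x) * y] is smallest at the lower bound when
    [x <= s]. *)
Lemma scalar_bounds s c st ms : all2 in_range st ms -> size c = size ms ->
  scalar c ms + lower_gain s c st <= s * sumn ms + upper_loss s c st.
Proof.
elim: c st ms => [|x c IH] [|b st] [|y ms] //= /andP[yb inb] [sz].
have {}IH := IH _ _ inb sz; case/andP: yb => /andP[ly yh] _.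
suff : x * y + (s - x) * b.1 <= s * y + (x - s) * b.2 by rewrite mulnDr; lia.
have [sx|/ltnW xs] := leqP s x.
  have -> : s - x = 0 by lia.
  rewrite mul0n addn0 -leq_subLR -mulnBl; exact: leq_mul.
have -> : x - s = 0 by lia.
by rewrite mul0n addn0 -[in leqRHS](subnKC xs) mulnDl leq_add2l leq_mul2l ly orbT.
Qed.

(* [Farkas s us] derives a contradiction from s copies of the length constraint and one
   copy of the weight constraint of each functional in [us] (repetitions allowed).
   [Branch p v gs t0 t1] distinguishes whether m <= v at p and at all images of p under
   the symmetries with indices [gs] (t0), or m > v at one of these points, which may
   then be taken to be p (t1). *)
Inductive certificate :=
| Farkas of nat & seq nat
| Branch of nat & nat & seq nat & certificate & certificate.

(** The multipliers of the individual bounds need no storage: they are the differences between the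
    column sums and [s]. The row [nseq 32 true] is that of the length constraint. The range of [u]
    leaves out the zero functional, which carries no weight constraint. *)
Definition farkas_check (n d : nat) (st : bounds) (s : nat) (us : seq nat) : bool :=
  let c := col_sums us in
  all (fun u => 0 < u < 32) us &&
  (s * round_down n (parity_on (nseq 32 true) st) + upper_loss s c st <
   sumn [seq round_up d (parity_on (nth [::] incidence u) st) | u <- us]
   + lower_gain s c st).

(** * The checker for branching trees *)

Definition raise_lower (p v : nat) (st : bounds) : bounds :=
  set_nth (0, 0) st p (v, (nth (0, 0) st p).2).

(** The multiplicity 1 being excluded, an upper bound 1 is already an upper bound 0. The point is
    the last index argument so that a list of points can be folded over. *)
Definition reduce_upper (v p : nat) (st : bounds) : bounds :=
  set_nth (0, 0) st p ((nth (0, 0) st p).1, if v == 1 then 0 else v).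

(** A symmetry may be used only if it leaves the current bounds unchanged, which is tested at each
    node. The maps listed at a node are used one at a time, so they need not be closed under
    composition. *)
Fixpoint check (perms : seq (seq nat)) (n d : nat) (st : bounds) (t : certificate)
    : bool :=
  match t with
  | Farkas s us => farkas_check n d st s us
  | Branch p v gs t0 t1 =>
      [&& p < 32,
          all (fun k => [seq nth (0, 0) st q | q <- nth [::] perms k] == st) gs,
          check perms n d (raise_lower p v.+1 st) t1
        & check perms n d
            (foldr (reduce_upper v) st (p :: [seq nth 0 (nth [::] perms k) p | k <- gs]))
            t0]
  end.

(** * Soundness of the checker *)

Definition multiplicities (m : point -> nat) : seq nat := [seq m (pt i) | i <- iota 0 32].

Lemma size_multiplicities m : size (multiplicities m) = 32.
Proof. by rewrite size_map size_iota. Qed.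

Definition in_bounds (st : bounds) (m : point -> nat) : Prop :=
  size st = 32 /\ forall i, i < 32 -> in_range (nth (0, 0) st i) (m (pt i)).

Lemma in_bounds_all2 st m : in_bounds st m -> all2 in_range st (multiplicities m).
Proof.
case=> sz h; rewrite all2E size_multiplicities sz eqxx andTb.
apply/(all_nthP ((0, 0), 0)) => i; rewrite size_zip size_multiplicities sz minnn => i32.
rewrite nth_zip ?size_multiplicities //.
have -> : nth 0 (multiplicities m) i = m (pt i).
  by rewrite (nth_map 0) ?size_iota // nth_iota.
exact: h.
Qed.

Lemma sumn_mask_incidence m u : u < 32 ->
  sumn (mask (nth [::] incidence u) (multiplicities m)) = \sum_(p | dotp (pt u) p) m p.
Proof.
move=> u32; rewrite nth_incidence // big_pt -big_filter /multiplicities /incidence_row.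
move: (iota 0 32) => l; rewrite -map_mask -filter_mask sumnE big_map.
by congr bigop; apply: eq_filter => p; rewrite dotp_pt.
Qed.

(** Adding the rounded weight constraints and [s] times the rounded length constraint, with the
    bounds absorbed by [scalar_bounds], gives the reverse of the strict inequality that was
    checked. *)
Lemma farkas_checkP n d st s us m :
  admissible n d m -> in_bounds st m -> farkas_check n d st s us -> False.
Proof.
case=> _ _ mn md inb /andP[/allP usP]; apply/negP; rewrite -leqNgt.
have all2m := in_bounds_all2 inb.
have szm := size_multiplicities m.
have := scalar_bounds s all2m _ (c := col_sums us).
rewrite size_col_sums szm => /(_ erefl); rewrite scalar_col_sums // => bnd.
have up : sumn [seq round_up d (parity_on (nth [::] incidence u) st) | u <- us] <=
          sumn [seq sumn (mask (nth [::] incidence u) (multiplicities m)) | u <- us].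
  rewrite !sumnE !big_map big_seq_cond [leqRHS]big_seq_cond.
  apply: leq_sum => u /andP[/usP/andP[u0 u32] _].
  apply: round_upP => [x|]; first exact: parity_onP.
  rewrite sumn_mask_incidence //; apply: md; rewrite pt_eq0 //; lia.
have dn : sumn (multiplicities m) <= round_down n (parity_on (nseq 32 true) st).
  apply: round_downP => [x /(parity_onP all2m) <-|].
    by rewrite mask_true ?szm.
  by apply: leq_trans mn; rewrite big_pt sumnE big_map.
have := leq_mul (leqnn s) dn; move: bnd up; lia.
Qed.

Lemma raise_lowerP p v st m : p < 32 -> in_bounds st m -> v <= m (pt p) ->
  in_bounds (raise_lower p v st) m.
Proof.
move=> p32 [sz h] vm; split; first by rewrite size_set_nth sz; apply/maxn_idPr.
move=> i i32; rewrite nth_set_nth /=; case: eqP => [->|_]; last exact: h.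
by have := h p p32; rewrite /in_range /= vm => /andP[/andP[_ ->] ->].
Qed.

Lemma reduce_upperP p v st m : p < 32 -> in_bounds st m -> m (pt p) <= v ->
  in_bounds (reduce_upper v p st) m.
Proof.
move=> p32 [sz h] mv; split; first by rewrite size_set_nth sz; apply/maxn_idPr.
move=> i i32; rewrite nth_set_nth /=; case: eqP => [->|_]; last exact: h.
have := h p p32; rewrite /in_range /= => /andP[/andP[-> _] m1]; rewrite m1 andbT /=.
by case: (v =P 1) => // v1; move: mv m1; rewrite v1; case: (m _) => [|[]].
Qed.

(** Suppose [m] exceeds [v] at an image [g p] of the branching point. Then [m] composed with [g]
    exceeds [v] at [p], is again admissible, and obeys the same bounds because [g] preserves them;
    the second subtree refutes it. Otherwise [m] is at most [v] at [p] and at all listed images,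
    which is the case of the first subtree. As the multiplicity function changes along the tree, the
    induction generalises over it. *)
Lemma checkP perms gs n d st t m :
  all gl5 gs -> perms = [seq [seq act g i | i <- iota 0 32] | g <- gs] ->
  check perms n d st t -> admissible n d m -> in_bounds st m -> False.
Proof.
move=> /allP gl -> {perms}; elim: t st m => [s us|p v ks t0 IH0 t1 IH1] st m /=.
  by move=> ck adm inb; exact: farkas_checkP adm inb ck.
set perms := map _ gs.
case/and4P=> p32 /allP sym ck1 ck0 adm inb.
have permP k : k \in ks -> exists2 g, gl5 g & nth [::] perms k = [seq act g i | i <- iota 0 32].
  move=> kks; have kgs : k < size gs.
    rewrite ltnNge; apply/negP => le.
    (* An index beyond the table would denote the empty permutation, under which the bounds become
       an empty list, never equal to one of 32 entries. *)
    have := sym k kks; rewrite nth_default ?size_map //= => /eqP st0.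
    by case: inb => sz _; rewrite -st0 in sz.
  by exists (nth [::] gs k); [exact/gl/mem_nth | rewrite (nth_map [::])].
have img k g : nth [::] perms k = [seq act g i | i <- iota 0 32] ->
    nth 0 (nth [::] perms k) p = act g p.
  by move=> ->; rewrite (nth_map 0) ?size_iota // nth_iota.
have [lt|le] := ltnP v (m (pt p)).
  exact: IH1 ck1 adm (raise_lowerP p32 inb lt).
have [/hasP[k kks lt]|/hasPn hle] :=
    boolP (has (fun k => v < m (pt (nth 0 (nth [::] perms k) p))) ks).
  have [g glg gE] := permP k kks; have := sym k kks; rewrite gE => /eqP symg.
  have sg : size g = 5 by case/and3P: glg => /eqP.
  pose m' q := m (q *m act_mx g)%R.
  have m'E i : m' (pt i) = m (pt (act g i)) by rewrite /m' -pt_act.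
  apply: (IH1 _ m' ck1 (admissible_mulmx (act_mx_unit glg) adm)).
  apply: raise_lowerP => //; last by rewrite m'E -(img k).
  case: inb => sz h; split=> // i i32; rewrite m'E -symg -map_comp.
  rewrite (nth_map 0) ?size_iota // nth_iota //=; apply: h.
  by apply: act_lt; case/and3P: glg.
apply: IH0 ck0 adm _; apply: reduce_upperP => //.
(* The induction runs over the suffixes of [ks], while membership must keep referring to the whole
   list. *)
have {sym} : {subset ks <= ks} by [].
elim: {1 3}ks => //= k l IHl sub; apply: reduce_upperP.
- have [g glg gE] := permP k (sub _ (mem_head _ _)).
  by rewrite (img k g gE); apply: act_lt; case/and3P: glg.
- by apply: IHl => j jl; apply: sub; rewrite inE jl orbT.
- by rewrite leqNgt; apply: hle; apply: sub; exact: mem_head.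
Qed.

(** The origin is pinned to 0; any other multiplicity is at most the total length. *)
Definition initial_bounds (n : nat) : bounds := (0, 0) :: nseq 31 (0, n).

Lemma admissible_initial n d m : admissible n d m -> in_bounds (initial_bounds n) m.
Proof.
case=> m0 m1 mn _; split; first by [].
move=> [|i] i32; rewrite /in_range m1 andbT; first by rewrite pt0 m0.
have -> : nth (0, 0) (initial_bounds n) i.+1 = (0, n).
  by rewrite -[LHS]/(nth (0, 0) (nseq 31 (0, n)) i) nth_nseq (i32 : i < 31).
apply: leq_trans mn.
by rewrite (bigD1 (pt i.+1)) //= leq_addr.
Qed.

(** * Codes from multiplicities *)

Definition columns (t l : seq nat) : seq nat := flatten [seq nseq x.1 x.2 | x <- zip t l].

Lemma count_columns (P : pred nat) t l :
  size t = size l -> count P (columns t l) = sumn (mask (map P l) t).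
Proof.
elim: t l => [|x t IH] [|y l] //= [/IH E].
by rewrite /columns /= count_cat count_nseq -/(columns t l) E; case: (P y); rewrite ?mul1n.
Qed.

Lemma size_columns t l : size t = size l -> size (columns t l) = sumn t.
Proof.
elim: t l => [|x t IH] [|y l] //= [/IH E].
by rewrite /columns /= size_cat size_nseq -/(columns t l) E.
Qed.

Lemma columns_sub t l : {subset columns t l <= l}.
Proof.
elim: t l => [|x t IH] [|y l] //= z.
rewrite /columns /= mem_cat mem_nseq inE => /orP[/andP[_ ->] //|/IH ->].
by rewrite orbT.
Qed.

(** As the points in [l] are distinct, the number of copies of [z] is a single entry of [t] or 0,
    and neither is 1. *)
Lemma columns_repeated t l z :
  uniq l -> all (fun x => x != 1) t -> count_mem z (columns t l) != 1.
Proof.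
elim: t l => [|x t IH] [|y l] //= /andP[yl ul] /andP[x1 t1].
rewrite /columns /= count_cat count_nseq -/(columns t l) /=.
case: (y =P z) => [<-|_]; last by rewrite mul0n add0n IH.
by rewrite mul1n (count_memPn _) ?addn0 //; apply: contra yl; exact: columns_sub.
Qed.

Lemma card_set_nth (P : pred nat) (s : seq nat) :
  #|[set j : 'I_(size s) | P (nth 0 s j)]| = count P s.
Proof.
rewrite card_set_sum -sum1_count [RHS]big_mkcond /= [RHS](big_nth 0) big_mkord.
by apply: eq_bigr => j _; case: (P _).
Qed.

(** The list [t] starts at the point 1, so [behead] removes the origin from each incidence row. *)
Definition realizes (n d : nat) (t : seq nat) : bool :=
  [&& size t == 31, all (fun x => x != 1) t, sumn t == n
    & all (fun u => d <= sumn (mask (behead (nth [::] incidence u)) t)) (iota 1 31)].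

(** The columns of [G] are the points repeated according to [t]. A nonzero [u] yields a word of
    weight at least [d > 0], so encoding is injective and the code has dimension 5. Each coordinate
    is recovered from another one carrying the same column, which exists because no point is used
    exactly once. *)
Lemma code_of_realizes n d t : 0 < d -> realizes n d t ->
  exists C : {vspace 'rV[F2]_n}, is_code 5 d C /\ has_locality 1 C.
Proof.
move=> d0 /and4P[/eqP sz t1 /eqP <- /allP td].
pose s := columns t (iota 1 31).
have szl : size t = size (iota 1 31) by rewrite sz.
rewrite -(size_columns szl) -/s.
pose G : 'M[F2]_(5, size s) := (\matrix_(k, j) pt (nth 0%N s j) 0 k)%R.
have dotG (u : point) j : ((u *m G)%R 0%R j != 0%R) = dotp u (pt (nth 0 s j)).
  by rewrite /dotp !mxE; congr (_ != _); apply: eq_bigr => k _; rewrite !mxE.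
have wG (u : point) : u != 0%R -> d <= #|[set j | (u *m G)%R 0%R j != 0%R]|.
  have [v v32 ->] := ptP u; rewrite pt_eq0 // => v0.
  have -> : [set j | (pt v *m G)%R 0%R j != 0%R] =
      [set j : 'I_(size s) | dotn 5 v (nth 0 s j)].
    by apply/setP => j; rewrite !inE dotG dotp_pt.
  rewrite (card_set_nth (dotn 5 v)) count_columns //.
  have := td v; rewrite mem_iota lt0n v0 => /(_ v32).
  by rewrite nth_incidence.
have injG : injective (fun u : point => (u *m G)%R).
  move=> u v uv; apply/eqP; rewrite -subr_eq0; apply/negPn/negP => /wG.
  rewrite mulmxBl uv subrr leqNgt; case/negP; apply: leq_ltn_trans d0.
  by rewrite leqn0 cards_eq0; apply/eqP/setP => j; rewrite !inE mxE eqxx.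
pose f : 'Hom(point, 'rV[F2]_(size s)) := linfun (mulmxr G).
have fE u : f u = (u *m G)%R by rewrite lfunE.
have CP w : reflect (exists u, w = (u *m G)%R) (w \in limg f).
  apply: (iffP memv_imgP) => [[u _ ->]|[u ->]]; exists u; rewrite ?fE ?memvf //.
exists (limg f); split; first split.
- rewrite limg_dim_eq ?dimvf //; apply/eqP; rewrite -subv0.
  apply/subvP => u; rewrite memv_cap memv_ker fE memv0 => /andP[_ /eqP u0].
  by apply/eqP/injG; rewrite u0 mul0mx.
- move=> _ _ /CP[u ->] /CP[v ->] uv.
  have h : d <= #|[set j | ((u - v) *m G)%R 0%R j != 0%R]|.
    by apply: wG; rewrite subr_eq0; apply: contra uv => /eqP->.
  apply: leq_trans h _; apply: subset_leq_card; apply/subsetP => j.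
  by rewrite !inE mulmxBl !mxE subr_eq0.
- move=> j; set x := nth 0 s j.
  have xs : 0 < count_mem x s by rewrite -has_count has_pred1 mem_nth.
  have x1 : count_mem x s != 1 by apply: columns_repeated => //; exact: iota_uniq.
  have : 1 < #|[set k : 'I_(size s) | pred1 x (nth 0 s k)]|.
    by rewrite card_set_nth; case: count xs x1 => [|[]].
  rewrite (cardsD1 j) inE /= eqxx ltnS => /card_gt0P[k].
  rewrite !inE => /andP[kj /eqP kx].
  exists [set k]; split; [by rewrite inE eq_sym | by rewrite cards1 |].
  move=> _ _ /CP[u ->] /CP[v ->] /(_ k (set11 k)) uvk.
  have colk (w : point) : (w *m G)%R 0%R j = (w *m G)%R 0%R k.
    by rewrite !mxE; apply: eq_bigr => i _; rewrite !mxE kx.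
  by rewrite !colk.
Qed.

Lemma sumn_mask_add2 r t : size r = size t ->
  sumn (mask r (map (addn 2) t)) = sumn (mask r t) + 2 * count id r.
Proof. by elim: r t => [|[] r IH] [|x t] //= [/IH E]; rewrite E; lia. Qed.

(** This appends two copies of the simplex code of length 31: every nonzero functional is 1 at
    exactly 16 of the 31 nonzero points, so each weight grows by 32. *)
Lemma realizes_add2 n d t :
  realizes n d t -> realizes (n + 62) (d + 32) (map (addn 2) t).
Proof.
case/and4P=> /eqP sz t1 /eqP <- /allP td; apply/and4P; split.
- by rewrite size_map sz.
- by rewrite all_map; apply/allP => x.
- have := @sumn_mask_add2 (nseq 31 true) t.
  by rewrite size_nseq sz !mask_true ?size_map ?sz // => ->.
apply/allP => u uI; have := td u uI.
have /allP/(_ u uI)/andP[/eqP sr /eqP cr] : all (fun u =>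
    let r := behead (nth [::] incidence u) in (size r == 31) && (count id r == 16))
    (iota 1 31) by vm_compute.
by rewrite sumn_mask_add2 ?sr ?sz // cr leq_add2r.
Qed.

(** * Local codes meeting the Griesmer bound *)

(** The repeated halves of 32 are integers, with [32 + 16 + 8 + 4 + 2 = 62]; this is the length
    added by two simplex codes, so attaining the bound is preserved in steps of 32. *)
Lemma griesmer_add32 d : griesmer 5 (d + 32) = griesmer 5 d + 62.
Proof. rewrite /=; lia. Qed.

(* Entry d - 1 gives m at the points 1, ..., 31 of an optimal code of distance d. *)
Definition multiplicity_table : seq (seq nat) :=
  [:: [:: 0; 0; 0; 2; 0; 0; 0; 0; 0; 0; 0; 2; 2; 2; 0; 0; 0; 2; 0; 0; 0; 0; 0; 0; 0; 0; 0; 0; 0;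
  0; 0]; [:: 0; 2; 0; 0; 0; 0; 0; 0; 0; 0; 0; 0; 0; 2; 0; 2; 0; 0; 0; 2; 0; 0; 0; 0; 0; 0; 0; 0;
  2; 0; 0]; [:: 0; 0; 0; 0; 0; 0; 2; 2; 0; 0; 0; 0; 2; 2; 0; 0; 0; 0; 0; 2; 0; 0; 0; 2; 0; 0; 0;
  0; 0; 0; 0]; [:: 2; 0; 2; 2; 0; 0; 0; 0; 0; 0; 0; 0; 0; 0; 2; 2; 0; 0; 0; 0; 0; 0; 0; 0; 2; 0;
  0; 0; 0; 0; 0]; [:: 0; 0; 2; 2; 0; 3; 0; 0; 0; 0; 0; 2; 2; 0; 0; 0; 0; 0; 0; 0; 0; 0; 2; 2; 0;
  0; 0; 0; 0; 0; 2]; [:: 0; 2; 0; 0; 2; 2; 2; 0; 0; 0; 0; 0; 0; 2; 0; 2; 2; 0; 0; 0; 0; 0; 0; 0;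
  2; 2; 0; 0; 0; 0; 0]; [:: 0; 0; 0; 2; 2; 2; 0; 0; 0; 2; 0; 0; 0; 0; 0; 0; 0; 0; 3; 2; 0; 0; 0;
  2; 0; 2; 2; 0; 0; 0; 0]; [:: 0; 2; 2; 2; 0; 0; 2; 2; 0; 0; 0; 0; 2; 0; 0; 0; 2; 0; 0; 0; 0; 0;
  2; 0; 0; 2; 2; 0; 0; 0; 0]; [:: 2; 2; 0; 0; 0; 0; 0; 3; 0; 0; 0; 0; 0; 0; 2; 0; 3; 0; 0; 0; 2;
  0; 0; 2; 0; 0; 2; 3; 0; 0; 3]; [:: 0; 0; 3; 2; 0; 0; 0; 0; 0; 3; 2; 3; 2; 0; 0; 0; 2; 0; 2; 3;
  0; 3; 0; 0; 0; 0; 0; 0; 0; 0; 0]; [:: 0; 0; 0; 0; 0; 0; 0; 2; 0; 0; 0; 2; 0; 0; 0; 2; 3; 2; 0;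
  2; 2; 2; 2; 0; 0; 0; 2; 2; 0; 2; 2]; [:: 0; 2; 2; 2; 2; 0; 2; 2; 2; 2; 0; 0; 0; 0; 0; 0; 0; 2;
  0; 2; 2; 0; 0; 0; 2; 2; 0; 2; 0; 0; 0]; [:: 0; 0; 2; 2; 2; 0; 0; 2; 2; 0; 0; 0; 0; 2; 2; 0; 0;
  2; 2; 2; 2; 0; 0; 2; 2; 0; 0; 0; 0; 2; 2]; [:: 2; 0; 2; 0; 2; 0; 2; 2; 0; 2; 0; 2; 0; 0; 0; 2;
  0; 2; 0; 2; 0; 2; 0; 0; 2; 0; 2; 0; 2; 0; 2]; [:: 2; 0; 2; 0; 2; 0; 2; 2; 0; 2; 0; 2; 0; 2; 0;
  0; 2; 0; 2; 0; 2; 0; 2; 2; 0; 2; 0; 2; 0; 2; 0]; [:: 2; 0; 2; 0; 2; 0; 2; 0; 2; 0; 2; 0; 2; 0;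
  2; 0; 2; 0; 2; 0; 2; 0; 2; 0; 2; 0; 2; 0; 2; 0; 2]; [:: 2; 0; 3; 3; 0; 2; 0; 0; 3; 0; 3; 2; 0;
  2; 0; 2; 0; 3; 0; 0; 2; 0; 2; 2; 0; 2; 0; 0; 2; 0; 2]; [:: 2; 0; 2; 0; 2; 0; 2; 0; 2; 0; 2; 0;
  3; 0; 3; 2; 0; 3; 0; 3; 0; 2; 0; 3; 0; 2; 0; 3; 0; 2; 0]; [:: 0; 0; 0; 0; 0; 0; 0; 2; 3; 2; 2;
  2; 3; 3; 3; 2; 3; 3; 3; 2; 2; 3; 3; 0; 0; 0; 0; 0; 0; 0; 0]; [:: 2; 2; 0; 0; 2; 3; 0; 0; 3; 3;
  0; 0; 3; 2; 0; 0; 2; 3; 0; 0; 3; 3; 0; 0; 2; 3; 0; 0; 3; 3; 0]; [:: 0; 0; 0; 0; 0; 0; 0; 0; 0;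
  0; 0; 0; 0; 0; 0; 3; 3; 3; 2; 2; 3; 3; 3; 3; 3; 2; 2; 4; 3; 3; 3]; [:: 0; 3; 3; 0; 0; 4; 3; 3;
  3; 0; 0; 2; 3; 0; 0; 0; 0; 3; 3; 0; 0; 3; 2; 3; 3; 0; 0; 3; 2; 0; 0]; [:: 0; 2; 3; 0; 0; 3; 3;
  3; 3; 0; 0; 3; 3; 0; 0; 3; 3; 0; 0; 3; 3; 0; 0; 0; 0; 3; 3; 0; 0; 3; 3]; [:: 3; 0; 3; 3; 0; 3;
  0; 0; 3; 0; 3; 3; 0; 3; 0; 0; 3; 0; 3; 3; 0; 3; 0; 0; 3; 0; 3; 3; 0; 3; 0]; [:: 0; 2; 3; 2; 3;
  0; 0; 0; 0; 2; 2; 3; 3; 0; 0; 2; 2; 2; 2; 2; 2; 2; 2; 2; 2; 2; 2; 2; 2; 2; 2]; [:: 3; 0; 3; 2;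
  2; 2; 3; 3; 0; 2; 0; 2; 2; 2; 2; 2; 3; 2; 2; 0; 2; 0; 2; 2; 2; 2; 2; 3; 0; 2; 0]; [:: 2; 3; 2;
  2; 0; 2; 3; 0; 2; 3; 2; 2; 0; 2; 3; 2; 2; 0; 2; 2; 3; 2; 0; 3; 2; 0; 2; 2; 3; 2; 0]; [:: 3; 2;
  2; 2; 2; 3; 0; 2; 2; 3; 0; 0; 3; 2; 2; 0; 3; 2; 2; 2; 2; 3; 0; 2; 2; 3; 0; 0; 3; 2; 2]; [:: 2;
  3; 2; 2; 2; 2; 2; 2; 2; 2; 2; 3; 2; 0; 2; 0; 2; 2; 2; 2; 2; 2; 2; 2; 2; 2; 2; 3; 2; 0; 2]; [::
  2; 2; 2; 2; 2; 2; 2; 2; 2; 2; 2; 2; 2; 2; 2; 2; 2; 2; 2; 2; 2; 2; 2; 2; 2; 2; 2; 2; 2; 2; 0];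
  [:: 2; 2; 2; 2; 2; 2; 2; 3; 2; 2; 2; 2; 2; 2; 2; 2; 2; 3; 2; 2; 2; 2; 2; 2; 2; 0; 2; 2; 2; 2;
  2]; [:: 2; 2; 2; 2; 2; 2; 2; 2; 2; 2; 2; 2; 2; 2; 2; 2; 2; 2; 2; 2; 2; 2; 2; 2; 2; 2; 2; 2; 2;
  2; 2]; [:: 2; 3; 2; 2; 0; 2; 3; 2; 2; 2; 2; 2; 2; 2; 2; 2; 2; 3; 2; 2; 2; 2; 3; 2; 3; 3; 2; 2;
  2; 2; 3]; [:: 2; 3; 3; 3; 2; 2; 2; 3; 3; 0; 2; 2; 2; 3; 2; 0; 2; 3; 3; 3; 2; 2; 2; 3; 3; 0; 2;
  2; 2; 3; 2]; [:: 2; 2; 2; 2; 0; 2; 2; 3; 2; 3; 3; 2; 3; 3; 3; 3; 2; 2; 2; 2; 3; 2; 2; 2; 3; 2;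
  2; 3; 2; 2; 2]; [:: 3; 3; 2; 2; 2; 3; 2; 2; 3; 2; 2; 2; 2; 2; 2; 3; 2; 2; 3; 2; 2; 2; 3; 2; 2;
  2; 3; 3; 2; 2; 3]; [:: 0; 2; 2; 2; 2; 2; 2; 2; 2; 2; 2; 2; 2; 2; 2; 2; 2; 3; 3; 3; 3; 3; 3; 3;
  3; 3; 3; 3; 3; 3; 3]; [:: 3; 2; 2; 3; 2; 3; 2; 3; 2; 3; 2; 3; 3; 2; 3; 3; 2; 3; 3; 2; 2; 2; 2;
  2; 3; 3; 2; 2; 3; 2; 2]; [:: 3; 2; 3; 3; 2; 3; 2; 2; 3; 2; 3; 2; 2; 3; 2; 2; 3; 2; 3; 3; 2; 3;
  2; 2; 3; 2; 3; 3; 2; 3; 2]; [:: 2; 2; 2; 2; 2; 2; 2; 2; 2; 2; 2; 2; 2; 2; 2; 3; 3; 3; 3; 3; 3;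
  3; 3; 3; 3; 3; 3; 3; 3; 3; 3]; [:: 2; 2; 2; 2; 3; 3; 3; 2; 3; 3; 3; 2; 3; 3; 3; 3; 3; 3; 3; 3;
  3; 3; 3; 2; 3; 3; 3; 2; 2; 2; 2]; [:: 3; 3; 3; 3; 3; 3; 2; 2; 2; 3; 3; 3; 3; 3; 2; 2; 2; 3; 3;
  3; 3; 2; 3; 2; 2; 3; 3; 3; 3; 3; 2]; [:: 2; 3; 3; 3; 3; 3; 3; 3; 3; 2; 2; 3; 3; 3; 3; 3; 3; 3;
  3; 2; 2; 3; 3; 3; 3; 3; 3; 3; 2; 2; 2]; [:: 2; 2; 2; 3; 3; 3; 3; 2; 2; 2; 2; 3; 3; 3; 3; 3; 3;
  3; 3; 3; 3; 3; 3; 3; 3; 3; 3; 3; 3; 3; 3]; [:: 3; 3; 3; 3; 3; 3; 3; 2; 3; 3; 3; 2; 3; 3; 3; 3;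
  3; 3; 3; 2; 3; 3; 3; 2; 3; 3; 3; 3; 3; 3; 3]; [:: 3; 3; 3; 3; 3; 3; 3; 2; 3; 3; 3; 3; 3; 3; 3;
  3; 3; 3; 3; 3; 3; 2; 3; 3; 3; 3; 3; 3; 3; 2; 3]; [:: 3; 3; 3; 3; 3; 3; 3; 3; 3; 3; 3; 3; 3; 3;
  3; 3; 3; 3; 3; 3; 2; 3; 3; 3; 3; 3; 3; 3; 3; 3; 3]; [:: 3; 3; 3; 3; 3; 3; 3; 3; 3; 3; 3; 3; 3;
  3; 3; 3; 3; 3; 3; 3; 3; 3; 3; 3; 3; 3; 3; 3; 3; 3; 3]; [:: 3; 3; 3; 3; 3; 4; 3; 3; 3; 3; 4; 3;
  2; 3; 3; 3; 3; 4; 3; 3; 3; 3; 4; 4; 3; 3; 3; 3; 3; 3; 4]; [:: 3; 3; 3; 3; 3; 4; 4; 3; 4; 3; 3;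
  3; 4; 3; 3; 4; 3; 3; 3; 3; 3; 2; 3; 4; 3; 3; 4; 3; 3; 3; 3]; [:: 3; 4; 3; 3; 3; 3; 3; 4; 3; 3;
  4; 2; 3; 4; 4; 3; 4; 4; 3; 4; 4; 3; 3; 4; 3; 2; 3; 3; 3; 3; 3]; [:: 4; 3; 3; 3; 4; 3; 4; 4; 3;
  4; 3; 3; 3; 4; 2; 3; 3; 2; 4; 3; 4; 3; 4; 4; 3; 4; 3; 4; 2; 3; 3]; [:: 3; 4; 4; 4; 4; 3; 3; 4;
  4; 3; 3; 3; 3; 3; 4; 3; 3; 3; 3; 4; 4; 3; 3; 4; 4; 3; 3; 2; 3; 4; 4]; [:: 3; 4; 4; 3; 3; 4; 4;
  4; 4; 3; 3; 4; 4; 2; 3; 3; 2; 4; 4; 3; 3; 4; 4; 4; 4; 3; 3; 4; 4; 3; 2]; [:: 4; 4; 3; 4; 3; 3;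
  4; 4; 3; 3; 4; 3; 4; 4; 3; 3; 4; 4; 3; 4; 3; 3; 3; 4; 3; 3; 4; 3; 4; 4; 3]; [:: 3; 3; 3; 3; 3;
  3; 3; 3; 3; 3; 3; 3; 3; 3; 3; 4; 4; 4; 4; 4; 4; 4; 4; 4; 4; 4; 4; 4; 4; 4; 4]; [:: 4; 4; 3; 4;
  4; 4; 4; 4; 4; 4; 4; 3; 2; 3; 4; 4; 3; 3; 3; 4; 4; 4; 4; 4; 4; 4; 4; 4; 3; 3; 3]; [:: 4; 4; 4;
  4; 3; 4; 4; 3; 3; 4; 4; 4; 3; 4; 4; 3; 3; 4; 4; 4; 3; 4; 4; 3; 3; 4; 4; 3; 4; 4; 4]; [:: 3; 3;
  3; 3; 3; 3; 3; 4; 3; 4; 4; 4; 4; 4; 4; 4; 4; 4; 4; 4; 4; 4; 4; 4; 4; 4; 4; 4; 4; 4; 4]; [:: 4;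
  4; 4; 4; 4; 3; 4; 4; 4; 4; 3; 4; 3; 4; 4; 3; 4; 4; 4; 4; 4; 3; 4; 4; 4; 4; 3; 4; 3; 4; 4]; [::
  4; 4; 4; 3; 4; 4; 4; 4; 4; 4; 4; 4; 4; 4; 4; 4; 4; 4; 4; 4; 3; 4; 4; 3; 4; 4; 4; 3; 4; 4; 4];
  [:: 4; 4; 4; 4; 4; 4; 4; 4; 3; 4; 4; 4; 4; 4; 4; 4; 4; 3; 4; 4; 4; 4; 4; 4; 4; 4; 3; 4; 4; 4;
  4]; [:: 4; 4; 4; 4; 3; 4; 4; 4; 4; 4; 4; 4; 4; 4; 4; 4; 4; 4; 4; 4; 4; 4; 4; 4; 4; 4; 4; 4; 4;
  4; 4]; [:: 4; 4; 4; 4; 4; 4; 4; 4; 4; 4; 4; 4; 4; 4; 4; 4; 4; 4; 4; 4; 4; 4; 4; 4; 4; 4; 4; 4;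
  4; 4; 4]; [:: 4; 3; 4; 5; 4; 5; 4; 4; 4; 4; 4; 5; 5; 4; 4; 3; 4; 4; 4; 5; 4; 5; 4; 4; 4; 4; 4;
  4; 5; 4; 4]; [:: 4; 4; 4; 5; 4; 5; 4; 3; 4; 3; 4; 5; 4; 5; 4; 5; 4; 5; 4; 4; 5; 3; 4; 5; 4; 5;
  4; 3; 5; 4; 4]; [:: 4; 4; 4; 4; 3; 4; 4; 4; 5; 5; 5; 5; 4; 4; 5; 4; 4; 3; 4; 4; 4; 4; 3; 5; 5;
  4; 5; 5; 5; 5; 4]; [:: 3; 4; 4; 4; 4; 4; 4; 4; 4; 5; 5; 4; 4; 4; 4; 4; 4; 5; 5; 5; 5; 5; 5; 4;
  4; 5; 5; 4; 4; 4; 4]; [:: 4; 5; 5; 4; 4; 5; 4; 5; 4; 3; 4; 5; 4; 4; 4; 5; 5; 4; 4; 5; 5; 4; 4;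
  4; 4; 5; 5; 4; 4; 5; 5]; [:: 4; 4; 4; 5; 5; 5; 4; 4; 4; 4; 4; 5; 5; 5; 5; 5; 5; 5; 5; 4; 4; 4;
  4; 5; 4; 5; 5; 4; 4; 3; 4]].

Lemma griesmer_realizable d : 31 < d -> d <> 36 -> d <> 38 ->
  exists t, realizes (griesmer 5 d) d t.
Proof.
elim/ltn_ind: d => d IH d31 d36 d38.
(* For [d > 70] the value [d - 32] is at least 39 and avoids both 36 and 38. The distances 68 and 70
   would descend to these exceptions, which is why they need codes of their own from the table. *)
have [d70|d70] := leqP d 70.
  exists (nth [::] multiplicity_table d.-1).
  have /allP/(_ d) : all (fun d => (d == 36) || (d == 38) ||
      realizes (griesmer 5 d) d (nth [::] multiplicity_table d.-1)) (iota 32 39).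
    by vm_compute.
  rewrite mem_iota d31 ltnS d70 => /(_ isT).
  by move/eqP/negPf: d36 => ->; move/eqP/negPf: d38 => ->.
have [||||t] := IH (d - 32); [lia..|].
move/realizes_add2; rewrite -griesmer_add32 subnK; last by lia.
by exists (map (addn 2) t).
Qed.

(** * Linear maps used in the branchings *)

(** Certificates refer to these maps by position. Positions 0 to 29 move the point 1 to every other
    nonzero point; 30 to 58 fix 1 and move 2 to each of 3, ..., 31; 59 to 85 fix 1, 2 and move 4 to
    each of 5, ..., 31; 86 to 108 fix 1, 2, 4 and move 8 to each of 9, ..., 31; 109 to 123 fix 1, 2,
    4, 8 and move 16 to each of 17, ..., 31. The remaining maps preserve bounds that arise deeper in
    the trees. *)
Definition symmetries : seq (seq nat) :=
  [:: [:: 2; 1; 4; 8; 16]; [:: 3; 1; 4; 8; 16]; [:: 4; 1; 2; 8; 16]; [:: 5; 1; 2; 8; 16]; [:: 6;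
  1; 2; 8; 16]; [:: 7; 1; 2; 8; 16]; [:: 8; 1; 2; 4; 16]; [:: 9; 1; 2; 4; 16]; [:: 10; 1; 2; 4;
  16]; [:: 11; 1; 2; 4; 16]; [:: 12; 1; 2; 4; 16]; [:: 13; 1; 2; 4; 16]; [:: 14; 1; 2; 4; 16];
  [:: 15; 1; 2; 4; 16]; [:: 16; 1; 2; 4; 8]; [:: 17; 1; 2; 4; 8]; [:: 18; 1; 2; 4; 8]; [:: 19;
  1; 2; 4; 8]; [:: 20; 1; 2; 4; 8]; [:: 21; 1; 2; 4; 8]; [:: 22; 1; 2; 4; 8]; [:: 23; 1; 2; 4;
  8]; [:: 24; 1; 2; 4; 8]; [:: 25; 1; 2; 4; 8]; [:: 26; 1; 2; 4; 8]; [:: 27; 1; 2; 4; 8]; [::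
  28; 1; 2; 4; 8]; [:: 29; 1; 2; 4; 8]; [:: 30; 1; 2; 4; 8]; [:: 31; 1; 2; 4; 8]; [:: 1; 3; 4;
  8; 16]; [:: 1; 4; 2; 8; 16]; [:: 1; 5; 2; 8; 16]; [:: 1; 6; 2; 8; 16]; [:: 1; 7; 2; 8; 16];
  [:: 1; 8; 2; 4; 16]; [:: 1; 9; 2; 4; 16]; [:: 1; 10; 2; 4; 16]; [:: 1; 11; 2; 4; 16]; [:: 1;
  12; 2; 4; 16]; [:: 1; 13; 2; 4; 16]; [:: 1; 14; 2; 4; 16]; [:: 1; 15; 2; 4; 16]; [:: 1; 16; 2;
  4; 8]; [:: 1; 17; 2; 4; 8]; [:: 1; 18; 2; 4; 8]; [:: 1; 19; 2; 4; 8]; [:: 1; 20; 2; 4; 8]; [::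
  1; 21; 2; 4; 8]; [:: 1; 22; 2; 4; 8]; [:: 1; 23; 2; 4; 8]; [:: 1; 24; 2; 4; 8]; [:: 1; 25; 2;
  4; 8]; [:: 1; 26; 2; 4; 8]; [:: 1; 27; 2; 4; 8]; [:: 1; 28; 2; 4; 8]; [:: 1; 29; 2; 4; 8]; [::
  1; 30; 2; 4; 8]; [:: 1; 31; 2; 4; 8]; [:: 1; 2; 5; 8; 16]; [:: 1; 2; 6; 8; 16]; [:: 1; 2; 7;
  8; 16]; [:: 1; 2; 8; 4; 16]; [:: 1; 2; 9; 4; 16]; [:: 1; 2; 10; 4; 16]; [:: 1; 2; 11; 4; 16];
  [:: 1; 2; 12; 4; 16]; [:: 1; 2; 13; 4; 16]; [:: 1; 2; 14; 4; 16]; [:: 1; 2; 15; 4; 16]; [:: 1;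
  2; 16; 4; 8]; [:: 1; 2; 17; 4; 8]; [:: 1; 2; 18; 4; 8]; [:: 1; 2; 19; 4; 8]; [:: 1; 2; 20; 4;
  8]; [:: 1; 2; 21; 4; 8]; [:: 1; 2; 22; 4; 8]; [:: 1; 2; 23; 4; 8]; [:: 1; 2; 24; 4; 8]; [:: 1;
  2; 25; 4; 8]; [:: 1; 2; 26; 4; 8]; [:: 1; 2; 27; 4; 8]; [:: 1; 2; 28; 4; 8]; [:: 1; 2; 29; 4;
  8]; [:: 1; 2; 30; 4; 8]; [:: 1; 2; 31; 4; 8]; [:: 1; 2; 4; 9; 16]; [:: 1; 2; 4; 10; 16]; [::
  1; 2; 4; 11; 16]; [:: 1; 2; 4; 12; 16]; [:: 1; 2; 4; 13; 16]; [:: 1; 2; 4; 14; 16]; [:: 1; 2;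
  4; 15; 16]; [:: 1; 2; 4; 16; 8]; [:: 1; 2; 4; 17; 8]; [:: 1; 2; 4; 18; 8]; [:: 1; 2; 4; 19;
  8]; [:: 1; 2; 4; 20; 8]; [:: 1; 2; 4; 21; 8]; [:: 1; 2; 4; 22; 8]; [:: 1; 2; 4; 23; 8]; [:: 1;
  2; 4; 24; 8]; [:: 1; 2; 4; 25; 8]; [:: 1; 2; 4; 26; 8]; [:: 1; 2; 4; 27; 8]; [:: 1; 2; 4; 28;
  8]; [:: 1; 2; 4; 29; 8]; [:: 1; 2; 4; 30; 8]; [:: 1; 2; 4; 31; 8]; [:: 1; 2; 4; 8; 17]; [:: 1;
  2; 4; 8; 18]; [:: 1; 2; 4; 8; 19]; [:: 1; 2; 4; 8; 20]; [:: 1; 2; 4; 8; 21]; [:: 1; 2; 4; 8;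
  22]; [:: 1; 2; 4; 8; 23]; [:: 1; 2; 4; 8; 24]; [:: 1; 2; 4; 8; 25]; [:: 1; 2; 4; 8; 26]; [::
  1; 2; 4; 8; 27]; [:: 1; 2; 4; 8; 28]; [:: 1; 2; 4; 8; 29]; [:: 1; 2; 4; 8; 30]; [:: 1; 2; 4;
  8; 31]; [:: 2; 4; 1; 8; 16]; [:: 2; 8; 1; 4; 16]; [:: 4; 8; 1; 2; 16]; [:: 2; 16; 1; 4; 8];
  [:: 4; 16; 1; 2; 8]; [:: 8; 16; 1; 2; 4]; [:: 1; 4; 8; 2; 16]; [:: 2; 4; 8; 1; 16]; [:: 1; 4;
  16; 2; 8]; [:: 2; 4; 16; 1; 8]; [:: 1; 8; 16; 2; 4]; [:: 2; 8; 16; 1; 4]; [:: 4; 8; 16; 1; 2];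
  [:: 1; 2; 8; 16; 4]; [:: 1; 4; 8; 16; 2]; [:: 2; 4; 8; 16; 1]; [:: 1; 4; 2; 16; 8]; [:: 2; 4;
  1; 16; 8]; [:: 2; 1; 4; 16; 8]; [:: 4; 1; 2; 16; 8]; [:: 8; 15; 1; 2; 16]; [:: 4; 15; 1; 2;
  16]; [:: 2; 15; 1; 4; 16]; [:: 1; 2; 8; 4; 19]; [:: 1; 2; 15; 4; 19]; [:: 2; 1; 8; 4; 16]; [::
  2; 1; 16; 4; 8]; [:: 7; 1; 2; 16; 8]; [:: 1; 7; 2; 16; 8]; [:: 2; 1; 7; 8; 16]; [:: 4; 7; 1;
  8; 16]; [:: 7; 4; 2; 8; 16]; [:: 2; 1; 7; 16; 8]; [:: 4; 7; 1; 16; 8]; [:: 7; 4; 2; 16; 8];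
  [:: 1; 11; 13; 8; 16]; [:: 1; 13; 11; 8; 16]; [:: 11; 2; 4; 8; 16]; [:: 4; 7; 1; 11; 16]; [::
  2; 4; 1; 11; 16]; [:: 2; 1; 4; 11; 16]; [:: 1; 7; 2; 11; 16]; [:: 4; 2; 1; 8; 21]; [:: 4; 1;
  2; 13; 16]; [:: 4; 23; 1; 13; 16]; [:: 2; 23; 1; 11; 16]; [:: 1; 23; 2; 8; 16]; [:: 2; 1; 23;
  11; 16]; [:: 1; 2; 23; 8; 16]; [:: 2; 4; 1; 11; 19]; [:: 2; 4; 1; 19; 11]; [:: 2; 1; 4; 11;
  19]; [:: 4; 1; 2; 13; 21]; [:: 2; 1; 4; 19; 11]; [:: 4; 1; 2; 21; 13]; [:: 2; 1; 4; 8; 19];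
  [:: 4; 1; 2; 8; 21]; [:: 4; 1; 2; 8; 26]; [:: 2; 1; 4; 8; 28]; [:: 8; 11; 4; 1; 16]; [:: 11;
  8; 4; 2; 16]; [:: 16; 2; 21; 8; 1]; [:: 1; 8; 14; 2; 26]; [:: 1; 4; 2; 14; 16]; [:: 1; 2; 7;
  11; 16]; [:: 1; 4; 7; 13; 16]; [:: 2; 4; 7; 13; 16]; [:: 7; 1; 2; 13; 16]; [:: 1; 2; 7; 11;
  19]; [:: 1; 4; 7; 13; 21]; [:: 1; 2; 7; 19; 11]; [:: 1; 4; 7; 21; 13]; [:: 4; 1; 7; 8; 16];
  [:: 7; 2; 4; 8; 16]; [:: 2; 1; 7; 8; 19]; [:: 4; 1; 7; 8; 21]; [:: 7; 2; 4; 8; 22]; [:: 1; 2;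
  11; 7; 16]; [:: 2; 1; 7; 11; 16]; [:: 4; 1; 7; 21; 8]; [:: 4; 7; 1; 8; 21]; [:: 1; 8; 4; 2;
  16]; [:: 4; 13; 1; 2; 21]; [:: 1; 8; 25; 2; 7]; [:: 14; 2; 4; 7; 16]; [:: 1; 2; 19; 8; 7]; [::
  1; 8; 14; 2; 16]; [:: 1; 4; 2; 9; 16]; [:: 3; 1; 4; 16; 8]; [:: 2; 1; 8; 16; 4]; [:: 3; 1; 8;
  16; 4]; [:: 1; 3; 8; 4; 16]; [:: 1; 3; 13; 4; 16]; [:: 2; 1; 4; 22; 8]; [:: 8; 11; 13; 1; 16];
  [:: 8; 11; 13; 1; 22]; [:: 3; 2; 4; 17; 11]; [:: 14; 13; 4; 1; 31]; [:: 8; 11; 4; 1; 25]; [::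
  1; 16; 22; 8; 2]; [:: 14; 31; 22; 1; 13]; [:: 8; 25; 22; 1; 11]; [:: 17; 25; 31; 3; 16]; [::
  17; 25; 31; 5; 16]; [:: 1; 3; 4; 16; 8]; [:: 1; 3; 8; 16; 4]; [:: 1; 2; 16; 11; 4]; [:: 1; 2;
  14; 8; 16]; [:: 1; 2; 22; 8; 16]; [:: 1; 2; 28; 8; 16]; [:: 1; 3; 19; 9; 6]; [:: 1; 3; 19; 9;
  12]; [:: 1; 8; 4; 16; 2]; [:: 1; 2; 4; 11; 19]; [:: 1; 2; 4; 13; 21]; [:: 1; 2; 4; 14; 22];
  [:: 1; 2; 4; 19; 11]; [:: 1; 2; 4; 21; 13]; [:: 1; 2; 4; 22; 14]; [:: 1; 2; 7; 8; 19]; [:: 1;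
  2; 7; 8; 22]; [:: 2; 1; 7; 11; 19]; [:: 1; 2; 13; 8; 25]; [:: 1; 2; 14; 8; 26]; [:: 1; 2; 16;
  8; 4]; [:: 1; 2; 25; 8; 13]; [:: 1; 2; 26; 8; 14]; [:: 1; 2; 7; 11; 22]; [:: 1; 2; 8; 4; 25];
  [:: 1; 2; 11; 7; 26]; [:: 1; 2; 8; 4; 28]; [:: 1; 2; 11; 7; 31]; [:: 1; 13; 4; 7; 16]; [:: 2;
  13; 4; 7; 16]; [:: 4; 8; 1; 2; 21]; [:: 8; 1; 2; 4; 22]; [:: 2; 1; 8; 4; 28]].

Definition symmetry_perms : seq (seq nat) :=
  Eval vm_compute in [seq [seq act g i | i <- iota 0 32] | g <- symmetries].

(** * Infeasibility certificates, indexed by the distance *)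

(** Each tree refutes the length [n] one below the claimed minimum. Nested branchings at the point 1
    determine the largest multiplicity and place it there. The 15 even functionals vanish at 1, and
    their weights add up to 8 times the length outside 1, so [15 d <= 8 (n - m(1))]; the root
    threshold is the integral part of [n - 15 d / 8]. In the same way the seven multiples of 4 bound
    the total multiplicity of 1, 2, 3, and the three multiples of 8 that of the plane spanned by 1,
    2, 4. After branchings at 1, 2, 4, 8, the leaf for the point 16 says that the columns do not all
    lie in one hyperplane. *)
Definition certificate_1 : certificate :=
  Branch 1 7 [:: 0; 1; 2; 3; 4; 5; 6; 7; 8; 9; 10; 11; 12; 13; 14; 15; 16; 17; 18; 19; 20; 21;
  22; 23; 24; 25; 26; 27; 28; 29] (Branch 1 1 [:: 0; 1; 2; 3; 4; 5; 6; 7; 8; 9; 10; 11; 12; 13;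
  14; 15; 16; 17; 18; 19; 20; 21; 22; 23; 24; 25; 26; 27; 28; 29] (Farkas 3 [:: 1; 5; 10; 14;
  19; 23; 24; 28; 31; 31; 31; 31; 31; 31; 31]) (Branch 2 1 [:: 30; 31; 32; 33; 34; 35; 36; 37;
  38; 39; 40; 41; 42; 43; 44; 45; 46; 47; 48; 49; 50; 51; 52; 53; 54; 55; 56; 57; 58] (Farkas 1
  [:: 2; 22; 26; 28; 28]) (Branch 4 1 [:: 59; 60; 61; 62; 63; 64; 65; 66; 67; 68; 69; 70; 71;
  72; 73; 74; 75; 76; 77; 78; 79; 80; 81; 82; 83; 84; 85] (Farkas 1 [:: 12; 20; 24; 28]) (Branch
  8 2 [:: 86; 87; 88; 89; 90; 91; 92; 93; 94; 95; 96; 97; 98; 99; 100; 101; 102; 103; 104; 105;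
  106; 107; 108] (Branch 8 1 [:: 86; 87; 88; 89; 90; 91; 92; 93; 94; 95; 96; 97; 98; 99; 100;
  101; 102; 103; 104; 105; 106; 107; 108] (Farkas 1 [:: 8; 24]) (Farkas 1 [:: 16])) (Farkas 1
  [:: 16]))))) (Farkas 2 [:: 2; 4; 6]).

Definition certificate_3 : certificate :=
  Branch 1 5 [:: 0; 1; 2; 3; 4; 5; 6; 7; 8; 9; 10; 11; 12; 13; 14; 15; 16; 17; 18; 19; 20; 21;
  22; 23; 24; 25; 26; 27; 28; 29] (Branch 1 4 [:: 0; 1; 2; 3; 4; 5; 6; 7; 8; 9; 10; 11; 12; 13;
  14; 15; 16; 17; 18; 19; 20; 21; 22; 23; 24; 25; 26; 27; 28; 29] (Branch 1 1 [:: 0; 1; 2; 3; 4;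
  5; 6; 7; 8; 9; 10; 11; 12; 13; 14; 15; 16; 17; 18; 19; 20; 21; 22; 23; 24; 25; 26; 27; 28; 29]
  (Farkas 3 [:: 1; 5; 14; 19; 21; 23; 24; 28; 31; 31]) (Branch 2 1 [:: 30; 31; 32; 33; 34; 35;
  36; 37; 38; 39; 40; 41; 42; 43; 44; 45; 46; 47; 48; 49; 50; 51; 52; 53; 54; 55; 56; 57; 58]
  (Farkas 2 [:: 14; 22; 26; 28; 30]) (Branch 4 2 [:: 59; 60; 61; 62; 63; 64; 65; 66; 67; 68; 69;
  70; 71; 72; 73; 74; 75; 76; 77; 78; 79; 80; 81; 82; 83; 84; 85] (Branch 4 1 [:: 59; 60; 61;
  62; 63; 64; 65; 66; 67; 68; 69; 70; 71; 72; 73; 74; 75; 76; 77; 78; 79; 80; 81; 82; 83; 84;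
  85] (Farkas 1 [:: 4; 20; 28]) (Farkas 2 [:: 8; 16; 24])) (Farkas 2 [:: 8; 16; 24])))) (Branch
  2 1 [:: 30; 31; 32; 33; 34; 35; 36; 37; 38; 39; 40; 41; 42; 43; 44; 45; 46; 47; 48; 49; 50;
  51; 52; 53; 54; 55; 56; 57; 58] (Farkas 2 [:: 4; 6; 8; 10; 12; 14]) (Farkas 2 [:: 4; 8; 12])))
  (Farkas 4 [:: 2; 4; 6; 8; 10; 12; 14]).

Definition certificate_5 : certificate :=
  Branch 1 6 [:: 0; 1; 2; 3; 4; 5; 6; 7; 8; 9; 10; 11; 12; 13; 14; 15; 16; 17; 18; 19; 20; 21;
  22; 23; 24; 25; 26; 27; 28; 29] (Branch 1 5 [:: 0; 1; 2; 3; 4; 5; 6; 7; 8; 9; 10; 11; 12; 13;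
  14; 15; 16; 17; 18; 19; 20; 21; 22; 23; 24; 25; 26; 27; 28; 29] (Branch 1 4 [:: 0; 1; 2; 3; 4;
  5; 6; 7; 8; 9; 10; 11; 12; 13; 14; 15; 16; 17; 18; 19; 20; 21; 22; 23; 24; 25; 26; 27; 28; 29]
  (Branch 1 3 [:: 0; 1; 2; 3; 4; 5; 6; 7; 8; 9; 10; 11; 12; 13; 14; 15; 16; 17; 18; 19; 20; 21;
  22; 23; 24; 25; 26; 27; 28; 29] (Branch 1 2 [:: 0; 1; 2; 3; 4; 5; 6; 7; 8; 9; 10; 11; 12; 13;
  14; 15; 16; 17; 18; 19; 20; 21; 22; 23; 24; 25; 26; 27; 28; 29] (Branch 1 1 [:: 0; 1; 2; 3; 4;
  5; 6; 7; 8; 9; 10; 11; 12; 13; 14; 15; 16; 17; 18; 19; 20; 21; 22; 23; 24; 25; 26; 27; 28; 29]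
  (Farkas 3 [:: 1; 5; 14; 19; 21; 23; 24; 28; 31; 31]) (Branch 2 1 [:: 30; 31; 32; 33; 34; 35;
  36; 37; 38; 39; 40; 41; 42; 43; 44; 45; 46; 47; 48; 49; 50; 51; 52; 53; 54; 55; 56; 57; 58]
  (Farkas 2 [:: 12; 14; 16; 23; 23; 28; 30]) (Branch 4 1 [:: 59; 60; 61; 62; 63; 64; 65; 66; 67;
  68; 69; 70; 71; 72; 73; 74; 75; 76; 77; 78; 79; 80; 81; 82; 83; 84; 85] (Farkas 2 [:: 6; 6; 8;
  16; 20; 28]) (Branch 8 1 [:: 86; 87; 88; 89; 90; 91; 92; 93; 94; 95; 96; 97; 98; 99; 100; 101;
  102; 103; 104; 105; 106; 107; 108] (Farkas 2 [:: 8; 16; 17; 17; 24]) (Branch 16 1 [:: 109;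
  110; 111; 112; 113; 114; 115; 116; 117; 118; 119; 120; 121; 122; 123] (Farkas 2 [:: 16; 16;
  16]) (Branch 3 1 [:: 31; 124; 35; 125; 126; 43; 127; 128; 129] (Branch 7 1 [:: 62; 130; 131;
  70; 132; 133; 134; 135; 136] (Branch 15 1 [:: 93; 137; 138; 139] (Farkas 3 [:: 1; 1; 2; 5; 8;
  10; 17; 20]) (Branch 23 1 [:: 62; 130; 131] (Farkas 1 [:: 10; 16]) (Farkas 2 [:: 3; 5; 6])))
  (Farkas 2 [:: 8; 16; 24])) (Farkas 2 [:: 4; 8; 12]))))))) (Branch 2 2 [:: 30; 31; 32; 33; 34;
  35; 36; 37; 38; 39; 40; 41; 42; 43; 44; 45; 46; 47; 48; 49; 50; 51; 52; 53; 54; 55; 56; 57;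
  58] (Branch 2 1 [:: 30; 31; 32; 33; 34; 35; 36; 37; 38; 39; 40; 41; 42; 43; 44; 45; 46; 47;
  48; 49; 50; 51; 52; 53; 54; 55; 56; 57; 58] (Farkas 4 [:: 2; 10; 12; 14; 18; 20; 26; 28; 30])
  (Farkas 4 [:: 4; 8; 12; 16; 20; 24; 28])) (Branch 4 2 [:: 59; 60; 61; 62; 63; 64; 65; 66; 67;
  68; 69; 70; 71; 72; 73; 74; 75; 76; 77; 78; 79; 80; 81; 82; 83; 84; 85] (Farkas 4 [:: 4; 8;
  12; 16; 20; 24; 28]) (Farkas 2 [:: 8; 16; 24])))) (Branch 2 3 [:: 30; 31; 32; 33; 34; 35; 36;
  37; 38; 39; 40; 41; 42; 43; 44; 45; 46; 47; 48; 49; 50; 51; 52; 53; 54; 55; 56; 57; 58]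
  (Branch 2 1 [:: 30; 31; 32; 33; 34; 35; 36; 37; 38; 39; 40; 41; 42; 43; 44; 45; 46; 47; 48;
  49; 50; 51; 52; 53; 54; 55; 56; 57; 58] (Farkas 4 [:: 2; 10; 12; 14; 18; 20; 26; 28; 30])
  (Branch 4 2 [:: 59; 60; 61; 62; 63; 64; 65; 66; 67; 68; 69; 70; 71; 72; 73; 74; 75; 76; 77;
  78; 79; 80; 81; 82; 83; 84; 85] (Farkas 4 [:: 4; 8; 12; 16; 20; 24; 28]) (Farkas 2 [:: 8; 16;
  24]))) (Farkas 4 [:: 4; 8; 12; 16; 20; 24; 28]))) (Branch 2 2 [:: 30; 31; 32; 33; 34; 35; 36;
  37; 38; 39; 40; 41; 42; 43; 44; 45; 46; 47; 48; 49; 50; 51; 52; 53; 54; 55; 56; 57; 58]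
  (Farkas 4 [:: 2; 4; 6; 8; 10; 12; 14]) (Farkas 4 [:: 4; 8; 12; 16; 20; 24; 28]))) (Branch 2 1
  [:: 30; 31; 32; 33; 34; 35; 36; 37; 38; 39; 40; 41; 42; 43; 44; 45; 46; 47; 48; 49; 50; 51;
  52; 53; 54; 55; 56; 57; 58] (Farkas 2 [:: 4; 6; 8; 10; 12; 14]) (Farkas 4 [:: 4; 8; 12; 16;
  20; 24; 28]))) (Farkas 8 [:: 2; 4; 6; 8; 10; 12; 14; 16; 18; 20; 22; 24; 26; 28; 30]).

Definition certificate_6 : certificate :=
  Branch 1 5 [:: 0; 1; 2; 3; 4; 5; 6; 7; 8; 9; 10; 11; 12; 13; 14; 15; 16; 17; 18; 19; 20; 21;
  22; 23; 24; 25; 26; 27; 28; 29] (Branch 1 4 [:: 0; 1; 2; 3; 4; 5; 6; 7; 8; 9; 10; 11; 12; 13;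
  14; 15; 16; 17; 18; 19; 20; 21; 22; 23; 24; 25; 26; 27; 28; 29] (Branch 1 1 [:: 0; 1; 2; 3; 4;
  5; 6; 7; 8; 9; 10; 11; 12; 13; 14; 15; 16; 17; 18; 19; 20; 21; 22; 23; 24; 25; 26; 27; 28; 29]
  (Farkas 3 [:: 1; 5; 14; 19; 21; 23; 24; 28; 31; 31]) (Branch 2 1 [:: 30; 31; 32; 33; 34; 35;
  36; 37; 38; 39; 40; 41; 42; 43; 44; 45; 46; 47; 48; 49; 50; 51; 52; 53; 54; 55; 56; 57; 58]
  (Farkas 2 [:: 12; 16; 22; 23; 23; 24; 28; 30]) (Branch 4 1 [:: 59; 60; 61; 62; 63; 64; 65; 66;
  67; 68; 69; 70; 71; 72; 73; 74; 75; 76; 77; 78; 79; 80; 81; 82; 83; 84; 85] (Farkas 2 [:: 6;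
  6; 8; 16; 20; 28]) (Branch 8 1 [:: 86; 87; 88; 89; 90; 91; 92; 93; 94; 95; 96; 97; 98; 99;
  100; 101; 102; 103; 104; 105; 106; 107; 108] (Farkas 2 [:: 8; 16; 17; 17; 24]) (Branch 16 1
  [:: 109; 110; 111; 112; 113; 114; 115; 116; 117; 118; 119; 120; 121; 122; 123] (Farkas 1 [::
  16; 16]) (Branch 15 1 [:: 93; 137; 138; 139] (Branch 7 1 [:: 62; 130; 131; 70; 132; 133; 134;
  135; 136] (Branch 3 1 [:: 31; 124; 35; 125; 126; 43; 127; 128; 129] (Farkas 2 [:: 1; 1; 6; 10;
  20; 24]) (Farkas 3 [:: 3; 4; 8; 16; 24])) (Branch 11 1 [:: 31; 124; 93; 140; 141] (Branch 9 1
  [:: 0; 2; 93; 142; 143] (Farkas 4 [:: 1; 2; 5; 6; 8; 16; 24; 24; 24]) (Farkas 1 [:: 16]))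
  (Farkas 1 [:: 16]))) (Branch 19 1 [:: 31; 124; 144; 35; 125; 145; 126; 146; 42] (Branch 17 1
  [:: 0; 2; 6; 13] (Farkas 1 [:: 10; 16]) (Farkas 4 [:: 2; 4; 6; 8; 10; 12; 16])) (Branch 21 1
  [:: 111; 62; 147; 148; 69] (Farkas 4 [:: 3; 3; 4; 8; 12; 16; 16]) (Farkas 1 [:: 8])))))))))
  (Branch 2 1 [:: 30; 31; 32; 33; 34; 35; 36; 37; 38; 39; 40; 41; 42; 43; 44; 45; 46; 47; 48;
  49; 50; 51; 52; 53; 54; 55; 56; 57; 58] (Farkas 4 [:: 2; 10; 12; 14; 18; 20; 26; 28; 30])
  (Farkas 4 [:: 4; 8; 12; 16; 20; 24; 28]))) (Farkas 8 [:: 2; 4; 6; 8; 10; 12; 14; 16; 18; 20;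
  22; 24; 26; 28; 30]).

Definition certificate_7 : certificate :=
  Branch 1 4 [:: 0; 1; 2; 3; 4; 5; 6; 7; 8; 9; 10; 11; 12; 13; 14; 15; 16; 17; 18; 19; 20; 21;
  22; 23; 24; 25; 26; 27; 28; 29] (Branch 1 3 [:: 0; 1; 2; 3; 4; 5; 6; 7; 8; 9; 10; 11; 12; 13;
  14; 15; 16; 17; 18; 19; 20; 21; 22; 23; 24; 25; 26; 27; 28; 29] (Branch 1 2 [:: 0; 1; 2; 3; 4;
  5; 6; 7; 8; 9; 10; 11; 12; 13; 14; 15; 16; 17; 18; 19; 20; 21; 22; 23; 24; 25; 26; 27; 28; 29]
  (Branch 1 1 [:: 0; 1; 2; 3; 4; 5; 6; 7; 8; 9; 10; 11; 12; 13; 14; 15; 16; 17; 18; 19; 20; 21;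
  22; 23; 24; 25; 26; 27; 28; 29] (Farkas 3 [:: 1; 14; 19; 21; 23; 24; 26; 28; 31]) (Branch 2 1
  [:: 30; 31; 32; 33; 34; 35; 36; 37; 38; 39; 40; 41; 42; 43; 44; 45; 46; 47; 48; 49; 50; 51;
  52; 53; 54; 55; 56; 57; 58] (Farkas 3 [:: 5; 6; 12; 14; 18; 22; 30]) (Branch 4 1 [:: 59; 60;
  61; 62; 63; 64; 65; 66; 67; 68; 69; 70; 71; 72; 73; 74; 75; 76; 77; 78; 79; 80; 81; 82; 83;
  84; 85] (Farkas 2 [:: 8; 12; 24; 28]) (Branch 8 1 [:: 86; 87; 88; 89; 90; 91; 92; 93; 94; 95;
  96; 97; 98; 99; 100; 101; 102; 103; 104; 105; 106; 107; 108] (Farkas 2 [:: 16; 18; 24; 26])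
  (Branch 16 1 [:: 109; 110; 111; 112; 113; 114; 115; 116; 117; 118; 119; 120; 121; 122; 123]
  (Farkas 2 [:: 16; 16; 16]) (Farkas 12 [:: 1; 1; 2; 2; 3; 4; 4; 5; 6; 8; 8; 9; 10; 12; 16; 16;
  17; 18; 20; 24])))))) (Branch 2 2 [:: 30; 31; 32; 33; 34; 35; 36; 37; 38; 39; 40; 41; 42; 43;
  44; 45; 46; 47; 48; 49; 50; 51; 52; 53; 54; 55; 56; 57; 58] (Farkas 8 [:: 2; 4; 6; 8; 10; 12;
  14; 16; 18; 20; 22; 24; 26; 28; 30]) (Farkas 4 [:: 4; 8; 12; 16; 20; 24; 28]))) (Branch 2 1
  [:: 30; 31; 32; 33; 34; 35; 36; 37; 38; 39; 40; 41; 42; 43; 44; 45; 46; 47; 48; 49; 50; 51;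
  52; 53; 54; 55; 56; 57; 58] (Farkas 4 [:: 4; 6; 8; 14; 16; 20; 24; 26; 28; 30]) (Farkas 4 [::
  4; 8; 12; 16; 20; 24; 28]))) (Farkas 8 [:: 2; 4; 6; 8; 10; 12; 14; 16; 18; 20; 22; 24; 26; 28;
  30]).

Definition certificate_8 : certificate :=
  Branch 1 4 [:: 0; 1; 2; 3; 4; 5; 6; 7; 8; 9; 10; 11; 12; 13; 14; 15; 16; 17; 18; 19; 20; 21;
  22; 23; 24; 25; 26; 27; 28; 29] (Branch 1 3 [:: 0; 1; 2; 3; 4; 5; 6; 7; 8; 9; 10; 11; 12; 13;
  14; 15; 16; 17; 18; 19; 20; 21; 22; 23; 24; 25; 26; 27; 28; 29] (Branch 1 1 [:: 0; 1; 2; 3; 4;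
  5; 6; 7; 8; 9; 10; 11; 12; 13; 14; 15; 16; 17; 18; 19; 20; 21; 22; 23; 24; 25; 26; 27; 28; 29]
  (Farkas 3 [:: 1; 14; 19; 21; 23; 24; 26; 28; 31]) (Branch 2 1 [:: 30; 31; 32; 33; 34; 35; 36;
  37; 38; 39; 40; 41; 42; 43; 44; 45; 46; 47; 48; 49; 50; 51; 52; 53; 54; 55; 56; 57; 58]
  (Farkas 2 [:: 5; 6; 14; 18; 22; 30]) (Branch 4 1 [:: 59; 60; 61; 62; 63; 64; 65; 66; 67; 68;
  69; 70; 71; 72; 73; 74; 75; 76; 77; 78; 79; 80; 81; 82; 83; 84; 85] (Farkas 2 [:: 8; 12; 24;
  28]) (Branch 8 1 [:: 86; 87; 88; 89; 90; 91; 92; 93; 94; 95; 96; 97; 98; 99; 100; 101; 102;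
  103; 104; 105; 106; 107; 108] (Farkas 2 [:: 16; 18; 24; 26]) (Branch 16 1 [:: 109; 110; 111;
  112; 113; 114; 115; 116; 117; 118; 119; 120; 121; 122; 123] (Farkas 1 [:: 16; 16]) (Branch 7 1
  [:: 62; 130; 131; 70; 132; 133; 134; 135; 136] (Branch 3 1 [:: 31; 124; 35; 125; 126; 43; 127;
  128; 129] (Farkas 7 [:: 1; 2; 3; 5; 5; 6; 9; 9; 10; 12; 18; 18; 18; 20; 24]) (Farkas 2 [:: 4;
  8; 12])) (Farkas 2 [:: 8; 16; 24]))))))) (Branch 2 1 [:: 30; 31; 32; 33; 34; 35; 36; 37; 38;
  39; 40; 41; 42; 43; 44; 45; 46; 47; 48; 49; 50; 51; 52; 53; 54; 55; 56; 57; 58] (Farkas 4 [::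
  4; 6; 8; 14; 16; 20; 24; 26; 28; 30]) (Farkas 4 [:: 4; 8; 12; 16; 20; 24; 28]))) (Farkas 8 [::
  2; 4; 6; 8; 10; 12; 14; 16; 18; 20; 22; 24; 26; 28; 30]).

Definition certificate_9 : certificate :=
  Branch 1 6 [:: 0; 1; 2; 3; 4; 5; 6; 7; 8; 9; 10; 11; 12; 13; 14; 15; 16; 17; 18; 19; 20; 21;
  22; 23; 24; 25; 26; 27; 28; 29] (Branch 1 5 [:: 0; 1; 2; 3; 4; 5; 6; 7; 8; 9; 10; 11; 12; 13;
  14; 15; 16; 17; 18; 19; 20; 21; 22; 23; 24; 25; 26; 27; 28; 29] (Branch 1 4 [:: 0; 1; 2; 3; 4;
  5; 6; 7; 8; 9; 10; 11; 12; 13; 14; 15; 16; 17; 18; 19; 20; 21; 22; 23; 24; 25; 26; 27; 28; 29]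
  (Branch 1 3 [:: 0; 1; 2; 3; 4; 5; 6; 7; 8; 9; 10; 11; 12; 13; 14; 15; 16; 17; 18; 19; 20; 21;
  22; 23; 24; 25; 26; 27; 28; 29] (Branch 1 2 [:: 0; 1; 2; 3; 4; 5; 6; 7; 8; 9; 10; 11; 12; 13;
  14; 15; 16; 17; 18; 19; 20; 21; 22; 23; 24; 25; 26; 27; 28; 29] (Branch 1 1 [:: 0; 1; 2; 3; 4;
  5; 6; 7; 8; 9; 10; 11; 12; 13; 14; 15; 16; 17; 18; 19; 20; 21; 22; 23; 24; 25; 26; 27; 28; 29]
  (Farkas 4 [:: 6; 11; 14; 15; 19; 22; 23; 27; 28; 31]) (Branch 2 1 [:: 30; 31; 32; 33; 34; 35;
  36; 37; 38; 39; 40; 41; 42; 43; 44; 45; 46; 47; 48; 49; 50; 51; 52; 53; 54; 55; 56; 57; 58]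
  (Farkas 4 [:: 2; 6; 7; 10; 14; 21; 22; 26; 30]) (Branch 4 1 [:: 59; 60; 61; 62; 63; 64; 65;
  66; 67; 68; 69; 70; 71; 72; 73; 74; 75; 76; 77; 78; 79; 80; 81; 82; 83; 84; 85] (Farkas 3 [::
  4; 6; 10; 16; 17; 24; 29]) (Branch 8 1 [:: 86; 87; 88; 89; 90; 91; 92; 93; 94; 95; 96; 97; 98;
  99; 100; 101; 102; 103; 104; 105; 106; 107; 108] (Farkas 2 [:: 2; 10; 16; 24]) (Branch 16 1
  [:: 109; 110; 111; 112; 113; 114; 115; 116; 117; 118; 119; 120; 121; 122; 123] (Farkas 2 [::
  16; 16; 16]) (Branch 7 1 [:: 62; 130; 131; 70; 132; 133; 134; 135; 136] (Farkas 16 [:: 1; 1;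
  1; 2; 2; 2; 3; 3; 3; 4; 5; 6; 7; 8; 8; 9; 9; 10; 10; 12; 12; 16; 16; 17; 17; 18; 18; 20; 20])
  (Farkas 2 [:: 8; 16; 24]))))))) (Branch 2 2 [:: 30; 31; 32; 33; 34; 35; 36; 37; 38; 39; 40;
  41; 42; 43; 44; 45; 46; 47; 48; 49; 50; 51; 52; 53; 54; 55; 56; 57; 58] (Branch 2 1 [:: 30;
  31; 32; 33; 34; 35; 36; 37; 38; 39; 40; 41; 42; 43; 44; 45; 46; 47; 48; 49; 50; 51; 52; 53;
  54; 55; 56; 57; 58] (Farkas 2 [:: 4; 14; 20; 24; 30]) (Branch 4 1 [:: 59; 60; 61; 62; 63; 64;
  65; 66; 67; 68; 69; 70; 71; 72; 73; 74; 75; 76; 77; 78; 79; 80; 81; 82; 83; 84; 85] (Farkas 2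
  [:: 4; 12; 20; 28]) (Branch 8 1 [:: 86; 87; 88; 89; 90; 91; 92; 93; 94; 95; 96; 97; 98; 99;
  100; 101; 102; 103; 104; 105; 106; 107; 108] (Farkas 2 [:: 2; 8; 18; 24]) (Branch 16 1 [::
  109; 110; 111; 112; 113; 114; 115; 116; 117; 118; 119; 120; 121; 122; 123] (Farkas 2 [:: 16;
  16; 16]) (Branch 7 1 [:: 62; 130; 70; 132; 134] (Branch 6 1 [:: 62; 130; 70; 132; 134] (Branch
  3 1 [:: 31; 35; 43] (Farkas 8 [:: 2; 2; 2; 6; 6; 10; 10; 12; 14; 18; 18; 20; 22; 24; 26; 28;
  28]) (Farkas 2 [:: 4; 8; 12])) (Farkas 2 [:: 8; 16; 24])) (Farkas 2 [:: 8; 16; 24]))))))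
  (Branch 4 2 [:: 59; 60; 61; 62; 63; 64; 65; 66; 67; 68; 69; 70; 71; 72; 73; 74; 75; 76; 77;
  78; 79; 80; 81; 82; 83; 84; 85] (Farkas 4 [:: 4; 8; 12; 16; 20; 24; 28]) (Branch 8 2 [:: 86;
  87; 88; 89; 90; 91; 92; 93; 94; 95; 96; 97; 98; 99; 100; 101; 102; 103; 104; 105; 106; 107;
  108] (Farkas 2 [:: 8; 16; 24]) (Branch 16 1 [:: 109; 110; 111; 112; 113; 114; 115; 116; 117;
  118; 119; 120; 121; 122; 123] (Farkas 3 [:: 16; 16; 16; 16]) (Branch 19 1 [:: 31; 124; 35;
  125; 126] (Branch 23 1 [:: 62; 130; 131] (Farkas 6 [:: 1; 2; 4; 8; 9; 10; 12; 16; 16; 24; 24])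
  (Branch 27 1 [:: 31; 124] (Farkas 6 [:: 1; 2; 3; 6; 8; 8; 16; 16; 18; 20]) (Farkas 2 [:: 3;
  17; 18]))) (Farkas 2 [:: 4; 8; 12]))))))) (Branch 2 2 [:: 30; 31; 32; 33; 34; 35; 36; 37; 38;
  39; 40; 41; 42; 43; 44; 45; 46; 47; 48; 49; 50; 51; 52; 53; 54; 55; 56; 57; 58] (Farkas 8 [::
  2; 4; 6; 8; 10; 12; 14; 16; 18; 20; 22; 24; 26; 28; 30]) (Branch 4 2 [:: 59; 60; 61; 62; 63;
  64; 65; 66; 67; 68; 69; 70; 71; 72; 73; 74; 75; 76; 77; 78; 79; 80; 81; 82; 83; 84; 85]
  (Farkas 4 [:: 4; 8; 12; 16; 20; 24; 28]) (Farkas 2 [:: 8; 16; 24])))) (Branch 2 4 [:: 30; 31;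
  32; 33; 34; 35; 36; 37; 38; 39; 40; 41; 42; 43; 44; 45; 46; 47; 48; 49; 50; 51; 52; 53; 54;
  55; 56; 57; 58] (Branch 2 2 [:: 30; 31; 32; 33; 34; 35; 36; 37; 38; 39; 40; 41; 42; 43; 44;
  45; 46; 47; 48; 49; 50; 51; 52; 53; 54; 55; 56; 57; 58] (Farkas 8 [:: 2; 4; 6; 8; 10; 12; 14;
  16; 18; 20; 22; 24; 26; 28; 30]) (Farkas 4 [:: 4; 8; 12; 16; 20; 24; 28])) (Farkas 2 [:: 4; 8;
  12]))) (Branch 2 5 [:: 30; 31; 32; 33; 34; 35; 36; 37; 38; 39; 40; 41; 42; 43; 44; 45; 46; 47;
  48; 49; 50; 51; 52; 53; 54; 55; 56; 57; 58] (Branch 2 4 [:: 30; 31; 32; 33; 34; 35; 36; 37;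
  38; 39; 40; 41; 42; 43; 44; 45; 46; 47; 48; 49; 50; 51; 52; 53; 54; 55; 56; 57; 58] (Branch 2
  1 [:: 30; 31; 32; 33; 34; 35; 36; 37; 38; 39; 40; 41; 42; 43; 44; 45; 46; 47; 48; 49; 50; 51;
  52; 53; 54; 55; 56; 57; 58] (Farkas 2 [:: 4; 6; 8; 10; 12; 14]) (Farkas 4 [:: 4; 8; 12; 16;
  20; 24; 28])) (Farkas 2 [:: 4; 8; 12])) (Farkas 2 [:: 4; 8; 12]))) (Farkas 8 [:: 2; 4; 6; 8;
  10; 12; 14; 16; 18; 20; 22; 24; 26; 28; 30]).

Definition certificate_10 : certificate :=
  Branch 1 5 [:: 0; 1; 2; 3; 4; 5; 6; 7; 8; 9; 10; 11; 12; 13; 14; 15; 16; 17; 18; 19; 20; 21;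
  22; 23; 24; 25; 26; 27; 28; 29] (Branch 1 4 [:: 0; 1; 2; 3; 4; 5; 6; 7; 8; 9; 10; 11; 12; 13;
  14; 15; 16; 17; 18; 19; 20; 21; 22; 23; 24; 25; 26; 27; 28; 29] (Branch 1 1 [:: 0; 1; 2; 3; 4;
  5; 6; 7; 8; 9; 10; 11; 12; 13; 14; 15; 16; 17; 18; 19; 20; 21; 22; 23; 24; 25; 26; 27; 28; 29]
  (Farkas 3 [:: 1; 14; 19; 21; 23; 24; 26; 28; 31]) (Branch 2 1 [:: 30; 31; 32; 33; 34; 35; 36;
  37; 38; 39; 40; 41; 42; 43; 44; 45; 46; 47; 48; 49; 50; 51; 52; 53; 54; 55; 56; 57; 58]
  (Farkas 2 [:: 7; 10; 11; 16; 22; 30]) (Branch 4 1 [:: 59; 60; 61; 62; 63; 64; 65; 66; 67; 68;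
  69; 70; 71; 72; 73; 74; 75; 76; 77; 78; 79; 80; 81; 82; 83; 84; 85] (Farkas 2 [:: 4; 16; 17;
  24; 29]) (Branch 8 1 [:: 86; 87; 88; 89; 90; 91; 92; 93; 94; 95; 96; 97; 98; 99; 100; 101;
  102; 103; 104; 105; 106; 107; 108] (Farkas 2 [:: 2; 8; 10; 24; 24]) (Branch 16 1 [:: 109; 110;
  111; 112; 113; 114; 115; 116; 117; 118; 119; 120; 121; 122; 123] (Farkas 1 [:: 16; 16])
  (Branch 7 1 [:: 62; 130; 131; 70; 132; 133; 134; 135; 136] (Branch 3 1 [:: 31; 124; 35; 125;
  126; 43; 127; 128; 129] (Farkas 2 [:: 3; 6; 12; 17; 24]) (Branch 5 1 [:: 0; 62; 149; 70; 150]
  (Farkas 6 [:: 3; 3; 4; 8; 8; 12; 12; 16; 20; 24; 24]) (Farkas 2 [:: 8; 16; 24]))) (Branch 9 2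
  [:: 0; 2; 5; 93; 142; 143; 151] (Branch 11 3 [:: 31; 34; 93; 140; 152] (Branch 1 3 [:: 0; 2;
  5] (Branch 25 3 [:: 0; 2; 5] (Branch 3 1 [:: 31; 34] (Branch 11 2 [:: 31; 34; 93; 140; 152]
  (Branch 24 2 [::] (Branch 9 1 [:: 153; 154; 155; 93; 156; 157; 158] (Branch 11 1 [:: 31; 34;
  93; 140; 152] (Farkas 4 [:: 1; 2; 3; 4; 5; 6; 7; 24; 24; 24; 24]) (Branch 13 1 [:: 61] (Branch
  1 2 [:: 153; 154; 155] (Branch 25 1 [:: 153; 154; 155] (Farkas 1 [:: 3; 7; 19]) (Branch 29 2
  [:: 61] (Branch 28 1 [:: 61] (Farkas 4 [:: 4; 4; 8; 16; 19; 19; 24]) (Branch 26 1 [:: 154]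
  (Branch 25 2 [:: 154] (Branch 27 1 [::] (Branch 30 1 [::] (Farkas 2 [:: 2; 3; 8; 19; 26])
  (Farkas 2 [:: 13; 21; 24])) (Farkas 2 [:: 4; 9; 13])) (Farkas 6 [:: 2; 2; 3; 4; 6; 8; 13; 19;
  21; 24; 26])) (Farkas 2 [:: 4; 19; 24]))) (Farkas 2 [:: 2; 9; 19; 24]))) (Farkas 2 [:: 4; 8;
  20; 24])) (Branch 1 2 [:: 153; 154; 155] (Branch 25 2 [:: 153; 154; 155] (Branch 25 1 [:: 153;
  154; 155] (Farkas 1 [:: 7; 16]) (Branch 27 1 [:: 31] (Branch 19 1 [:: 31; 159; 160] (Farkas 4
  [:: 6; 9; 9; 16; 16; 24; 30]) (Branch 21 1 [:: 161] (Farkas 2 [:: 4; 16; 21]) (Farkas 4 [:: 2;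
  4; 8; 16; 30]))) (Farkas 2 [:: 4; 9; 13]))) (Farkas 10 [:: 2; 2; 4; 4; 9; 9; 16; 16; 16; 16;
  19; 21; 24; 30])) (Farkas 1 [:: 16])))) (Branch 11 1 [:: 31; 34] (Branch 10 1 [:: 31; 34]
  (Branch 2 2 [:: 31; 34] (Branch 27 3 [:: 31; 34] (Branch 1 2 [::] (Branch 8 2 [::] (Branch 16
  3 [::] (Branch 16 2 [::] (Branch 17 1 [::] (Branch 25 1 [::] (Branch 24 1 [::] (Farkas 2 [::
  6; 18; 20; 22; 22]) (Farkas 2 [:: 2; 4; 6])) (Farkas 2 [:: 2; 4; 6])) (Farkas 2 [:: 2; 4; 6]))
  (Farkas 2 [:: 2; 8; 18; 24])) (Farkas 2 [:: 2; 4; 6])) (Farkas 4 [:: 2; 4; 6; 16; 18; 20;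
  22])) (Farkas 4 [:: 2; 4; 6; 16; 18; 20; 22])) (Farkas 2 [:: 4; 9; 13])) (Farkas 2 [:: 4; 8;
  20; 24])) (Farkas 2 [:: 4; 16; 20])) (Farkas 2 [:: 4; 16; 20]))) (Farkas 4 [:: 1; 2; 3; 4; 5;
  6; 7])) (Branch 13 1 [:: 61] (Farkas 2 [:: 3; 4; 19; 20]) (Farkas 1 [:: 16]))) (Farkas 2 [::
  8; 16; 24])) (Farkas 2 [:: 2; 4; 6])) (Farkas 2 [:: 8; 16; 24])) (Farkas 2 [:: 3; 16; 19]))
  (Farkas 4 [:: 2; 4; 6; 16; 18; 20; 22])))))))) (Branch 2 1 [:: 30; 31; 32; 33; 34; 35; 36; 37;
  38; 39; 40; 41; 42; 43; 44; 45; 46; 47; 48; 49; 50; 51; 52; 53; 54; 55; 56; 57; 58] (Farkas 4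
  [:: 4; 6; 8; 14; 16; 20; 24; 26; 28; 30]) (Farkas 4 [:: 4; 8; 12; 16; 20; 24; 28]))) (Farkas 8
  [:: 2; 4; 6; 8; 10; 12; 14; 16; 18; 20; 22; 24; 26; 28; 30]).

Definition certificate_11 : certificate :=
  Branch 1 5 [:: 0; 1; 2; 3; 4; 5; 6; 7; 8; 9; 10; 11; 12; 13; 14; 15; 16; 17; 18; 19; 20; 21;
  22; 23; 24; 25; 26; 27; 28; 29] (Branch 1 4 [:: 0; 1; 2; 3; 4; 5; 6; 7; 8; 9; 10; 11; 12; 13;
  14; 15; 16; 17; 18; 19; 20; 21; 22; 23; 24; 25; 26; 27; 28; 29] (Branch 1 3 [:: 0; 1; 2; 3; 4;
  5; 6; 7; 8; 9; 10; 11; 12; 13; 14; 15; 16; 17; 18; 19; 20; 21; 22; 23; 24; 25; 26; 27; 28; 29]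
  (Branch 1 2 [:: 0; 1; 2; 3; 4; 5; 6; 7; 8; 9; 10; 11; 12; 13; 14; 15; 16; 17; 18; 19; 20; 21;
  22; 23; 24; 25; 26; 27; 28; 29] (Branch 1 1 [:: 0; 1; 2; 3; 4; 5; 6; 7; 8; 9; 10; 11; 12; 13;
  14; 15; 16; 17; 18; 19; 20; 21; 22; 23; 24; 25; 26; 27; 28; 29] (Farkas 5 [:: 1; 7; 11; 13;
  14; 15; 19; 21; 22; 23; 26; 28; 31; 31]) (Branch 2 1 [:: 30; 31; 32; 33; 34; 35; 36; 37; 38;
  39; 40; 41; 42; 43; 44; 45; 46; 47; 48; 49; 50; 51; 52; 53; 54; 55; 56; 57; 58] (Farkas 5 [::
  2; 5; 6; 7; 8; 12; 13; 16; 17; 21; 26; 30; 31]) (Branch 4 1 [:: 59; 60; 61; 62; 63; 64; 65;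
  66; 67; 68; 69; 70; 71; 72; 73; 74; 75; 76; 77; 78; 79; 80; 81; 82; 83; 84; 85] (Farkas 5 [::
  1; 4; 5; 12; 17; 18; 20; 21; 22; 24; 26; 28; 28; 30]) (Branch 8 1 [:: 86; 87; 88; 89; 90; 91;
  92; 93; 94; 95; 96; 97; 98; 99; 100; 101; 102; 103; 104; 105; 106; 107; 108] (Farkas 4 [:: 1;
  8; 12; 14; 16; 16; 20; 22; 26]) (Branch 16 1 [:: 109; 110; 111; 112; 113; 114; 115; 116; 117;
  118; 119; 120; 121; 122; 123] (Farkas 1 [:: 16; 16]) (Branch 7 1 [:: 62; 130; 131; 70; 132;
  133; 134; 135; 136] (Farkas 8 [:: 1; 2; 3; 4; 5; 8; 9; 10; 12; 16; 17; 18; 20; 24; 25; 31;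
  31]) (Branch 9 1 [:: 0; 2; 5; 93; 142; 143; 151] (Branch 11 1 [:: 31; 34; 93; 140; 152]
  (Farkas 6 [:: 1; 3; 5; 6; 8; 16; 17; 19; 21; 22; 24; 24]) (Branch 25 1 [:: 88; 154; 162]
  (Farkas 8 [:: 1; 3; 3; 4; 5; 7; 7; 8; 9; 12; 13; 16; 16; 20; 20]) (Branch 13 1 [:: 61] (Farkas
  4 [:: 2; 3; 4; 6; 8; 19; 24]) (Farkas 7 [:: 2; 4; 9; 16; 16; 16; 19; 21; 24; 30])))) (Farkas 4
  [:: 2; 4; 6; 16; 18; 20; 22])))))))) (Branch 2 2 [:: 30; 31; 32; 33; 34; 35; 36; 37; 38; 39;
  40; 41; 42; 43; 44; 45; 46; 47; 48; 49; 50; 51; 52; 53; 54; 55; 56; 57; 58] (Farkas 8 [:: 2;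
  4; 6; 8; 10; 12; 14; 16; 18; 20; 22; 24; 26; 28; 30]) (Branch 4 2 [:: 59; 60; 61; 62; 63; 64;
  65; 66; 67; 68; 69; 70; 71; 72; 73; 74; 75; 76; 77; 78; 79; 80; 81; 82; 83; 84; 85] (Farkas 4
  [:: 4; 8; 12; 16; 20; 24; 28]) (Branch 8 2 [:: 86; 87; 88; 89; 90; 91; 92; 93; 94; 95; 96; 97;
  98; 99; 100; 101; 102; 103; 104; 105; 106; 107; 108] (Farkas 2 [:: 8; 16; 24]) (Branch 16 1
  [:: 109; 110; 111; 112; 113; 114; 115; 116; 117; 118; 119; 120; 121; 122; 123] (Farkas 3 [::
  16; 16; 16; 16]) (Branch 19 1 [:: 31; 124; 35; 125; 126] (Branch 17 1 [:: 0; 2; 6] (Farkas 6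
  [:: 1; 3; 4; 5; 12; 16; 16; 17; 18; 20; 24]) (Farkas 2 [:: 2; 4; 6])) (Farkas 2 [:: 4; 8;
  12]))))))) (Branch 2 2 [:: 30; 31; 32; 33; 34; 35; 36; 37; 38; 39; 40; 41; 42; 43; 44; 45; 46;
  47; 48; 49; 50; 51; 52; 53; 54; 55; 56; 57; 58] (Farkas 8 [:: 2; 4; 6; 8; 10; 12; 14; 16; 18;
  20; 22; 24; 26; 28; 30]) (Farkas 4 [:: 4; 8; 12; 16; 20; 24; 28]))) (Branch 2 1 [:: 30; 31;
  32; 33; 34; 35; 36; 37; 38; 39; 40; 41; 42; 43; 44; 45; 46; 47; 48; 49; 50; 51; 52; 53; 54;
  55; 56; 57; 58] (Farkas 2 [:: 4; 6; 8; 10; 12; 14]) (Farkas 4 [:: 4; 8; 12; 16; 20; 24; 28])))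
  (Farkas 8 [:: 2; 4; 6; 8; 10; 12; 14; 16; 18; 20; 22; 24; 26; 28; 30]).

Definition certificate_12 : certificate :=
  Branch 1 4 [:: 0; 1; 2; 3; 4; 5; 6; 7; 8; 9; 10; 11; 12; 13; 14; 15; 16; 17; 18; 19; 20; 21;
  22; 23; 24; 25; 26; 27; 28; 29] (Branch 1 3 [:: 0; 1; 2; 3; 4; 5; 6; 7; 8; 9; 10; 11; 12; 13;
  14; 15; 16; 17; 18; 19; 20; 21; 22; 23; 24; 25; 26; 27; 28; 29] (Branch 1 1 [:: 0; 1; 2; 3; 4;
  5; 6; 7; 8; 9; 10; 11; 12; 13; 14; 15; 16; 17; 18; 19; 20; 21; 22; 23; 24; 25; 26; 27; 28; 29]
  (Farkas 5 [:: 1; 7; 11; 13; 14; 15; 19; 21; 22; 23; 26; 28; 31; 31]) (Branch 2 1 [:: 30; 31;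
  32; 33; 34; 35; 36; 37; 38; 39; 40; 41; 42; 43; 44; 45; 46; 47; 48; 49; 50; 51; 52; 53; 54;
  55; 56; 57; 58] (Farkas 3 [:: 5; 6; 7; 12; 13; 16; 26; 30]) (Branch 4 1 [:: 59; 60; 61; 62;
  63; 64; 65; 66; 67; 68; 69; 70; 71; 72; 73; 74; 75; 76; 77; 78; 79; 80; 81; 82; 83; 84; 85]
  (Farkas 5 [:: 1; 4; 5; 12; 17; 18; 20; 21; 22; 24; 26; 28; 28; 30]) (Branch 8 1 [:: 86; 87;
  88; 89; 90; 91; 92; 93; 94; 95; 96; 97; 98; 99; 100; 101; 102; 103; 104; 105; 106; 107; 108]
  (Farkas 4 [:: 1; 8; 12; 14; 16; 16; 20; 22; 26]) (Branch 16 1 [:: 109; 110; 111; 112; 113;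
  114; 115; 116; 117; 118; 119; 120; 121; 122; 123] (Farkas 1 [:: 16; 16]) (Branch 7 1 [:: 62;
  130; 131; 70; 132; 133; 134; 135; 136] (Branch 3 1 [:: 31; 124; 35; 125; 126; 43; 127; 128;
  129] (Farkas 7 [:: 1; 2; 3; 3; 4; 5; 5; 8; 10; 10; 12; 12; 17; 18; 20; 24; 31; 31]) (Farkas 4
  [:: 3; 4; 8; 12; 16; 20; 24; 31])) (Branch 9 2 [:: 0; 2; 5; 93; 142; 143; 151] (Branch 3 1 [::
  31; 34] (Branch 9 1 [:: 153; 154; 155; 93; 156; 157; 158] (Branch 11 1 [:: 31; 34; 93; 140;
  152] (Farkas 2 [:: 1; 8; 17; 24]) (Branch 25 1 [:: 88; 154; 162] (Farkas 2 [:: 3; 7; 16; 20])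
  (Branch 13 1 [:: 61] (Farkas 2 [:: 3; 4; 19; 20]) (Branch 26 1 [:: 31; 163] (Farkas 2 [:: 7;
  9; 16; 30]) (Branch 28 1 [:: 164] (Farkas 2 [:: 4; 7; 16; 19]) (Branch 19 1 [:: 31; 165]
  (Farkas 2 [:: 1; 14; 23; 24]) (Farkas 1 [:: 4]))))))) (Branch 11 1 [:: 31; 34] (Branch 10 1
  [:: 31; 34] (Farkas 2 [:: 6; 8; 22; 24]) (Farkas 2 [:: 4; 16; 20])) (Farkas 2 [:: 4; 16;
  20]))) (Farkas 2 [:: 8; 16; 24])) (Farkas 4 [:: 2; 4; 6; 16; 18; 20; 22])))))))) (Branch 2 2
  [:: 30; 31; 32; 33; 34; 35; 36; 37; 38; 39; 40; 41; 42; 43; 44; 45; 46; 47; 48; 49; 50; 51;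
  52; 53; 54; 55; 56; 57; 58] (Farkas 8 [:: 2; 4; 6; 8; 10; 12; 14; 16; 18; 20; 22; 24; 26; 28;
  30]) (Farkas 4 [:: 4; 8; 12; 16; 20; 24; 28]))) (Farkas 8 [:: 2; 4; 6; 8; 10; 12; 14; 16; 18;
  20; 22; 24; 26; 28; 30]).

Definition certificate_13 : certificate :=
  Branch 1 4 [:: 0; 1; 2; 3; 4; 5; 6; 7; 8; 9; 10; 11; 12; 13; 14; 15; 16; 17; 18; 19; 20; 21;
  22; 23; 24; 25; 26; 27; 28; 29] (Branch 1 3 [:: 0; 1; 2; 3; 4; 5; 6; 7; 8; 9; 10; 11; 12; 13;
  14; 15; 16; 17; 18; 19; 20; 21; 22; 23; 24; 25; 26; 27; 28; 29] (Branch 1 2 [:: 0; 1; 2; 3; 4;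
  5; 6; 7; 8; 9; 10; 11; 12; 13; 14; 15; 16; 17; 18; 19; 20; 21; 22; 23; 24; 25; 26; 27; 28; 29]
  (Branch 1 1 [:: 0; 1; 2; 3; 4; 5; 6; 7; 8; 9; 10; 11; 12; 13; 14; 15; 16; 17; 18; 19; 20; 21;
  22; 23; 24; 25; 26; 27; 28; 29] (Farkas 6 [:: 7; 11; 13; 14; 15; 19; 22; 23; 26; 27; 28; 29;
  30; 31]) (Farkas 8 [:: 2; 4; 6; 8; 10; 12; 14; 16; 18; 20; 22; 24; 26; 28; 30])) (Branch 2 2
  [:: 30; 31; 32; 33; 34; 35; 36; 37; 38; 39; 40; 41; 42; 43; 44; 45; 46; 47; 48; 49; 50; 51;
  52; 53; 54; 55; 56; 57; 58] (Farkas 8 [:: 2; 4; 6; 8; 10; 12; 14; 16; 18; 20; 22; 24; 26; 28;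
  30]) (Branch 4 2 [:: 59; 60; 61; 62; 63; 64; 65; 66; 67; 68; 69; 70; 71; 72; 73; 74; 75; 76;
  77; 78; 79; 80; 81; 82; 83; 84; 85] (Farkas 4 [:: 4; 8; 12; 16; 20; 24; 28]) (Branch 8 2 [::
  86; 87; 88; 89; 90; 91; 92; 93; 94; 95; 96; 97; 98; 99; 100; 101; 102; 103; 104; 105; 106;
  107; 108] (Farkas 2 [:: 8; 16; 24]) (Branch 16 2 [:: 109; 110; 111; 112; 113; 114; 115; 116;
  117; 118; 119; 120; 121; 122; 123] (Branch 16 1 [:: 109; 110; 111; 112; 113; 114; 115; 116;
  117; 118; 119; 120; 121; 122; 123] (Farkas 2 [:: 16; 16; 16]) (Branch 19 1 [:: 31; 124; 35;
  125; 126] (Farkas 8 [:: 1; 2; 3; 4; 5; 8; 10; 12; 16; 16; 17; 18; 20; 24]) (Farkas 2 [:: 4; 8;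
  12]))) (Farkas 12 [:: 1; 1; 2; 2; 3; 4; 4; 5; 6; 8; 8; 9; 10; 12; 16; 16; 17; 18; 20;
  24])))))) (Branch 2 2 [:: 30; 31; 32; 33; 34; 35; 36; 37; 38; 39; 40; 41; 42; 43; 44; 45; 46;
  47; 48; 49; 50; 51; 52; 53; 54; 55; 56; 57; 58] (Farkas 4 [:: 2; 4; 6; 8; 10; 12; 14]) (Farkas
  4 [:: 4; 8; 12; 16; 20; 24; 28]))) (Farkas 8 [:: 2; 4; 6; 8; 10; 12; 14; 16; 18; 20; 22; 24;
  26; 28; 30]).

(** Here [n = 31]. If all multiplicities are at most 2 they are even, so the weights are at least 16
    and the length is at most 30; summing all weights gives [31 * 16 <= 16 * 30], which is false. If
    [m(1) >= 3], the even functionals give [15 * 15 <= 8 * 28], also false. The same tree serves the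
    distances 23, 24, 28 and 30. *)
Definition certificate_15 : certificate :=
  Branch 1 2 [:: 0; 1; 2; 3; 4; 5; 6; 7; 8; 9; 10; 11; 12; 13; 14; 15; 16; 17; 18; 19; 20; 21;
  22; 23; 24; 25; 26; 27; 28; 29] (Farkas 16 [:: 1; 2; 3; 4; 5; 6; 7; 8; 9; 10; 11; 12; 13; 14;
  15; 16; 17; 18; 19; 20; 21; 22; 23; 24; 25; 26; 27; 28; 29; 30; 31]) (Farkas 8 [:: 2; 4; 6; 8;
  10; 12; 14; 16; 18; 20; 22; 24; 26; 28; 30]).

Definition certificate_17 : certificate :=
  Branch 1 4 [:: 0; 1; 2; 3; 4; 5; 6; 7; 8; 9; 10; 11; 12; 13; 14; 15; 16; 17; 18; 19; 20; 21;
  22; 23; 24; 25; 26; 27; 28; 29] (Branch 1 3 [:: 0; 1; 2; 3; 4; 5; 6; 7; 8; 9; 10; 11; 12; 13;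
  14; 15; 16; 17; 18; 19; 20; 21; 22; 23; 24; 25; 26; 27; 28; 29] (Branch 1 1 [:: 0; 1; 2; 3; 4;
  5; 6; 7; 8; 9; 10; 11; 12; 13; 14; 15; 16; 17; 18; 19; 20; 21; 22; 23; 24; 25; 26; 27; 28; 29]
  (Farkas 6 [:: 7; 11; 13; 14; 15; 19; 22; 23; 26; 27; 28; 29; 30; 31]) (Branch 2 2 [:: 30; 31;
  32; 33; 34; 35; 36; 37; 38; 39; 40; 41; 42; 43; 44; 45; 46; 47; 48; 49; 50; 51; 52; 53; 54;
  55; 56; 57; 58] (Branch 2 1 [:: 30; 31; 32; 33; 34; 35; 36; 37; 38; 39; 40; 41; 42; 43; 44;
  45; 46; 47; 48; 49; 50; 51; 52; 53; 54; 55; 56; 57; 58] (Farkas 3 [:: 4; 6; 8; 10; 16; 18; 28;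
  30]) (Branch 3 1 [::] (Branch 4 1 [:: 59; 60; 61; 62; 63; 64; 65; 66; 67; 68; 69; 70; 71; 72;
  73; 74; 75; 76; 77; 78; 79; 80; 81; 82; 83; 84; 85] (Farkas 3 [:: 4; 5; 12; 13; 16; 17; 24;
  25]) (Branch 8 1 [:: 86; 87; 88; 89; 90; 91; 92; 93; 94; 95; 96; 97; 98; 99; 100; 101; 102;
  103; 104; 105; 106; 107; 108] (Farkas 3 [:: 2; 3; 10; 11; 16; 17; 24; 25]) (Branch 16 1 [::
  109; 110; 111; 112; 113; 114; 115; 116; 117; 118; 119; 120; 121; 122; 123] (Farkas 1 [:: 16;
  16]) (Branch 5 1 [:: 62; 70] (Farkas 8 [:: 6; 10; 12; 14; 14; 18; 20; 22; 22; 24; 26; 26; 28;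
  28; 30; 30; 30]) (Farkas 4 [:: 2; 8; 10; 16; 18; 24; 26]))))) (Farkas 4 [:: 4; 8; 12; 16; 20;
  24; 28]))) (Branch 4 2 [:: 59; 60; 61; 62; 63; 64; 65; 66; 67; 68; 69; 70; 71; 72; 73; 74; 75;
  76; 77; 78; 79; 80; 81; 82; 83; 84; 85] (Farkas 4 [:: 4; 8; 12; 16; 20; 24; 28]) (Branch 8 2
  [:: 86; 87; 88; 89; 90; 91; 92; 93; 94; 95; 96; 97; 98; 99; 100; 101; 102; 103; 104; 105; 106;
  107; 108] (Farkas 4 [:: 1; 8; 9; 16; 17; 24; 25]) (Branch 14 1 [::] (Farkas 8 [:: 1; 2; 3; 4;
  5; 8; 9; 16; 17; 18; 19; 20; 21; 24; 25]) (Farkas 2 [:: 1; 16; 17])))))) (Branch 2 2 [:: 30;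
  31; 32; 33; 34; 35; 36; 37; 38; 39; 40; 41; 42; 43; 44; 45; 46; 47; 48; 49; 50; 51; 52; 53;
  54; 55; 56; 57; 58] (Farkas 8 [:: 2; 4; 6; 8; 10; 12; 14; 16; 18; 20; 22; 24; 26; 28; 30])
  (Farkas 4 [:: 4; 8; 12; 16; 20; 24; 28]))) (Farkas 8 [:: 2; 4; 6; 8; 10; 12; 14; 16; 18; 20;
  22; 24; 26; 28; 30]).

Definition certificate_18 : certificate :=
  Branch 1 3 [:: 0; 1; 2; 3; 4; 5; 6; 7; 8; 9; 10; 11; 12; 13; 14; 15; 16; 17; 18; 19; 20; 21;
  22; 23; 24; 25; 26; 27; 28; 29] (Branch 1 2 [:: 0; 1; 2; 3; 4; 5; 6; 7; 8; 9; 10; 11; 12; 13;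
  14; 15; 16; 17; 18; 19; 20; 21; 22; 23; 24; 25; 26; 27; 28; 29] (Branch 1 1 [:: 0; 1; 2; 3; 4;
  5; 6; 7; 8; 9; 10; 11; 12; 13; 14; 15; 16; 17; 18; 19; 20; 21; 22; 23; 24; 25; 26; 27; 28; 29]
  (Farkas 6 [:: 7; 11; 13; 14; 15; 19; 22; 23; 26; 27; 28; 29; 30; 31]) (Branch 2 1 [:: 30; 31;
  32; 33; 34; 35; 36; 37; 38; 39; 40; 41; 42; 43; 44; 45; 46; 47; 48; 49; 50; 51; 52; 53; 54;
  55; 56; 57; 58] (Farkas 7 [:: 1; 2; 3; 4; 6; 8; 10; 11; 12; 13; 14; 17; 18; 19; 20; 22; 24;
  26; 27; 28; 29; 30]) (Branch 3 1 [::] (Branch 4 1 [:: 59; 60; 61; 62; 63; 64; 65; 66; 67; 68;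
  69; 70; 71; 72; 73; 74; 75; 76; 77; 78; 79; 80; 81; 82; 83; 84; 85] (Farkas 3 [:: 4; 5; 12;
  13; 20; 21; 28; 29]) (Branch 8 1 [:: 86; 87; 88; 89; 90; 91; 92; 93; 94; 95; 96; 97; 98; 99;
  100; 101; 102; 103; 104; 105; 106; 107; 108] (Farkas 7 [:: 2; 3; 5; 6; 7; 8; 9; 11; 15; 18;
  19; 22; 24; 28; 30; 31]) (Branch 16 1 [:: 109; 110; 111; 112; 113; 114; 115; 116; 117; 118;
  119; 120; 121; 122; 123] (Farkas 1 [:: 16; 16]) (Branch 5 1 [:: 0; 62; 149; 70; 150] (Farkas
  24 [:: 1; 1; 1; 2; 3; 3; 3; 5; 5; 6; 6; 7; 7; 8; 9; 10; 10; 10; 11; 12; 12; 14; 14; 14; 14;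
  16; 17; 17; 17; 18; 19; 20; 20; 21; 21; 22; 22; 24; 25; 25; 25; 26; 27; 28; 28; 29; 29; 30;
  30]) (Farkas 4 [:: 2; 8; 10; 16; 18; 24; 26]))))) (Farkas 4 [:: 4; 8; 12; 16; 20; 24; 28]))))
  (Branch 2 2 [:: 30; 31; 32; 33; 34; 35; 36; 37; 38; 39; 40; 41; 42; 43; 44; 45; 46; 47; 48;
  49; 50; 51; 52; 53; 54; 55; 56; 57; 58] (Branch 2 1 [:: 30; 31; 32; 33; 34; 35; 36; 37; 38;
  39; 40; 41; 42; 43; 44; 45; 46; 47; 48; 49; 50; 51; 52; 53; 54; 55; 56; 57; 58] (Farkas 7 [::
  1; 2; 3; 4; 6; 8; 10; 11; 12; 13; 14; 17; 18; 19; 20; 22; 24; 26; 27; 28; 29; 30]) (Branch 3 1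
  [::] (Branch 4 1 [:: 59; 60; 61; 62; 63; 64; 65; 66; 67; 68; 69; 70; 71; 72; 73; 74; 75; 76;
  77; 78; 79; 80; 81; 82; 83; 84; 85] (Farkas 3 [:: 4; 5; 12; 13; 20; 21; 28; 29]) (Branch 8 1
  [:: 86; 87; 88; 89; 90; 91; 92; 93; 94; 95; 96; 97; 98; 99; 100; 101; 102; 103; 104; 105; 106;
  107; 108] (Farkas 7 [:: 2; 3; 5; 6; 7; 8; 9; 11; 15; 18; 19; 22; 24; 28; 30; 31]) (Branch 16 1
  [:: 109; 110; 111; 112; 113; 114; 115; 116; 117; 118; 119; 120; 121; 122; 123] (Farkas 1 [::
  16; 16]) (Branch 5 1 [:: 62; 70] (Farkas 24 [:: 1; 1; 1; 1; 3; 3; 3; 5; 5; 5; 6; 7; 7; 8; 9;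
  9; 10; 10; 11; 12; 12; 13; 14; 14; 14; 16; 17; 17; 18; 18; 19; 20; 20; 21; 22; 22; 22; 24; 25;
  25; 26; 26; 27; 28; 28; 29; 30; 30; 30]) (Farkas 4 [:: 2; 8; 10; 16; 18; 24; 26]))))) (Farkas
  4 [:: 4; 8; 12; 16; 20; 24; 28]))) (Farkas 4 [:: 4; 8; 12; 16; 20; 24; 28]))) (Farkas 8 [:: 2;
  4; 6; 8; 10; 12; 14; 16; 18; 20; 22; 24; 26; 28; 30]).

Definition certificate_19 : certificate :=
  Branch 1 4 [:: 0; 1; 2; 3; 4; 5; 6; 7; 8; 9; 10; 11; 12; 13; 14; 15; 16; 17; 18; 19; 20; 21;
  22; 23; 24; 25; 26; 27; 28; 29] (Branch 1 3 [:: 0; 1; 2; 3; 4; 5; 6; 7; 8; 9; 10; 11; 12; 13;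
  14; 15; 16; 17; 18; 19; 20; 21; 22; 23; 24; 25; 26; 27; 28; 29] (Branch 1 2 [:: 0; 1; 2; 3; 4;
  5; 6; 7; 8; 9; 10; 11; 12; 13; 14; 15; 16; 17; 18; 19; 20; 21; 22; 23; 24; 25; 26; 27; 28; 29]
  (Branch 1 1 [:: 0; 1; 2; 3; 4; 5; 6; 7; 8; 9; 10; 11; 12; 13; 14; 15; 16; 17; 18; 19; 20; 21;
  22; 23; 24; 25; 26; 27; 28; 29] (Farkas 6 [:: 7; 11; 13; 14; 15; 19; 22; 23; 26; 27; 28; 29;
  30; 31]) (Branch 2 1 [:: 30; 31; 32; 33; 34; 35; 36; 37; 38; 39; 40; 41; 42; 43; 44; 45; 46;
  47; 48; 49; 50; 51; 52; 53; 54; 55; 56; 57; 58] (Farkas 7 [:: 1; 2; 3; 4; 5; 8; 11; 12; 14;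
  16; 18; 20; 23; 26; 27; 29]) (Branch 3 1 [::] (Branch 4 1 [:: 59; 60; 61; 62; 63; 64; 65; 66;
  67; 68; 69; 70; 71; 72; 73; 74; 75; 76; 77; 78; 79; 80; 81; 82; 83; 84; 85] (Farkas 3 [:: 4;
  6; 12; 14; 20; 22; 28; 30]) (Branch 8 1 [:: 86; 87; 88; 89; 90; 91; 92; 93; 94; 95; 96; 97;
  98; 99; 100; 101; 102; 103; 104; 105; 106; 107; 108] (Farkas 7 [:: 1; 2; 4; 8; 10; 11; 12; 13;
  15; 17; 18; 20; 22; 23; 24; 31]) (Branch 16 1 [:: 109; 110; 111; 112; 113; 114; 115; 116; 117;
  118; 119; 120; 121; 122; 123] (Farkas 1 [:: 16; 16]) (Branch 5 1 [:: 0; 62; 149; 70; 150]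
  (Farkas 24 [:: 1; 1; 2; 3; 3; 3; 3; 5; 5; 5; 7; 7; 7; 8; 10; 10; 10; 11; 11; 12; 12; 13; 14;
  14; 15; 16; 16; 17; 18; 18; 19; 20; 20; 20; 21; 21; 22; 24; 24; 25; 26; 26; 27; 28; 28; 28;
  29; 29; 30]) (Farkas 4 [:: 2; 8; 10; 16; 18; 24; 26]))))) (Farkas 4 [:: 4; 8; 12; 16; 20; 24;
  28])))) (Branch 2 2 [:: 30; 31; 32; 33; 34; 35; 36; 37; 38; 39; 40; 41; 42; 43; 44; 45; 46;
  47; 48; 49; 50; 51; 52; 53; 54; 55; 56; 57; 58] (Farkas 8 [:: 2; 4; 6; 8; 10; 12; 14; 16; 18;
  20; 22; 24; 26; 28; 30]) (Branch 4 2 [:: 59; 60; 61; 62; 63; 64; 65; 66; 67; 68; 69; 70; 71;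
  72; 73; 74; 75; 76; 77; 78; 79; 80; 81; 82; 83; 84; 85] (Farkas 4 [:: 4; 8; 12; 16; 20; 24;
  28]) (Branch 7 1 [::] (Farkas 8 [:: 1; 2; 4; 8; 9; 10; 12; 16; 17; 18; 20; 24; 25; 26; 28])
  (Branch 8 2 [:: 86; 87; 88; 89; 90; 91; 92; 93; 94; 95; 96; 97; 98; 99; 100; 101; 102; 103;
  104; 105; 106; 107; 108] (Farkas 2 [:: 8; 16; 24]) (Branch 15 1 [::] (Branch 11 2 [:: 31; 124]
  (Branch 9 1 [:: 0; 2] (Branch 16 1 [:: 109; 110; 111; 112; 113; 114; 115; 116; 117; 118; 119;
  120; 121; 122; 123] (Farkas 2 [:: 16; 16; 16]) (Branch 17 1 [:: 0; 2] (Branch 3 1 [:: 31; 124]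
  (Branch 27 2 [:: 31; 124] (Branch 11 1 [:: 31; 124] (Farkas 6 [:: 2; 3; 4; 5; 8; 16; 18; 19;
  20; 21; 24]) (Branch 25 1 [:: 0] (Farkas 4 [:: 1; 3; 5; 7; 16; 18; 20; 22]) (Branch 7 2 [::]
  (Branch 23 2 [::] (Branch 24 1 [::] (Branch 27 1 [::] (Branch 29 1 [::] (Branch 22 1 [:: 117]
  (Farkas 4 [:: 1; 2; 4; 8; 11; 13; 16; 25]) (Branch 23 1 [::] (Branch 30 1 [::] (Branch 21 1
  [:: 149] (Farkas 4 [:: 1; 2; 3; 4; 6; 16; 18]) (Branch 14 1 [::] (Farkas 5 [:: 2; 3; 4; 5; 8;
  16; 18; 19; 20; 21; 24]) (Branch 16 2 [:: 166] (Farkas 2 [:: 1; 17; 18; 24; 26]) (Branch 25 2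
  [::] (Branch 19 2 [::] (Farkas 4 [:: 1; 2; 4; 5; 8; 18; 20; 20; 24]) (Farkas 2 [:: 4; 8; 12]))
  (Farkas 2 [:: 2; 4; 6]))))) (Farkas 4 [:: 1; 6; 7; 18; 19; 20; 21])) (Farkas 4 [:: 6; 8; 14;
  18; 20; 26; 28]))) (Farkas 4 [:: 2; 9; 11; 17; 19; 24; 26])) (Farkas 4 [:: 4; 9; 13; 17; 21;
  24; 28])) (Farkas 2 [:: 2; 4; 6])) (Farkas 4 [:: 3; 5; 6; 8; 11; 13; 14])) (Farkas 2 [:: 8;
  16; 24])))) (Farkas 4 [:: 4; 7; 13; 14; 17; 18; 24; 27])) (Farkas 2 [:: 8; 16; 24])) (Farkas 4
  [:: 2; 4; 6; 8; 10; 12; 14]))) (Farkas 4 [:: 2; 4; 6; 16; 18; 20; 22])) (Farkas 2 [:: 4; 16;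
  20])) (Farkas 4 [:: 3; 5; 6; 16; 19; 21; 22]))))))) (Branch 2 2 [:: 30; 31; 32; 33; 34; 35;
  36; 37; 38; 39; 40; 41; 42; 43; 44; 45; 46; 47; 48; 49; 50; 51; 52; 53; 54; 55; 56; 57; 58]
  (Farkas 8 [:: 2; 4; 6; 8; 10; 12; 14; 16; 18; 20; 22; 24; 26; 28; 30]) (Farkas 4 [:: 4; 8; 12;
  16; 20; 24; 28]))) (Farkas 8 [:: 2; 4; 6; 8; 10; 12; 14; 16; 18; 20; 22; 24; 26; 28; 30]).

Definition certificate_20 : certificate :=
  Branch 1 3 [:: 0; 1; 2; 3; 4; 5; 6; 7; 8; 9; 10; 11; 12; 13; 14; 15; 16; 17; 18; 19; 20; 21;
  22; 23; 24; 25; 26; 27; 28; 29] (Branch 1 2 [:: 0; 1; 2; 3; 4; 5; 6; 7; 8; 9; 10; 11; 12; 13;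
  14; 15; 16; 17; 18; 19; 20; 21; 22; 23; 24; 25; 26; 27; 28; 29] (Branch 1 1 [:: 0; 1; 2; 3; 4;
  5; 6; 7; 8; 9; 10; 11; 12; 13; 14; 15; 16; 17; 18; 19; 20; 21; 22; 23; 24; 25; 26; 27; 28; 29]
  (Farkas 6 [:: 7; 11; 13; 14; 15; 19; 22; 23; 26; 27; 28; 29; 30; 31]) (Branch 2 1 [:: 30; 31;
  32; 33; 34; 35; 36; 37; 38; 39; 40; 41; 42; 43; 44; 45; 46; 47; 48; 49; 50; 51; 52; 53; 54;
  55; 56; 57; 58] (Farkas 7 [:: 1; 2; 3; 4; 5; 8; 11; 12; 14; 16; 18; 20; 23; 26; 27; 29])
  (Branch 3 1 [::] (Branch 4 1 [:: 59; 60; 61; 62; 63; 64; 65; 66; 67; 68; 69; 70; 71; 72; 73;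
  74; 75; 76; 77; 78; 79; 80; 81; 82; 83; 84; 85] (Farkas 3 [:: 4; 6; 12; 14; 20; 22; 28; 30])
  (Branch 8 1 [:: 86; 87; 88; 89; 90; 91; 92; 93; 94; 95; 96; 97; 98; 99; 100; 101; 102; 103;
  104; 105; 106; 107; 108] (Farkas 7 [:: 1; 2; 4; 8; 10; 11; 12; 13; 15; 17; 18; 20; 22; 23; 24;
  31]) (Branch 16 1 [:: 109; 110; 111; 112; 113; 114; 115; 116; 117; 118; 119; 120; 121; 122;
  123] (Farkas 1 [:: 16; 16]) (Branch 5 1 [:: 0; 62; 149; 70; 150] (Farkas 24 [:: 1; 1; 2; 3; 3;
  3; 3; 5; 5; 5; 7; 7; 7; 8; 10; 10; 10; 11; 11; 12; 12; 13; 14; 14; 15; 16; 16; 17; 18; 18; 19;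
  20; 20; 20; 21; 21; 22; 24; 24; 25; 26; 26; 27; 28; 28; 28; 29; 29; 30]) (Farkas 4 [:: 2; 8;
  10; 16; 18; 24; 26]))))) (Farkas 4 [:: 4; 8; 12; 16; 20; 24; 28])))) (Branch 2 2 [:: 30; 31;
  32; 33; 34; 35; 36; 37; 38; 39; 40; 41; 42; 43; 44; 45; 46; 47; 48; 49; 50; 51; 52; 53; 54;
  55; 56; 57; 58] (Branch 2 1 [:: 30; 31; 32; 33; 34; 35; 36; 37; 38; 39; 40; 41; 42; 43; 44;
  45; 46; 47; 48; 49; 50; 51; 52; 53; 54; 55; 56; 57; 58] (Farkas 7 [:: 1; 2; 3; 4; 5; 8; 11;
  12; 14; 16; 18; 20; 23; 26; 27; 29]) (Branch 3 1 [::] (Branch 4 1 [:: 59; 60; 61; 62; 63; 64;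
  65; 66; 67; 68; 69; 70; 71; 72; 73; 74; 75; 76; 77; 78; 79; 80; 81; 82; 83; 84; 85] (Farkas 3
  [:: 4; 6; 12; 14; 20; 22; 28; 30]) (Branch 8 1 [:: 86; 87; 88; 89; 90; 91; 92; 93; 94; 95; 96;
  97; 98; 99; 100; 101; 102; 103; 104; 105; 106; 107; 108] (Farkas 7 [:: 1; 2; 4; 8; 10; 11; 12;
  13; 15; 17; 18; 20; 22; 23; 24; 31]) (Branch 16 1 [:: 109; 110; 111; 112; 113; 114; 115; 116;
  117; 118; 119; 120; 121; 122; 123] (Farkas 1 [:: 16; 16]) (Branch 5 1 [:: 62; 70] (Farkas 24
  [:: 1; 1; 1; 1; 3; 3; 3; 5; 5; 5; 6; 7; 7; 8; 9; 9; 10; 10; 11; 12; 12; 13; 14; 14; 14; 16;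
  17; 17; 18; 18; 19; 20; 20; 21; 22; 22; 22; 24; 25; 25; 26; 26; 27; 28; 28; 29; 30; 30; 30])
  (Farkas 4 [:: 2; 8; 10; 16; 18; 24; 26]))))) (Farkas 4 [:: 4; 8; 12; 16; 20; 24; 28])))
  (Branch 3 2 [::] (Branch 4 2 [:: 59; 60; 61; 62; 63; 64; 65; 66; 67; 68; 69; 70; 71; 72; 73;
  74; 75; 76; 77; 78; 79; 80; 81; 82; 83; 84; 85] (Farkas 4 [:: 4; 8; 12; 16; 20; 24; 28])
  (Branch 8 1 [:: 86; 87; 88; 89; 90; 91; 92; 93; 94; 95; 96; 97; 98; 99; 100; 101; 102; 103;
  104; 105; 106; 107; 108] (Farkas 3 [:: 1; 5; 8; 12; 16; 20; 25; 29]) (Branch 16 1 [:: 109;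
  110; 111; 112; 113; 114; 115; 116; 117; 118; 119; 120; 121; 122; 123] (Farkas 1 [:: 16; 16])
  (Branch 9 1 [:: 0; 93; 142] (Branch 13 2 [:: 0; 93; 142] (Branch 29 1 [:: 0] (Farkas 10 [:: 1;
  2; 3; 3; 4; 8; 8; 10; 10; 16; 16; 17; 17; 24; 24; 24; 25; 26; 28]) (Farkas 20 [:: 1; 2; 2; 3;
  3; 5; 7; 7; 8; 8; 9; 9; 10; 11; 11; 12; 12; 14; 16; 16; 17; 17; 18; 19; 19; 20; 20; 22; 24;
  24; 24; 24; 25; 26; 26; 28; 28; 29])) (Farkas 6 [:: 2; 8; 9; 12; 16; 16; 18; 24; 25; 28]))
  (Farkas 4 [:: 2; 4; 6; 16; 18; 20; 22]))))) (Farkas 4 [:: 4; 8; 12; 16; 20; 24; 28]))))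
  (Farkas 8 [:: 2; 4; 6; 8; 10; 12; 14; 16; 18; 20; 22; 24; 26; 28; 30]).

Definition certificate_21 : certificate :=
  Branch 1 4 [:: 0; 1; 2; 3; 4; 5; 6; 7; 8; 9; 10; 11; 12; 13; 14; 15; 16; 17; 18; 19; 20; 21;
  22; 23; 24; 25; 26; 27; 28; 29] (Branch 1 3 [:: 0; 1; 2; 3; 4; 5; 6; 7; 8; 9; 10; 11; 12; 13;
  14; 15; 16; 17; 18; 19; 20; 21; 22; 23; 24; 25; 26; 27; 28; 29] (Branch 1 2 [:: 0; 1; 2; 3; 4;
  5; 6; 7; 8; 9; 10; 11; 12; 13; 14; 15; 16; 17; 18; 19; 20; 21; 22; 23; 24; 25; 26; 27; 28; 29]
  (Branch 1 1 [:: 0; 1; 2; 3; 4; 5; 6; 7; 8; 9; 10; 11; 12; 13; 14; 15; 16; 17; 18; 19; 20; 21;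
  22; 23; 24; 25; 26; 27; 28; 29] (Farkas 6 [:: 7; 11; 13; 14; 15; 19; 22; 23; 26; 27; 28; 29;
  30; 31]) (Branch 2 1 [:: 30; 31; 32; 33; 34; 35; 36; 37; 38; 39; 40; 41; 42; 43; 44; 45; 46;
  47; 48; 49; 50; 51; 52; 53; 54; 55; 56; 57; 58] (Farkas 6 [:: 2; 3; 6; 10; 11; 15; 16; 19; 20;
  26; 28; 29]) (Branch 4 1 [:: 59; 60; 61; 62; 63; 64; 65; 66; 67; 68; 69; 70; 71; 72; 73; 74;
  75; 76; 77; 78; 79; 80; 81; 82; 83; 84; 85] (Farkas 3 [:: 4; 6; 12; 14; 20; 22; 28; 30])
  (Branch 3 1 [:: 31; 124] (Branch 8 1 [:: 86; 87; 88; 89; 90; 91; 92; 93; 94; 95; 96; 97; 98;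
  99; 100; 101; 102; 103; 104; 105; 106; 107; 108] (Farkas 7 [:: 1; 2; 3; 4; 7; 8; 10; 14; 15;
  17; 18; 20; 24; 25; 29; 31]) (Branch 16 1 [:: 109; 110; 111; 112; 113; 114; 115; 116; 117;
  118; 119; 120; 121; 122; 123] (Farkas 1 [:: 16; 16]) (Branch 9 1 [:: 0; 2; 93; 142; 143]
  (Farkas 7 [:: 1; 3; 5; 7; 9; 10; 12; 14; 17; 18; 20; 22; 25; 26; 28; 30]) (Farkas 4 [:: 2; 4;
  6; 16; 18; 20; 22])))) (Farkas 4 [:: 4; 8; 12; 16; 20; 24; 28]))))) (Branch 2 2 [:: 30; 31;
  32; 33; 34; 35; 36; 37; 38; 39; 40; 41; 42; 43; 44; 45; 46; 47; 48; 49; 50; 51; 52; 53; 54;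
  55; 56; 57; 58] (Farkas 8 [:: 2; 4; 6; 8; 10; 12; 14; 16; 18; 20; 22; 24; 26; 28; 30]) (Branch
  4 2 [:: 59; 60; 61; 62; 63; 64; 65; 66; 67; 68; 69; 70; 71; 72; 73; 74; 75; 76; 77; 78; 79;
  80; 81; 82; 83; 84; 85] (Farkas 4 [:: 4; 8; 12; 16; 20; 24; 28]) (Branch 8 1 [:: 86; 87; 88;
  89; 90; 91; 92; 93; 94; 95; 96; 97; 98; 99; 100; 101; 102; 103; 104; 105; 106; 107; 108]
  (Farkas 3 [:: 1; 3; 9; 11; 16; 18; 24; 26]) (Branch 16 1 [:: 109; 110; 111; 112; 113; 114;
  115; 116; 117; 118; 119; 120; 121; 122; 123] (Farkas 1 [:: 16; 16]) (Branch 9 2 [:: 0; 2; 93;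
  142; 143] (Branch 3 1 [:: 31; 124] (Branch 7 1 [::] (Farkas 4 [:: 1; 2; 9; 10; 17; 18; 25;
  26]) (Branch 11 1 [:: 31; 124; 93; 140; 141] (Branch 25 1 [:: 0; 2] (Farkas 8 [:: 1; 2; 3; 4;
  5; 6; 8; 10; 16; 17; 18; 19; 20; 22; 24; 31]) (Farkas 16 [:: 1; 1; 1; 1; 2; 2; 3; 3; 3; 4; 4;
  4; 5; 5; 6; 6; 6; 6; 9; 11; 11; 12; 13; 17; 17; 17; 19; 21; 22; 22; 24])) (Branch 13 1 [:: 0]
  (Farkas 4 [:: 3; 4; 8; 16; 19; 20; 24]) (Branch 15 2 [::] (Branch 7 2 [::] (Branch 19 1 [::
  31; 163] (Branch 26 2 [:: 31; 163] (Branch 17 1 [:: 164; 167] (Farkas 4 [:: 1; 3; 9; 11; 16;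
  18; 24; 26]) (Branch 18 1 [:: 31] (Farkas 4 [:: 2; 3; 10; 11; 16; 17; 24; 25]) (Branch 16 2
  [::] (Branch 20 1 [::] (Farkas 4 [:: 4; 5; 12; 13; 16; 17; 24; 25]) (Branch 23 1 [::] (Farkas
  8 [:: 1; 1; 2; 4; 8; 8; 9; 9; 10; 12; 16; 22; 24; 30]) (Branch 23 2 [::] (Farkas 4 [:: 1; 2;
  4; 8; 9; 10; 12]) (Branch 30 1 [::] (Farkas 6 [:: 1; 2; 3; 4; 5; 8; 9; 9; 14; 16; 23]) (Branch
  10 1 [:: 31; 163; 168; 169; 170] (Farkas 8 [:: 1; 2; 2; 3; 3; 4; 5; 7; 7; 8; 9; 11; 11; 12;
  13; 13; 13]) (Branch 12 1 [:: 164; 171; 172] (Farkas 4 [:: 1; 4; 5; 8; 9; 10; 11]) (Farkas 2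
  [:: 14; 16; 30]))))))) (Farkas 4 [:: 1; 4; 5; 8; 9; 12; 13])))) (Farkas 10 [:: 1; 2; 2; 4; 5;
  5; 9; 10; 10; 11; 12; 13; 14; 16; 18; 23; 24; 25; 28])) (Branch 21 1 [:: 164] (Farkas 4 [:: 3;
  4; 8; 11; 12; 16; 24]) (Branch 23 2 [::] (Branch 10 1 [:: 31; 173; 93; 140; 174] (Branch 27 2
  [:: 31; 173] (Branch 25 1 [:: 175; 176] (Farkas 4 [:: 5; 6; 7; 8; 9; 16; 17; 25]) (Branch 14 1
  [:: 93] (Farkas 4 [:: 2; 3; 8; 9; 18; 19; 24; 25]) (Branch 26 1 [:: 31] (Farkas 7 [:: 4; 6; 6;
  7; 7; 8; 9; 12; 16; 16; 17; 17; 18; 26; 30]) (Branch 24 1 [::] (Branch 22 1 [::] (Farkas 4 [::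
  2; 3; 10; 11; 16; 17; 24; 25]) (Branch 28 1 [::] (Farkas 4 [:: 8; 9; 10; 11; 16; 17; 18; 19])
  (Branch 31 1 [::] (Farkas 6 [:: 2; 2; 4; 4; 7; 7; 11; 13; 14; 19; 21; 22; 25; 25; 26]) (Branch
  8 2 [:: 175; 176; 93; 177; 178] (Farkas 2 [:: 6; 24; 24; 27; 29]) (Branch 9 1 [::] (Branch 27
  1 [:: 31] (Branch 16 2 [:: 179; 180; 181; 182; 123] (Farkas 2 [:: 6; 16; 16; 19; 21]) (Branch
  17 1 [::] (Branch 11 2 [:: 31; 93; 140] (Farkas 5 [:: 1; 1; 1; 2; 4; 6; 9; 10; 12; 17; 18; 20;
  24]) (Branch 21 2 [:: 164; 183; 184] (Farkas 3 [:: 1; 4; 4; 9; 10; 11; 16; 25]) (Branch 26 2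
  [:: 140] (Farkas 4 [:: 7; 7; 7; 7; 9; 9; 10; 17; 17; 20; 30]) (Branch 14 2 [:: 185] (Farkas 4
  [:: 2; 2; 4; 4; 7; 19; 20; 25; 25]) (Branch 22 2 [:: 186] (Farkas 4 [:: 2; 4; 4; 5; 7; 10;
  10]) (Farkas 5 [:: 1; 1; 4; 7; 10; 10; 28])))))) (Farkas 2 [:: 2; 4; 6]))) (Farkas 8 [:: 4; 7;
  7; 9; 9; 10; 10; 10; 14; 17; 17; 18; 21; 21; 22; 24; 28])) (Farkas 2 [:: 2; 16; 18]))))))
  (Farkas 8 [:: 1; 2; 2; 4; 4; 6; 7; 7; 7; 24; 24; 25; 25; 26; 27; 28; 29]))))) (Farkas 4 [:: 4;
  7; 9; 10; 21; 22; 24; 27])) (Branch 12 1 [:: 175] (Branch 8 2 [:: 175] (Branch 29 2 [:: 175]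
  (Branch 9 1 [::] (Branch 14 2 [::] (Branch 24 2 [::] (Branch 14 1 [::] (Farkas 4 [:: 4; 5; 8;
  9; 20; 21; 24; 25]) (Branch 28 1 [::] (Farkas 6 [:: 1; 4; 5; 7; 8; 10; 11; 16; 17; 17; 30])
  (Branch 17 1 [::] (Branch 25 1 [:: 175; 187] (Farkas 20 [:: 1; 1; 1; 2; 2; 3; 3; 3; 4; 4; 4;
  5; 7; 7; 7; 8; 12; 13; 13; 13; 13; 14; 14; 16; 16; 16; 20; 20; 20; 20; 20; 21; 21; 22; 22; 26;
  26; 26; 30]) (Branch 27 1 [::] (Farkas 8 [:: 1; 1; 4; 5; 5; 10; 10; 11; 15; 17; 20; 20; 21;
  26; 26; 26; 30]) (Farkas 2 [:: 4; 17; 21]))) (Farkas 10 [:: 1; 2; 4; 4; 8; 10; 10; 12; 14; 16;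
  17; 17; 20; 21; 25; 26; 27])))) (Farkas 16 [:: 1; 1; 1; 2; 3; 4; 4; 4; 5; 5; 5; 7; 7; 8; 8;
  10; 11; 17; 17; 20; 21; 24; 25; 26; 26; 27; 27; 30; 30])) (Farkas 2 [:: 1; 16; 17])) (Farkas 2
  [:: 4; 16; 20])) (Farkas 8 [:: 2; 4; 4; 5; 7; 9; 10; 10; 11; 12; 14; 20; 20; 26; 26])) (Farkas
  2 [:: 4; 16; 20])) (Farkas 2 [:: 14; 16; 30]))) (Farkas 2 [:: 8; 17; 25])))) (Branch 23 2 [::]
  (Branch 19 1 [:: 31; 165] (Branch 25 2 [:: 188; 189; 190] (Branch 17 1 [:: 164; 167; 191]
  (Farkas 1 [:: 16; 24]) (Branch 18 1 [:: 31; 165] (Farkas 4 [:: 2; 4; 10; 12; 16; 22; 24; 30])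
  (Branch 20 1 [:: 188] (Farkas 6 [:: 4; 5; 6; 8; 12; 13; 14; 16; 19; 24; 27]) (Branch 24 1 [::
  164; 167] (Farkas 10 [:: 1; 1; 2; 5; 6; 6; 9; 9; 9; 10; 11; 11; 12; 14; 14; 16; 16; 18; 19;
  23; 30]) (Branch 26 1 [:: 31] (Branch 10 1 [:: 31] (Farkas 4 [:: 2; 3; 6; 7; 8; 9; 12; 13])
  (Farkas 2 [:: 1; 4; 5])) (Farkas 2 [:: 1; 4; 5])))))) (Farkas 18 [:: 2; 2; 2; 2; 3; 4; 4; 5;
  5; 5; 6; 6; 9; 9; 10; 10; 11; 11; 13; 13; 13; 13; 14; 16; 16; 16; 19; 21; 23; 23; 24; 24;
  30])) (Branch 21 1 [:: 111] (Farkas 4 [:: 3; 4; 8; 11; 12; 16; 24]) (Branch 9 1 [:: 153; 154;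
  155; 93; 156; 157; 158] (Branch 8 2 [:: 192; 193; 93; 194; 195] (Farkas 1 [:: 8; 24]) (Branch
  25 1 [:: 153; 196; 197] (Farkas 2 [:: 7; 8; 16]) (Branch 27 2 [:: 31] (Branch 26 1 [:: 31]
  (Farkas 4 [:: 4; 5; 6; 7; 16; 17; 18; 19]) (Branch 28 1 [:: 153] (Farkas 4 [:: 4; 8; 11; 16;
  19; 24; 28]) (Branch 24 2 [::] (Branch 30 2 [::] (Branch 22 1 [::] (Farkas 4 [:: 2; 4; 10; 12;
  16; 22; 24; 30]) (Branch 16 2 [:: 198; 199; 200] (Farkas 1 [:: 16; 24]) (Branch 24 1 [::]
  (Branch 14 1 [::] (Farkas 8 [:: 2; 3; 4; 5; 8; 8; 16; 16; 18; 19; 20; 21; 24; 24]) (Branch 11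
  2 [:: 31; 124; 93; 140; 141] (Farkas 1 [:: 8; 24]) (Branch 27 1 [::] (Branch 21 2 [:: 188; 62;
  201] (Farkas 2 [:: 4; 12; 16; 24]) (Branch 29 1 [:: 202] (Branch 13 2 [:: 202; 140; 203]
  (Farkas 2 [:: 3; 8; 19; 24]) (Branch 19 2 [:: 204; 205; 206] (Farkas 1 [:: 5; 16]) (Branch 25
  2 [:: 175; 176] (Farkas 1 [:: 8; 16]) (Farkas 4 [:: 2; 4; 8; 16; 30])))) (Farkas 2 [:: 2; 5;
  7]))) (Farkas 2 [:: 3; 4; 7])))) (Farkas 2 [:: 1; 2; 3])))) (Farkas 2 [:: 1; 24; 25])) (Farkas
  3 [:: 1; 2; 4; 24])))) (Farkas 2 [:: 4; 17; 21])))) (Branch 10 1 [:: 31; 173] (Branch 8 2 [::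
  175; 176] (Branch 27 2 [:: 31; 173] (Branch 25 1 [:: 175; 176] (Farkas 12 [:: 2; 2; 3; 3; 5;
  5; 6; 7; 7; 8; 8; 8; 8; 11; 12; 12; 13; 16; 18; 18; 22; 27; 29; 29; 29]) (Branch 18 1 [:: 31]
  (Branch 27 1 [:: 31] (Farkas 8 [:: 2; 2; 6; 9; 11; 11; 13; 13; 15; 18; 20; 25; 25; 27; 29; 29;
  29]) (Farkas 2 [:: 4; 9; 13])) (Farkas 2 [:: 4; 9; 13]))) (Farkas 12 [:: 2; 3; 4; 4; 7; 7; 8;
  9; 9; 9; 10; 13; 13; 17; 18; 18; 22; 22; 25; 25; 27])) (Farkas 2 [:: 4; 16; 20])) (Farkas 2
  [:: 4; 16; 20]))))) (Farkas 4 [:: 3; 5; 6; 8; 11; 13; 14]))) (Farkas 2 [:: 9; 16; 25])))))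
  (Farkas 4 [:: 4; 8; 12; 16; 20; 24; 28])) (Farkas 4 [:: 2; 4; 6; 16; 18; 20; 22])))))))
  (Branch 2 3 [:: 30; 31; 32; 33; 34; 35; 36; 37; 38; 39; 40; 41; 42; 43; 44; 45; 46; 47; 48;
  49; 50; 51; 52; 53; 54; 55; 56; 57; 58] (Branch 2 2 [:: 30; 31; 32; 33; 34; 35; 36; 37; 38;
  39; 40; 41; 42; 43; 44; 45; 46; 47; 48; 49; 50; 51; 52; 53; 54; 55; 56; 57; 58] (Farkas 8 [::
  2; 4; 6; 8; 10; 12; 14; 16; 18; 20; 22; 24; 26; 28; 30]) (Branch 4 2 [:: 59; 60; 61; 62; 63;
  64; 65; 66; 67; 68; 69; 70; 71; 72; 73; 74; 75; 76; 77; 78; 79; 80; 81; 82; 83; 84; 85]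
  (Farkas 4 [:: 4; 8; 12; 16; 20; 24; 28]) (Branch 8 2 [:: 86; 87; 88; 89; 90; 91; 92; 93; 94;
  95; 96; 97; 98; 99; 100; 101; 102; 103; 104; 105; 106; 107; 108] (Farkas 4 [:: 2; 8; 10; 16;
  18; 24; 26]) (Branch 16 1 [:: 109; 110; 111; 112; 113; 114; 115; 116; 117; 118; 119; 120; 121;
  122; 123] (Farkas 2 [:: 16; 16; 16]) (Branch 7 2 [:: 62; 130] (Branch 6 1 [:: 62; 130] (Branch
  3 1 [:: 31; 35] (Branch 18 2 [:: 31; 35] (Branch 7 1 [:: 62; 130] (Farkas 4 [:: 2; 4; 10; 12;
  18; 20; 26; 28]) (Branch 11 1 [:: 31] (Farkas 8 [:: 1; 2; 5; 6; 8; 8; 16; 16; 17; 18; 21; 22;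
  24; 24]) (Branch 21 1 [:: 62] (Farkas 8 [:: 1; 3; 4; 5; 6; 6; 7; 8; 12; 12; 12; 14; 14; 18;
  22; 24; 28]) (Branch 17 1 [::] (Branch 15 2 [::] (Branch 20 1 [::] (Branch 18 1 [::] (Branch
  23 1 [::] (Branch 22 2 [::] (Farkas 6 [:: 2; 2; 4; 6; 10; 12; 12; 17; 18; 22; 24; 25; 28])
  (Branch 19 2 [::] (Farkas 8 [:: 2; 2; 2; 6; 6; 10; 10; 12; 14; 18; 18; 20; 22; 24; 26; 28;
  28]) (Farkas 2 [:: 8; 18; 26]))) (Farkas 8 [:: 2; 3; 6; 11; 12; 17; 18; 18; 20; 20; 22; 24;
  25; 26; 28; 28; 28])) (Farkas 8 [:: 1; 2; 4; 5; 6; 9; 12; 12; 13; 18; 18; 18; 22; 24; 26; 26;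
  28])) (Farkas 2 [:: 2; 8; 10])) (Farkas 2 [:: 3; 16; 19])) (Farkas 2 [:: 2; 8; 10])))))
  (Farkas 4 [:: 1; 4; 5; 8; 9; 12; 13])) (Farkas 4 [:: 4; 8; 12; 16; 20; 24; 28])) (Farkas 4 [::
  1; 8; 9; 16; 17; 24; 25])) (Farkas 2 [:: 8; 16; 24])))))) (Farkas 4 [:: 4; 8; 12; 16; 20; 24;
  28]))) (Farkas 8 [:: 2; 4; 6; 8; 10; 12; 14; 16; 18; 20; 22; 24; 26; 28; 30]).

Definition certificate_22 : certificate :=
  Branch 1 3 [:: 0; 1; 2; 3; 4; 5; 6; 7; 8; 9; 10; 11; 12; 13; 14; 15; 16; 17; 18; 19; 20; 21;
  22; 23; 24; 25; 26; 27; 28; 29] (Branch 1 2 [:: 0; 1; 2; 3; 4; 5; 6; 7; 8; 9; 10; 11; 12; 13;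
  14; 15; 16; 17; 18; 19; 20; 21; 22; 23; 24; 25; 26; 27; 28; 29] (Branch 1 1 [:: 0; 1; 2; 3; 4;
  5; 6; 7; 8; 9; 10; 11; 12; 13; 14; 15; 16; 17; 18; 19; 20; 21; 22; 23; 24; 25; 26; 27; 28; 29]
  (Farkas 6 [:: 7; 11; 13; 14; 15; 19; 22; 23; 26; 27; 28; 29; 30; 31]) (Branch 2 1 [:: 30; 31;
  32; 33; 34; 35; 36; 37; 38; 39; 40; 41; 42; 43; 44; 45; 46; 47; 48; 49; 50; 51; 52; 53; 54;
  55; 56; 57; 58] (Farkas 6 [:: 2; 3; 6; 10; 11; 15; 16; 19; 20; 26; 28; 29]) (Branch 3 1 [::]
  (Branch 4 1 [:: 59; 60; 61; 62; 63; 64; 65; 66; 67; 68; 69; 70; 71; 72; 73; 74; 75; 76; 77;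
  78; 79; 80; 81; 82; 83; 84; 85] (Farkas 3 [:: 4; 6; 12; 14; 20; 22; 28; 30]) (Branch 8 1 [::
  86; 87; 88; 89; 90; 91; 92; 93; 94; 95; 96; 97; 98; 99; 100; 101; 102; 103; 104; 105; 106;
  107; 108] (Farkas 7 [:: 1; 2; 3; 4; 7; 8; 10; 14; 15; 17; 18; 20; 24; 25; 29; 31]) (Branch 16
  1 [:: 109; 110; 111; 112; 113; 114; 115; 116; 117; 118; 119; 120; 121; 122; 123] (Farkas 1 [::
  16; 16]) (Branch 5 1 [:: 0; 62; 149; 70; 150] (Farkas 7 [:: 1; 3; 5; 7; 9; 10; 12; 14; 17; 18;
  20; 22; 25; 26; 28; 30]) (Farkas 4 [:: 2; 8; 10; 16; 18; 24; 26]))))) (Farkas 4 [:: 4; 8; 12;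
  16; 20; 24; 28])))) (Branch 2 1 [:: 30; 31; 32; 33; 34; 35; 36; 37; 38; 39; 40; 41; 42; 43;
  44; 45; 46; 47; 48; 49; 50; 51; 52; 53; 54; 55; 56; 57; 58] (Farkas 6 [:: 2; 3; 6; 10; 11; 15;
  16; 19; 20; 26; 28; 29]) (Branch 4 1 [:: 59; 60; 61; 62; 63; 64; 65; 66; 67; 68; 69; 70; 71;
  72; 73; 74; 75; 76; 77; 78; 79; 80; 81; 82; 83; 84; 85] (Farkas 3 [:: 4; 6; 12; 14; 20; 22;
  28; 30]) (Branch 8 1 [:: 86; 87; 88; 89; 90; 91; 92; 93; 94; 95; 96; 97; 98; 99; 100; 101;
  102; 103; 104; 105; 106; 107; 108] (Farkas 3 [:: 8; 10; 12; 14; 24; 26; 28; 30]) (Branch 16 1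
  [:: 109; 110; 111; 112; 113; 114; 115; 116; 117; 118; 119; 120; 121; 122; 123] (Farkas 1 [::
  16; 16]) (Branch 6 2 [:: 62; 130; 70; 132; 134] (Branch 7 1 [:: 62; 130; 70; 132; 134] (Farkas
  8 [:: 1; 2; 4; 6; 8; 10; 12; 15; 17; 18; 20; 22; 24; 26; 28; 31]) (Branch 9 1 [:: 93] (Branch
  11 1 [:: 31; 93; 140] (Farkas 4 [:: 1; 5; 8; 12; 17; 21; 24; 28]) (Branch 3 1 [::] (Branch 5 1
  [::] (Branch 6 1 [:: 62] (Branch 20 1 [:: 62] (Branch 23 1 [:: 62] (Branch 4 2 [:: 188; 62;
  201] (Farkas 8 [:: 2; 4; 5; 6; 7; 12; 12; 13; 15; 18; 18; 20; 22; 24; 26; 28; 28]) (Branch 12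
  1 [::] (Branch 15 1 [::] (Branch 29 1 [:: 88] (Branch 25 2 [:: 88] (Farkas 4 [:: 3; 4; 7; 8;
  12; 16; 20; 27; 27]) (Branch 18 1 [::] (Branch 14 2 [:: 207] (Farkas 2 [:: 2; 9; 19; 24])
  (Branch 19 2 [:: 208] (Farkas 7 [:: 2; 6; 6; 9; 10; 10; 11; 16; 16; 17; 19; 24; 26; 28; 28])
  (Branch 7 2 [:: 209] (Farkas 2 [:: 17; 18; 25; 26]) (Branch 2 2 [:: 210] (Farkas 2 [:: 10; 11;
  26; 27]) (Branch 28 2 [:: 164] (Farkas 2 [:: 8; 11; 16; 19]) (Branch 26 2 [:: 154] (Farkas 3
  [:: 8; 12; 16; 17; 26]) (Farkas 3 [:: 11; 22; 24; 26]))))))) (Farkas 4 [:: 4; 9; 13; 19; 23;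
  26; 30]))) (Farkas 8 [:: 2; 8; 9; 10; 11; 12; 14; 16; 17; 18; 19; 20; 22; 24; 26])) (Farkas 4
  [:: 3; 9; 10; 16; 19; 25; 26])) (Farkas 4 [:: 1; 2; 3; 16; 17; 18; 19]))) (Farkas 4 [:: 5; 6;
  13; 14; 17; 18; 25; 26])) (Farkas 4 [:: 1; 3; 9; 11; 20; 22; 28; 30])) (Farkas 4 [:: 6; 8; 14;
  16; 22; 24; 30])) (Farkas 4 [:: 2; 8; 10; 16; 18; 24; 26])) (Farkas 4 [:: 4; 8; 12; 16; 20;
  24; 28]))) (Farkas 4 [:: 2; 4; 6; 16; 18; 20; 22]))) (Farkas 4 [:: 1; 8; 9; 16; 17; 24;
  25]))))))) (Farkas 8 [:: 2; 4; 6; 8; 10; 12; 14; 16; 18; 20; 22; 24; 26; 28; 30]).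

Definition certificate_23 : certificate :=
  Branch 1 2 [:: 0; 1; 2; 3; 4; 5; 6; 7; 8; 9; 10; 11; 12; 13; 14; 15; 16; 17; 18; 19; 20; 21;
  22; 23; 24; 25; 26; 27; 28; 29] (Farkas 16 [:: 1; 2; 3; 4; 5; 6; 7; 8; 9; 10; 11; 12; 13; 14;
  15; 16; 17; 18; 19; 20; 21; 22; 23; 24; 25; 26; 27; 28; 29; 30; 31]) (Farkas 8 [:: 2; 4; 6; 8;
  10; 12; 14; 16; 18; 20; 22; 24; 26; 28; 30]).

Definition certificate_24 : certificate :=
  Branch 1 2 [:: 0; 1; 2; 3; 4; 5; 6; 7; 8; 9; 10; 11; 12; 13; 14; 15; 16; 17; 18; 19; 20; 21;
  22; 23; 24; 25; 26; 27; 28; 29] (Farkas 16 [:: 1; 2; 3; 4; 5; 6; 7; 8; 9; 10; 11; 12; 13; 14;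
  15; 16; 17; 18; 19; 20; 21; 22; 23; 24; 25; 26; 27; 28; 29; 30; 31]) (Farkas 8 [:: 2; 4; 6; 8;
  10; 12; 14; 16; 18; 20; 22; 24; 26; 28; 30]).

Definition certificate_25 : certificate :=
  Branch 1 4 [:: 0; 1; 2; 3; 4; 5; 6; 7; 8; 9; 10; 11; 12; 13; 14; 15; 16; 17; 18; 19; 20; 21;
  22; 23; 24; 25; 26; 27; 28; 29] (Branch 1 3 [:: 0; 1; 2; 3; 4; 5; 6; 7; 8; 9; 10; 11; 12; 13;
  14; 15; 16; 17; 18; 19; 20; 21; 22; 23; 24; 25; 26; 27; 28; 29] (Branch 1 2 [:: 0; 1; 2; 3; 4;
  5; 6; 7; 8; 9; 10; 11; 12; 13; 14; 15; 16; 17; 18; 19; 20; 21; 22; 23; 24; 25; 26; 27; 28; 29]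
  (Farkas 16 [:: 1; 2; 3; 4; 5; 6; 7; 8; 9; 10; 11; 12; 13; 14; 15; 16; 17; 18; 19; 20; 21; 22;
  23; 24; 25; 26; 27; 28; 29; 30; 31]) (Branch 2 2 [:: 30; 31; 32; 33; 34; 35; 36; 37; 38; 39;
  40; 41; 42; 43; 44; 45; 46; 47; 48; 49; 50; 51; 52; 53; 54; 55; 56; 57; 58] (Farkas 8 [:: 2;
  4; 6; 8; 10; 12; 14; 16; 18; 20; 22; 24; 26; 28; 30]) (Branch 4 2 [:: 59; 60; 61; 62; 63; 64;
  65; 66; 67; 68; 69; 70; 71; 72; 73; 74; 75; 76; 77; 78; 79; 80; 81; 82; 83; 84; 85] (Farkas 4
  [:: 4; 8; 12; 16; 20; 24; 28]) (Branch 8 1 [:: 86; 87; 88; 89; 90; 91; 92; 93; 94; 95; 96; 97;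
  98; 99; 100; 101; 102; 103; 104; 105; 106; 107; 108] (Farkas 3 [:: 1; 3; 9; 11; 16; 18; 24;
  26]) (Branch 16 1 [:: 109; 110; 111; 112; 113; 114; 115; 116; 117; 118; 119; 120; 121; 122;
  123] (Farkas 1 [:: 16; 16]) (Branch 9 1 [:: 0; 2; 93; 142; 143] (Branch 15 1 [:: 93] (Farkas 4
  [:: 1; 2; 7; 7; 7; 7; 9; 16; 18; 19; 24; 24; 27]) (Farkas 12 [:: 3; 5; 6; 8; 8; 9; 9; 10; 10;
  12; 12; 16; 19; 21; 22; 24; 24; 25; 25; 26; 26; 28; 28])) (Branch 10 1 [:: 86; 31; 211]
  (Farkas 4 [:: 2; 6; 8; 12; 18; 22; 24; 28]) (Branch 11 1 [::] (Branch 3 1 [::] (Farkas 4 [::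
  1; 2; 5; 6; 17; 18; 21; 22]) (Farkas 2 [:: 4; 16; 20])) (Farkas 2 [:: 4; 16; 20])))))))))
  (Branch 2 3 [:: 30; 31; 32; 33; 34; 35; 36; 37; 38; 39; 40; 41; 42; 43; 44; 45; 46; 47; 48;
  49; 50; 51; 52; 53; 54; 55; 56; 57; 58] (Branch 2 2 [:: 30; 31; 32; 33; 34; 35; 36; 37; 38;
  39; 40; 41; 42; 43; 44; 45; 46; 47; 48; 49; 50; 51; 52; 53; 54; 55; 56; 57; 58] (Farkas 7 [::
  2; 4; 6; 8; 10; 12; 14; 16; 18; 20; 22; 24; 26; 28; 30]) (Branch 4 2 [:: 59; 60; 61; 62; 63;
  64; 65; 66; 67; 68; 69; 70; 71; 72; 73; 74; 75; 76; 77; 78; 79; 80; 81; 82; 83; 84; 85]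
  (Farkas 4 [:: 4; 8; 12; 16; 20; 24; 28]) (Branch 8 2 [:: 86; 87; 88; 89; 90; 91; 92; 93; 94;
  95; 96; 97; 98; 99; 100; 101; 102; 103; 104; 105; 106; 107; 108] (Farkas 4 [:: 2; 8; 10; 16;
  18; 24; 26]) (Branch 16 1 [:: 109; 110; 111; 112; 113; 114; 115; 116; 117; 118; 119; 120; 121;
  122; 123] (Farkas 2 [:: 16; 16; 16]) (Branch 6 1 [:: 62; 130] (Branch 3 1 [:: 31; 35] (Branch
  17 1 [::] (Farkas 8 [:: 6; 8; 12; 12; 14; 18; 20; 22; 22; 24; 24; 26; 28; 28; 28; 30; 30])
  (Farkas 4 [:: 2; 4; 6; 8; 10; 12; 14])) (Farkas 4 [:: 4; 8; 12; 16; 20; 24; 28])) (Farkas 4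
  [:: 1; 8; 9; 16; 17; 24; 25])))))) (Farkas 4 [:: 4; 8; 12; 16; 20; 24; 28]))) (Farkas 8 [:: 2;
  4; 6; 8; 10; 12; 14; 16; 18; 20; 22; 24; 26; 28; 30]).

Definition certificate_26 : certificate :=
  Branch 1 4 [:: 0; 1; 2; 3; 4; 5; 6; 7; 8; 9; 10; 11; 12; 13; 14; 15; 16; 17; 18; 19; 20; 21;
  22; 23; 24; 25; 26; 27; 28; 29] (Branch 1 3 [:: 0; 1; 2; 3; 4; 5; 6; 7; 8; 9; 10; 11; 12; 13;
  14; 15; 16; 17; 18; 19; 20; 21; 22; 23; 24; 25; 26; 27; 28; 29] (Branch 1 2 [:: 0; 1; 2; 3; 4;
  5; 6; 7; 8; 9; 10; 11; 12; 13; 14; 15; 16; 17; 18; 19; 20; 21; 22; 23; 24; 25; 26; 27; 28; 29]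
  (Branch 1 1 [:: 0; 1; 2; 3; 4; 5; 6; 7; 8; 9; 10; 11; 12; 13; 14; 15; 16; 17; 18; 19; 20; 21;
  22; 23; 24; 25; 26; 27; 28; 29] (Farkas 6 [:: 7; 11; 13; 14; 15; 19; 22; 23; 26; 27; 28; 29;
  30; 31]) (Branch 2 1 [:: 30; 31; 32; 33; 34; 35; 36; 37; 38; 39; 40; 41; 42; 43; 44; 45; 46;
  47; 48; 49; 50; 51; 52; 53; 54; 55; 56; 57; 58] (Farkas 6 [:: 4; 5; 6; 8; 14; 15; 16; 19; 20;
  24; 25; 26]) (Branch 4 1 [:: 59; 60; 61; 62; 63; 64; 65; 66; 67; 68; 69; 70; 71; 72; 73; 74;
  75; 76; 77; 78; 79; 80; 81; 82; 83; 84; 85] (Farkas 6 [:: 4; 7; 9; 12; 13; 14; 15; 20; 26; 28;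
  30; 31]) (Branch 8 1 [:: 86; 87; 88; 89; 90; 91; 92; 93; 94; 95; 96; 97; 98; 99; 100; 101;
  102; 103; 104; 105; 106; 107; 108] (Farkas 7 [:: 1; 2; 4; 7; 8; 9; 10; 12; 17; 18; 19; 23; 24;
  28; 29; 30]) (Branch 3 1 [:: 31; 124; 35; 125; 126] (Farkas 8 [:: 1; 5; 6; 9; 12; 14; 17; 19;
  20; 21; 22; 23; 25; 26; 28; 29; 30; 30]) (Branch 16 1 [:: 109; 110; 111; 112; 113; 114; 115;
  116; 117; 118; 119; 120; 121; 122; 123] (Farkas 1 [:: 16; 16]) (Branch 13 1 [:: 0; 1; 93; 142;
  212; 137; 213; 214] (Farkas 3 [:: 2; 4; 8; 14; 18; 20; 24; 30]) (Branch 22 1 [:: 30; 62; 215;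
  216; 67] (Farkas 2 [:: 1; 2; 4; 16]) (Branch 11 1 [:: 90; 142; 217] (Farkas 5 [:: 1; 2; 3; 4;
  5; 6; 8; 9; 11; 12; 14; 15; 18; 21; 24; 31]) (Branch 17 1 [:: 114; 218; 219] (Farkas 6 [:: 3;
  5; 9; 11; 13; 14; 15; 16; 17; 18; 22; 23; 26]) (Branch 14 1 [:: 220] (Farkas 12 [:: 1; 2; 2;
  3; 4; 4; 5; 7; 8; 9; 9; 10; 12; 14; 15; 16; 18; 19; 20; 21; 24; 25; 30]) (Branch 25 1 [:: 88;
  90; 91] (Farkas 3 [:: 3; 4; 7; 8; 12; 16; 20]) (Branch 31 1 [::] (Farkas 8 [:: 1; 2; 4; 7; 8;
  9; 11; 13; 14; 16; 19; 21; 25; 26; 28]) (Branch 5 1 [:: 221; 222; 223; 224; 225] (Farkas 4 [::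
  4; 8; 9; 12; 19; 23; 27]) (Branch 6 1 [::] (Branch 9 1 [:: 91; 226; 227] (Farkas 10 [:: 1; 2;
  3; 3; 5; 7; 7; 10; 11; 11; 13; 14; 15; 16; 17; 17; 20; 21; 23; 24; 24; 25; 28; 29; 30])
  (Branch 18 1 [:: 31] (Branch 10 1 [:: 31] (Farkas 5 [:: 2; 3; 5; 7; 10; 11; 12; 13; 17; 19;
  21; 23; 24; 25; 28; 29]) (Farkas 2 [:: 4; 16; 20])) (Farkas 8 [:: 2; 4; 4; 4; 6; 8; 9; 12; 13;
  16; 19; 20; 23]))) (Farkas 2 [:: 7; 16; 23])))))))))))))))) (Branch 2 2 [:: 30; 31; 32; 33;
  34; 35; 36; 37; 38; 39; 40; 41; 42; 43; 44; 45; 46; 47; 48; 49; 50; 51; 52; 53; 54; 55; 56;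
  57; 58] (Branch 2 1 [:: 30; 31; 32; 33; 34; 35; 36; 37; 38; 39; 40; 41; 42; 43; 44; 45; 46;
  47; 48; 49; 50; 51; 52; 53; 54; 55; 56; 57; 58] (Farkas 6 [:: 4; 5; 6; 8; 14; 15; 16; 19; 20;
  24; 25; 26]) (Branch 4 1 [:: 59; 60; 61; 62; 63; 64; 65; 66; 67; 68; 69; 70; 71; 72; 73; 74;
  75; 76; 77; 78; 79; 80; 81; 82; 83; 84; 85] (Farkas 6 [:: 4; 7; 9; 12; 13; 14; 15; 20; 26; 28;
  30; 31]) (Branch 8 1 [:: 86; 87; 88; 89; 90; 91; 92; 93; 94; 95; 96; 97; 98; 99; 100; 101;
  102; 103; 104; 105; 106; 107; 108] (Farkas 7 [:: 1; 2; 4; 7; 8; 9; 10; 12; 17; 18; 19; 23; 24;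
  28; 29; 30]) (Branch 3 1 [:: 31; 35] (Farkas 16 [:: 1; 1; 3; 5; 5; 6; 7; 9; 10; 12; 13; 14;
  14; 17; 17; 18; 19; 20; 21; 21; 22; 22; 23; 24; 25; 26; 26; 28; 28; 29; 30; 30; 30]) (Branch
  16 1 [:: 109; 110; 111; 112; 113; 114; 115; 116; 117; 118; 119; 120; 121; 122; 123] (Farkas 1
  [:: 16; 16]) (Branch 14 1 [:: 30; 93; 228; 137; 229] (Farkas 3 [:: 2; 4; 8; 14; 18; 20; 24;
  30]) (Branch 22 1 [:: 62; 68] (Farkas 7 [:: 2; 3; 4; 5; 6; 7; 8; 9; 10; 11; 12; 13; 16; 17;
  30; 31]) (Branch 11 1 [:: 91; 93; 99] (Farkas 10 [:: 1; 1; 3; 4; 6; 6; 9; 11; 12; 14; 15; 17;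
  18; 21; 22; 23; 24; 26; 29; 31; 31]) (Branch 25 1 [:: 114] (Branch 19 1 [:: 114] (Farkas 6 [::
  1; 3; 5; 6; 9; 10; 14; 16; 18; 23; 27; 29; 31]) (Farkas 4 [:: 3; 4; 7; 8; 12; 16; 20]))
  (Branch 28 1 [:: 230] (Farkas 3 [:: 4; 7; 8; 11; 16; 19; 28; 31]) (Branch 6 1 [:: 231; 232;
  233] (Farkas 12 [:: 2; 4; 4; 5; 5; 6; 7; 8; 9; 10; 11; 12; 15; 18; 19; 20; 21; 21; 22; 24; 24;
  25; 26; 27; 27]) (Branch 26 1 [::] (Farkas 4 [:: 1; 6; 7; 8; 9; 16; 17]) (Branch 19 1 [::]
  (Farkas 8 [:: 1; 2; 4; 5; 6; 9; 10; 13; 14; 16; 19; 20; 23; 24; 28]) (Branch 9 1 [:: 93; 103]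
  (Farkas 7 [:: 1; 3; 5; 7; 8; 11; 12; 15; 16; 19; 20; 23; 24; 26; 28; 30]) (Branch 10 1 [::]
  (Branch 12 1 [::] (Farkas 3 [:: 6; 7; 8; 9; 22; 23; 24; 25]) (Branch 20 1 [:: 234; 118; 235]
  (Farkas 3 [:: 4; 6; 12; 14; 16; 18; 24; 26]) (Branch 18 1 [:: 205] (Branch 17 1 [:: 186]
  (Farkas 3 [:: 3; 7; 11; 15; 16; 20; 24; 28]) (Branch 15 1 [:: 93; 236] (Farkas 8 [:: 1; 3; 6;
  8; 9; 10; 13; 13; 15; 18; 19; 21; 23; 25; 27; 28; 29; 30]) (Branch 7 1 [:: 205] (Farkas 8 [::
  1; 2; 3; 7; 7; 9; 10; 12; 15; 17; 18; 19; 20; 23; 25; 26; 28; 31]) (Farkas 8 [:: 3; 6; 6; 7;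
  11; 15; 16; 16; 17; 21; 22; 22; 25; 29])))) (Farkas 2 [:: 1; 8; 9])))) (Farkas 2 [:: 4; 11;
  15])))))))))))))))) (Branch 3 1 [::] (Branch 4 1 [:: 59; 60; 61; 62; 63; 64; 65; 66; 67; 68;
  69; 70; 71; 72; 73; 74; 75; 76; 77; 78; 79; 80; 81; 82; 83; 84; 85] (Farkas 5 [:: 1; 4; 5; 8;
  9; 12; 13; 16; 17; 20; 21; 24; 25; 28; 29]) (Branch 8 1 [:: 86; 87; 88; 89; 90; 91; 92; 93;
  94; 95; 96; 97; 98; 99; 100; 101; 102; 103; 104; 105; 106; 107; 108] (Farkas 3 [:: 4; 6; 8;
  10; 16; 18; 28; 30]) (Branch 16 1 [:: 109; 110; 111; 112; 113; 114; 115; 116; 117; 118; 119;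
  120; 121; 122; 123] (Farkas 1 [:: 16; 16]) (Branch 5 2 [:: 0; 62; 149; 70; 150] (Branch 13 1
  [:: 0; 93; 142; 137; 213] (Farkas 8 [:: 1; 3; 4; 6; 8; 10; 12; 14; 16; 18; 20; 22; 24; 26; 29;
  31]) (Branch 7 1 [:: 62] (Farkas 4 [:: 1; 2; 5; 6; 17; 18; 21; 22]) (Branch 12 2 [:: 153]
  (Branch 11 1 [:: 90] (Farkas 4 [:: 1; 2; 5; 6; 17; 18; 21; 22]) (Branch 14 1 [::] (Farkas 4
  [:: 2; 5; 9; 14; 18; 21; 25; 30]) (Branch 21 1 [:: 61; 62; 65; 67; 68] (Farkas 12 [:: 1; 2; 3;
  3; 4; 4; 5; 6; 7; 7; 8; 8; 9; 10; 11; 11; 12; 12; 13; 14; 16; 16; 31; 31]) (Branch 20 2 [::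
  153] (Branch 19 1 [:: 113] (Farkas 4 [:: 1; 2; 5; 6; 9; 10; 13; 14]) (Branch 22 1 [::] (Farkas
  4 [:: 2; 5; 10; 13; 17; 22; 25; 30]) (Branch 9 1 [:: 237; 238; 239; 93; 240; 241; 242] (Farkas
  2 [:: 18; 22; 24; 24; 26; 30]) (Branch 10 1 [::] (Farkas 4 [:: 2; 6; 9; 13; 18; 22; 25; 29])
  (Branch 8 2 [:: 88] (Branch 25 1 [:: 111; 113; 114] (Branch 17 1 [:: 243; 113; 244] (Farkas 1
  [:: 7; 16]) (Branch 5 1 [:: 61] (Branch 16 2 [:: 245] (Branch 4 2 [:: 61] (Farkas 2 [:: 4; 12;
  20; 28]) (Branch 13 2 [:: 88] (Branch 20 1 [:: 175] (Farkas 1 [:: 7; 16]) (Branch 12 1 [:: 88]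
  (Farkas 5 [:: 1; 2; 4; 7; 8; 11; 16; 17; 20; 21; 22; 25]) (Branch 21 2 [::] (Branch 18 1 [::
  166] (Farkas 1 [:: 7; 16]) (Branch 27 1 [:: 31] (Farkas 4 [:: 1; 4; 8; 8; 10; 16]) (Branch 24
  2 [::] (Branch 15 1 [::] (Farkas 3 [:: 1; 2; 4; 7; 8; 11; 13; 14]) (Farkas 3 [:: 8; 9; 12; 16;
  18])) (Farkas 6 [:: 1; 2; 2; 4; 4; 8; 16; 25])))) (Farkas 2 [:: 2; 8; 10])))) (Farkas 6 [:: 2;
  4; 7; 8; 9; 11; 16; 16; 18; 25]))) (Farkas 4 [:: 2; 4; 6; 8; 10; 12; 14])) (Farkas 2 [:: 7; 8;
  16]))) (Branch 24 2 [:: 198] (Branch 26 1 [::] (Farkas 8 [:: 2; 4; 4; 6; 9; 13; 16; 16; 17;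
  20; 20; 21; 26; 30]) (Branch 5 1 [:: 243; 246; 247; 248; 209; 249; 250] (Farkas 4 [:: 2; 4;
  11; 13; 18; 20; 27; 29]) (Branch 4 2 [:: 198] (Branch 12 1 [:: 237] (Branch 13 2 [:: 237]
  (Farkas 2 [:: 4; 8; 20; 24]) (Branch 29 2 [:: 111] (Branch 28 1 [:: 111] (Farkas 2 [:: 4; 8;
  11; 16]) (Branch 6 1 [::] (Farkas 8 [:: 2; 2; 4; 5; 10; 11; 16; 16; 18; 18; 20; 21; 26; 27])
  (Branch 14 2 [::] (Branch 31 1 [::] (Farkas 8 [:: 1; 2; 4; 7; 8; 11; 13; 14; 16; 16; 16; 16])
  (Branch 16 2 [:: 192; 113; 251; 252; 253; 254; 255] (Farkas 2 [:: 4; 16; 20]) (Branch 21 2 [::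
  188; 62; 201] (Branch 19 2 [:: 256; 257] (Farkas 1 [:: 16]) (Farkas 2 [:: 4; 11; 15])) (Farkas
  2 [:: 7; 8; 15])))) (Farkas 1 [:: 16])))) (Farkas 4 [:: 2; 5; 7; 9; 11; 12; 14]))) (Farkas 2
  [:: 2; 16; 18])) (Farkas 4 [:: 2; 8; 10; 16; 18; 24; 26])))) (Farkas 4 [:: 2; 4; 6; 24; 26;
  28; 30]))) (Farkas 2 [:: 4; 16; 20])))))) (Farkas 4 [:: 2; 8; 10; 20; 22; 28; 30]))))) (Farkas
  4 [:: 2; 12; 14; 16; 18; 28; 30])))) (Farkas 4 [:: 2; 8; 10; 16; 18; 24; 26]))))) (Farkas 4
  [:: 4; 8; 12; 16; 20; 24; 28])))) (Branch 2 3 [:: 30; 31; 32; 33; 34; 35; 36; 37; 38; 39; 40;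
  41; 42; 43; 44; 45; 46; 47; 48; 49; 50; 51; 52; 53; 54; 55; 56; 57; 58] (Branch 2 2 [:: 30;
  31; 32; 33; 34; 35; 36; 37; 38; 39; 40; 41; 42; 43; 44; 45; 46; 47; 48; 49; 50; 51; 52; 53;
  54; 55; 56; 57; 58] (Farkas 8 [:: 2; 4; 6; 8; 10; 12; 14; 16; 18; 20; 22; 24; 26; 28; 30])
  (Branch 3 1 [::] (Branch 4 1 [:: 59; 60; 61; 62; 63; 64; 65; 66; 67; 68; 69; 70; 71; 72; 73;
  74; 75; 76; 77; 78; 79; 80; 81; 82; 83; 84; 85] (Farkas 4 [:: 2; 6; 8; 12; 14; 16; 20; 24; 26;
  28]) (Branch 8 1 [:: 86; 87; 88; 89; 90; 91; 92; 93; 94; 95; 96; 97; 98; 99; 100; 101; 102;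
  103; 104; 105; 106; 107; 108] (Farkas 3 [:: 1; 3; 9; 11; 16; 18; 24; 26]) (Branch 16 1 [::
  109; 110; 111; 112; 113; 114; 115; 116; 117; 118; 119; 120; 121; 122; 123] (Farkas 1 [:: 16;
  16]) (Branch 5 1 [:: 62; 70] (Farkas 8 [:: 6; 10; 12; 14; 14; 18; 20; 22; 22; 24; 26; 26; 28;
  28; 30; 30; 30]) (Farkas 4 [:: 2; 8; 10; 16; 18; 24; 26]))))) (Farkas 4 [:: 4; 8; 12; 16; 20;
  24; 28]))) (Farkas 4 [:: 4; 8; 12; 16; 20; 24; 28]))) (Farkas 8 [:: 2; 4; 6; 8; 10; 12; 14;
  16; 18; 20; 22; 24; 26; 28; 30]).

Definition certificate_27 : certificate :=
  Branch 1 3 [:: 0; 1; 2; 3; 4; 5; 6; 7; 8; 9; 10; 11; 12; 13; 14; 15; 16; 17; 18; 19; 20; 21;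
  22; 23; 24; 25; 26; 27; 28; 29] (Branch 1 2 [:: 0; 1; 2; 3; 4; 5; 6; 7; 8; 9; 10; 11; 12; 13;
  14; 15; 16; 17; 18; 19; 20; 21; 22; 23; 24; 25; 26; 27; 28; 29] (Farkas 16 [:: 1; 2; 3; 4; 5;
  6; 7; 8; 9; 10; 11; 12; 13; 14; 15; 16; 17; 18; 19; 20; 21; 22; 23; 24; 25; 26; 27; 28; 29;
  30; 31]) (Branch 2 2 [:: 30; 31; 32; 33; 34; 35; 36; 37; 38; 39; 40; 41; 42; 43; 44; 45; 46;
  47; 48; 49; 50; 51; 52; 53; 54; 55; 56; 57; 58] (Farkas 7 [:: 2; 4; 6; 8; 10; 12; 14; 16; 18;
  20; 22; 24; 26; 28; 30]) (Branch 3 1 [::] (Branch 4 1 [:: 59; 60; 61; 62; 63; 64; 65; 66; 67;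
  68; 69; 70; 71; 72; 73; 74; 75; 76; 77; 78; 79; 80; 81; 82; 83; 84; 85] (Farkas 3 [:: 4; 8;
  12; 16; 20; 24; 28]) (Branch 8 1 [:: 86; 87; 88; 89; 90; 91; 92; 93; 94; 95; 96; 97; 98; 99;
  100; 101; 102; 103; 104; 105; 106; 107; 108] (Farkas 3 [:: 8; 10; 12; 14; 16; 18; 20; 22])
  (Branch 16 1 [:: 109; 110; 111; 112; 113; 114; 115; 116; 117; 118; 119; 120; 121; 122; 123]
  (Farkas 1 [:: 16; 16]) (Branch 5 1 [:: 0; 62; 149; 70; 150] (Farkas 12 [:: 1; 3; 5; 6; 7; 10;
  12; 14; 14; 17; 18; 19; 20; 21; 22; 22; 23; 24; 26; 26; 28; 28; 30; 30; 30]) (Farkas 4 [:: 2;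
  8; 10; 16; 18; 24; 26]))))) (Farkas 4 [:: 4; 8; 12; 16; 20; 24; 28])))) (Farkas 8 [:: 2; 4; 6;
  8; 10; 12; 14; 16; 18; 20; 22; 24; 26; 28; 30]).

Definition certificate_28 : certificate :=
  Branch 1 2 [:: 0; 1; 2; 3; 4; 5; 6; 7; 8; 9; 10; 11; 12; 13; 14; 15; 16; 17; 18; 19; 20; 21;
  22; 23; 24; 25; 26; 27; 28; 29] (Farkas 16 [:: 1; 2; 3; 4; 5; 6; 7; 8; 9; 10; 11; 12; 13; 14;
  15; 16; 17; 18; 19; 20; 21; 22; 23; 24; 25; 26; 27; 28; 29; 30; 31]) (Farkas 8 [:: 2; 4; 6; 8;
  10; 12; 14; 16; 18; 20; 22; 24; 26; 28; 30]).

Definition certificate_29 : certificate :=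
  Branch 1 3 [:: 0; 1; 2; 3; 4; 5; 6; 7; 8; 9; 10; 11; 12; 13; 14; 15; 16; 17; 18; 19; 20; 21;
  22; 23; 24; 25; 26; 27; 28; 29] (Branch 1 2 [:: 0; 1; 2; 3; 4; 5; 6; 7; 8; 9; 10; 11; 12; 13;
  14; 15; 16; 17; 18; 19; 20; 21; 22; 23; 24; 25; 26; 27; 28; 29] (Farkas 16 [:: 1; 2; 3; 4; 5;
  6; 7; 8; 9; 10; 11; 12; 13; 14; 15; 16; 17; 18; 19; 20; 21; 22; 23; 24; 25; 26; 27; 28; 29;
  30; 31]) (Branch 2 2 [:: 30; 31; 32; 33; 34; 35; 36; 37; 38; 39; 40; 41; 42; 43; 44; 45; 46;
  47; 48; 49; 50; 51; 52; 53; 54; 55; 56; 57; 58] (Farkas 6 [:: 2; 4; 6; 8; 10; 12; 14; 16; 18;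
  20; 22; 24; 26; 28; 30]) (Branch 4 2 [:: 59; 60; 61; 62; 63; 64; 65; 66; 67; 68; 69; 70; 71;
  72; 73; 74; 75; 76; 77; 78; 79; 80; 81; 82; 83; 84; 85] (Farkas 4 [:: 4; 8; 12; 16; 20; 24;
  28]) (Branch 3 1 [:: 31; 124] (Branch 8 2 [:: 86; 87; 88; 89; 90; 91; 92; 93; 94; 95; 96; 97;
  98; 99; 100; 101; 102; 103; 104; 105; 106; 107; 108] (Farkas 8 [:: 2; 4; 6; 8; 10; 12; 14; 16;
  18; 20; 22; 24; 26; 28; 30]) (Branch 16 1 [:: 109; 110; 111; 112; 113; 114; 115; 116; 117;
  118; 119; 120; 121; 122; 123] (Farkas 1 [:: 16; 16]) (Branch 9 1 [:: 0; 2] (Branch 19 1 [::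
  31; 124; 35; 125; 126] (Farkas 5 [:: 1; 2; 3; 4; 5; 6; 9; 10; 11; 12; 13; 14; 17; 22; 25; 30])
  (Branch 20 1 [:: 111; 62; 147] (Farkas 16 [:: 1; 1; 3; 5; 5; 6; 7; 9; 10; 12; 13; 14; 14; 17;
  17; 17; 18; 19; 19; 21; 21; 22; 23; 24; 25; 25; 26; 26; 27; 28; 29; 30; 30]) (Branch 21 2 [::
  0] (Branch 17 2 [:: 0] (Farkas 16 [:: 1; 1; 3; 4; 5; 5; 6; 6; 7; 9; 9; 9; 10; 11; 11; 13; 14;
  17; 18; 20; 21; 21; 22; 22; 23; 24; 25; 25; 26; 26; 27; 29; 30]) (Farkas 4 [:: 4; 8; 12; 17;
  21; 25; 29])) (Farkas 4 [:: 2; 8; 10; 20; 22; 28; 30])))) (Farkas 4 [:: 2; 4; 6; 16; 18; 20;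
  22])))) (Farkas 4 [:: 4; 8; 12; 16; 20; 24; 28]))))) (Farkas 8 [:: 2; 4; 6; 8; 10; 12; 14; 16;
  18; 20; 22; 24; 26; 28; 30]).

Definition certificate_30 : certificate :=
  Branch 1 2 [:: 0; 1; 2; 3; 4; 5; 6; 7; 8; 9; 10; 11; 12; 13; 14; 15; 16; 17; 18; 19; 20; 21;
  22; 23; 24; 25; 26; 27; 28; 29] (Farkas 16 [:: 1; 2; 3; 4; 5; 6; 7; 8; 9; 10; 11; 12; 13; 14;
  15; 16; 17; 18; 19; 20; 21; 22; 23; 24; 25; 26; 27; 28; 29; 30; 31]) (Farkas 8 [:: 2; 4; 6; 8;
  10; 12; 14; 16; 18; 20; 22; 24; 26; 28; 30]).

Definition certificate_31 : certificate :=
  Branch 1 2 [:: 0; 1; 2; 3; 4; 5; 6; 7; 8; 9; 10; 11; 12; 13; 14; 15; 16; 17; 18; 19; 20; 21;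
  22; 23; 24; 25; 26; 27; 28; 29] (Farkas 8 [:: 6; 8; 9; 10; 11; 12; 13; 14; 15; 16; 17; 19; 20;
  22; 23; 24; 25; 26; 27; 28; 29; 30; 31]) (Farkas 8 [:: 2; 4; 6; 8; 10; 12; 14; 16; 18; 20; 22;
  24; 26; 28; 30]).

(** The length refuted is 71. Multiplicities at most 2 cannot give a weight above 32, so the largest
    one is 3, placed at the point 1; the rest of the tree treats this case. The tree for distance 38
    begins in the same way. *)
Definition certificate_36 : certificate :=
  Branch 1 3 [:: 0; 1; 2; 3; 4; 5; 6; 7; 8; 9; 10; 11; 12; 13; 14; 15; 16; 17; 18; 19; 20; 21;
  22; 23; 24; 25; 26; 27; 28; 29] (Branch 1 2 [:: 0; 1; 2; 3; 4; 5; 6; 7; 8; 9; 10; 11; 12; 13;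
  14; 15; 16; 17; 18; 19; 20; 21; 22; 23; 24; 25; 26; 27; 28; 29] (Farkas 6 [:: 7; 11; 13; 14;
  15; 19; 22; 23; 26; 27; 28; 29; 30; 31]) (Branch 2 2 [:: 30; 31; 32; 33; 34; 35; 36; 37; 38;
  39; 40; 41; 42; 43; 44; 45; 46; 47; 48; 49; 50; 51; 52; 53; 54; 55; 56; 57; 58] (Farkas 7 [::
  4; 5; 6; 7; 9; 13; 14; 15; 18; 20; 21; 22; 24; 25; 26; 30]) (Branch 4 2 [:: 59; 60; 61; 62;
  63; 64; 65; 66; 67; 68; 69; 70; 71; 72; 73; 74; 75; 76; 77; 78; 79; 80; 81; 82; 83; 84; 85]
  (Farkas 6 [:: 4; 10; 12; 12; 18; 20; 21; 23; 24; 26; 26; 28; 28; 30]) (Branch 3 1 [:: 31; 124]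
  (Farkas 8 [:: 1; 2; 5; 6; 9; 10; 13; 14; 17; 18; 21; 22; 25; 26; 29; 30]) (Branch 8 2 [:: 86;
  87; 88; 89; 90; 91; 92; 93; 94; 95; 96; 97; 98; 99; 100; 101; 102; 103; 104; 105; 106; 107;
  108] (Farkas 8 [:: 1; 4; 8; 8; 10; 16; 17; 17; 18; 19; 19; 20; 24; 24; 26; 29; 30]) (Branch 16
  1 [:: 109; 110; 111; 112; 113; 114; 115; 116; 117; 118; 119; 120; 121; 122; 123] (Farkas 1 [::
  16; 16]) (Branch 5 2 [:: 0; 62; 149] (Branch 21 1 [:: 0; 62; 149] (Farkas 8 [:: 1; 2; 3; 4; 5;
  8; 9; 10; 11; 12; 13; 16; 17; 24; 25]) (Branch 25 1 [:: 113] (Farkas 8 [:: 1; 2; 3; 4; 5; 6;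
  7; 8; 10; 16; 17; 18; 19; 20; 22]) (Branch 22 1 [:: 62] (Farkas 8 [:: 2; 3; 4; 5; 10; 11; 12;
  13; 16; 17; 22; 23; 24; 25; 30; 31]) (Branch 3 2 [::] (Branch 12 2 [::] (Branch 11 1 [::]
  (Farkas 8 [:: 1; 2; 5; 6; 8; 11; 12; 15; 17; 18; 21; 22; 24; 27; 28; 31]) (Branch 14 1 [::]
  (Farkas 8 [:: 2; 3; 4; 8; 9; 10; 14; 16; 18; 19; 20; 24; 25; 26; 30]) (Branch 6 1 [::] (Farkas
  8 [:: 2; 3; 4; 5; 10; 11; 12; 13; 18; 19; 20; 21; 26; 27; 28; 29]) (Branch 9 1 [:: 166]
  (Farkas 8 [:: 1; 3; 5; 7; 8; 10; 12; 14; 17; 19; 21; 23; 24; 26; 28; 30]) (Branch 17 1 [::]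
  (Farkas 4 [:: 1; 3; 5; 7; 16; 18; 20; 22]) (Branch 28 1 [::] (Farkas 8 [:: 4; 5; 6; 7; 8; 9;
  10; 11; 16; 17; 18; 19; 28; 29; 30; 31]) (Branch 20 1 [::] (Farkas 8 [:: 4; 5; 6; 7; 12; 13;
  14; 15; 16; 17; 18; 19; 24; 25; 26; 27]) (Branch 31 1 [::] (Farkas 8 [:: 1; 2; 4; 7; 8; 11;
  13; 14; 16; 19; 21; 22; 25; 26; 28; 31]) (Branch 12 1 [::] (Farkas 8 [:: 4; 5; 6; 7; 8; 9; 10;
  11; 20; 21; 22; 23; 24; 25; 26; 27]) (Branch 23 1 [::] (Farkas 8 [:: 1; 2; 4; 7; 9; 10; 12;
  15; 16; 19; 21; 22; 24; 27; 29; 30]) (Branch 15 1 [::] (Farkas 8 [:: 1; 2; 4; 7; 8; 11; 13;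
  14; 17; 18; 20; 23; 24; 27; 29; 30]) (Branch 26 1 [::] (Farkas 6 [:: 2; 3; 4; 6; 7; 8; 9; 12;
  13; 16; 20]) (Branch 7 1 [::] (Farkas 8 [:: 1; 2; 4; 7; 9; 10; 12; 15; 17; 18; 20; 23; 25; 26;
  28; 31]) (Branch 18 1 [::] (Farkas 4 [:: 8; 16; 17; 20; 24; 25; 28]) (Branch 24 1 [:: 166]
  (Farkas 8 [:: 1; 2; 3; 8; 9; 10; 11; 16; 17; 18; 19; 20; 21; 22; 23]) (Branch 29 1 [::]
  (Farkas 8 [:: 1; 1; 3; 6; 8; 13; 16; 16; 17; 17; 18; 23; 25; 28]) (Branch 10 1 [::] (Farkas 8
  [:: 2; 3; 6; 7; 8; 9; 12; 13; 18; 19; 22; 23; 24; 25; 28; 29]) (Branch 11 2 [:: 166] (Branch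
  30 1 [::] (Farkas 4 [:: 1; 4; 5; 8; 9; 16; 17]) (Branch 19 1 [:: 116] (Farkas 2 [:: 1; 6; 20])
  (Branch 13 1 [::] (Farkas 6 [:: 1; 3; 4; 6; 8; 16; 17; 19; 20; 22; 24]) (Branch 5 1 [::]
  (Farkas 8 [:: 1; 2; 3; 4; 6; 9; 11; 16; 17; 18; 19; 20; 22; 25; 27]) (Branch 18 2 [:: 166;
  205; 258] (Branch 7 2 [:: 205] (Branch 16 2 [:: 166; 259; 260] (Branch 27 1 [::] (Farkas 5 [::
  2; 5; 6; 8; 11; 16; 16; 20; 25; 26]) (Farkas 10 [:: 2; 4; 8; 10; 16; 16; 16; 17; 17; 18; 20;
  20; 21; 22; 24; 24; 25; 28])) (Farkas 4 [:: 1; 2; 4; 8; 9; 10; 12])) (Farkas 2 [:: 8; 16;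
  24])) (Farkas 10 [:: 1; 1; 2; 4; 4; 5; 5; 8; 8; 9; 12; 18; 18; 19; 22; 24; 26])))))) (Farkas 2
  [:: 4; 16; 20]))))))))))))))))))) (Farkas 4 [:: 1; 2; 3; 16; 17; 18; 19])) (Farkas 4 [:: 4; 8;
  12; 16; 20; 24; 28]))))) (Farkas 4 [:: 2; 8; 10; 16; 18; 24; 26])))))))) (Farkas 8 [:: 2; 4;
  6; 8; 10; 12; 14; 16; 18; 20; 22; 24; 26; 28; 30]).

Definition certificate_38 : certificate :=
  Branch 1 3 [:: 0; 1; 2; 3; 4; 5; 6; 7; 8; 9; 10; 11; 12; 13; 14; 15; 16; 17; 18; 19; 20; 21;
  22; 23; 24; 25; 26; 27; 28; 29] (Branch 1 2 [:: 0; 1; 2; 3; 4; 5; 6; 7; 8; 9; 10; 11; 12; 13;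
  14; 15; 16; 17; 18; 19; 20; 21; 22; 23; 24; 25; 26; 27; 28; 29] (Farkas 6 [:: 7; 11; 13; 14;
  15; 19; 22; 23; 26; 27; 28; 29; 30; 31]) (Branch 2 2 [:: 30; 31; 32; 33; 34; 35; 36; 37; 38;
  39; 40; 41; 42; 43; 44; 45; 46; 47; 48; 49; 50; 51; 52; 53; 54; 55; 56; 57; 58] (Farkas 7 [::
  1; 2; 4; 5; 7; 8; 11; 14; 18; 20; 21; 22; 24; 25; 27; 31]) (Branch 4 2 [:: 59; 60; 61; 62; 63;
  64; 65; 66; 67; 68; 69; 70; 71; 72; 73; 74; 75; 76; 77; 78; 79; 80; 81; 82; 83; 84; 85]
  (Farkas 4 [:: 4; 10; 12; 18; 20; 21; 23; 26; 28]) (Branch 3 1 [:: 31; 124] (Farkas 8 [:: 2; 3;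
  4; 5; 10; 11; 12; 13; 18; 19; 20; 21; 26; 27; 28; 29]) (Branch 8 2 [:: 86; 87; 88; 89; 90; 91;
  92; 93; 94; 95; 96; 97; 98; 99; 100; 101; 102; 103; 104; 105; 106; 107; 108] (Farkas 7 [:: 2;
  4; 6; 7; 8; 10; 11; 11; 14; 16; 17; 18; 20; 21; 22; 24; 25; 28]) (Branch 16 1 [:: 109; 110;
  111; 112; 113; 114; 115; 116; 117; 118; 119; 120; 121; 122; 123] (Farkas 1 [:: 16; 16])
  (Branch 5 2 [:: 0; 62; 149] (Branch 21 1 [:: 0; 62; 149] (Farkas 7 [:: 1; 2; 3; 4; 5; 8; 9;
  10; 11; 12; 13; 16; 17; 24; 25]) (Branch 25 1 [:: 113] (Farkas 4 [:: 5; 7; 8; 10; 16; 18; 29;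
  31]) (Branch 22 1 [:: 62] (Farkas 8 [:: 2; 3; 4; 5; 10; 11; 12; 13; 16; 17; 22; 23; 24; 25;
  30; 31]) (Branch 3 2 [::] (Branch 12 2 [::] (Branch 11 1 [::] (Farkas 8 [:: 1; 2; 5; 6; 8; 11;
  12; 15; 17; 18; 21; 22; 24; 27; 28; 31]) (Branch 14 1 [::] (Farkas 8 [:: 1; 2; 3; 4; 5; 8; 9;
  16; 17; 18; 19; 20; 21; 24; 25]) (Branch 6 1 [::] (Farkas 8 [:: 2; 3; 4; 5; 10; 11; 12; 13;
  18; 19; 20; 21; 26; 27; 28; 29]) (Branch 9 1 [:: 166] (Farkas 8 [:: 4; 5; 6; 7; 8; 9; 10; 11;
  20; 21; 22; 23; 24; 25; 26; 27]) (Branch 17 1 [::] (Farkas 4 [:: 1; 3; 5; 7; 16; 18; 20; 22])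
  (Branch 28 1 [::] (Farkas 8 [:: 4; 5; 6; 7; 8; 9; 10; 11; 16; 17; 18; 19; 28; 29; 30; 31])
  (Branch 20 1 [::] (Farkas 8 [:: 4; 5; 6; 7; 12; 13; 14; 15; 16; 17; 18; 19; 24; 25; 26; 27])
  (Branch 31 1 [::] (Farkas 8 [:: 1; 2; 4; 7; 8; 11; 13; 14; 16; 19; 21; 22; 25; 26; 28; 31])
  (Branch 12 1 [::] (Farkas 8 [:: 4; 5; 6; 7; 8; 9; 10; 11; 20; 21; 22; 23; 24; 25; 26; 27])
  (Branch 23 1 [::] (Farkas 8 [:: 1; 2; 4; 8; 9; 10; 12; 16; 20; 21; 22; 24; 28; 29; 30])
  (Branch 15 1 [::] (Farkas 8 [:: 1; 2; 4; 7; 8; 11; 13; 14; 17; 18; 20; 23; 24; 27; 29; 30])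
  (Branch 26 1 [::] (Farkas 8 [:: 2; 3; 6; 7; 8; 9; 12; 13; 16; 17; 20; 21; 26; 27; 30; 31])
  (Branch 7 1 [::] (Farkas 8 [:: 1; 2; 4; 7; 9; 10; 12; 15; 17; 18; 20; 23; 25; 26; 28; 31])
  (Branch 18 1 [::] (Farkas 8 [:: 2; 3; 6; 7; 8; 10; 11; 14; 15; 16; 17; 20; 24; 25; 28])
  (Branch 24 1 [:: 166] (Farkas 8 [:: 1; 2; 3; 8; 9; 10; 11; 16; 17; 18; 19; 20; 21; 22; 23])
  (Branch 29 1 [::] (Farkas 8 [:: 1; 2; 3; 4; 6; 8; 10; 13; 15; 16; 18; 25; 27; 28; 30]) (Branch
  10 1 [::] (Farkas 8 [:: 2; 3; 6; 7; 8; 9; 12; 13; 18; 19; 22; 23; 24; 25; 28; 29]) (Branch 30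
  1 [::] (Farkas 8 [:: 2; 4; 5; 8; 9; 12; 14; 16; 17; 20; 22; 24; 26; 28; 29]) (Branch 19 1 [::
  116] (Farkas 3 [:: 1; 2; 6; 16; 20]) (Branch 13 1 [::] (Farkas 8 [:: 1; 3; 4; 6; 8; 10; 13;
  15; 17; 19; 20; 22; 24; 26; 29; 31]) (Branch 5 1 [::] (Farkas 8 [:: 1; 3; 4; 6; 9; 11; 12; 14;
  17; 19; 20; 22; 25; 27; 28; 30]) (Branch 27 1 [::] (Farkas 8 [:: 1; 2; 4; 5; 6; 8; 11; 12; 15;
  16; 20; 25; 26; 29; 30]) (Branch 16 2 [:: 109; 110; 111; 112; 113; 114; 115; 116; 117; 118;
  119; 120; 121; 122; 123] (Farkas 1 [:: 16; 16]) (Branch 17 2 [:: 0; 2; 6] (Branch 7 2 [:: 62;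
  130; 131; 70; 132; 133; 134; 135; 136] (Farkas 3 [:: 2; 3; 4; 5; 12; 18]) (Branch 11 2 [:: 31;
  124; 93; 140; 141] (Farkas 6 [:: 1; 3; 5; 6; 8; 16; 17; 19; 21; 22; 24; 24]) (Branch 21 2 [::
  0; 62; 149] (Farkas 2 [:: 3; 7; 16; 20]) (Branch 14 2 [:: 140] (Farkas 12 [:: 2; 2; 3; 3; 4;
  4; 5; 5; 7; 8; 8; 10; 13; 16; 16; 19; 20; 24; 24; 25; 30]) (Farkas 7 [:: 8; 10; 13; 16; 16;
  16; 17; 19; 20; 22]))))) (Farkas 4 [:: 2; 4; 6; 8; 10; 12; 14])))))))))))))))))))))))))
  (Farkas 4 [:: 1; 2; 3; 16; 17; 18; 19])) (Farkas 4 [:: 4; 8; 12; 16; 20; 24; 28]))))) (Farkas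
  4 [:: 2; 8; 10; 16; 18; 24; 26])))))))) (Farkas 8 [:: 2; 4; 6; 8; 10; 12; 14; 16; 18; 20; 22;
  24; 26; 28; 30]).

(* For d = 2, 4, 14, 16 the bound for d - 1 is already sharp. *)
Definition certificates : seq certificate :=
  [:: certificate_1; certificate_1; certificate_3; certificate_3; certificate_5; certificate_6;
  certificate_7; certificate_8; certificate_9; certificate_10; certificate_11; certificate_12;
  certificate_13; certificate_13; certificate_15; certificate_15; certificate_17;
  certificate_18; certificate_19; certificate_20; certificate_21; certificate_22;
  certificate_23; certificate_24; certificate_25; certificate_26; certificate_27;
  certificate_28; certificate_29; certificate_30; certificate_31].

(** * Minimum lengths of local codes *)

(** A code of length at most [n] gives an admissible function for [n] itself, since admissibility
    bounds the length only from above; one tree thus excludes all lengths up to [n]. *)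
Lemma local_code_lower_bound n d t N (C : {vspace 'rV[F2]_N}) :
  0 < d -> check symmetry_perms n d (initial_bounds n) t ->
  is_code 5 d C -> has_locality 1 C -> n < N.
Proof.
move=> d0 ck codeC locC; rewrite ltnNge; apply/negP => Nn.
have [m [m0 m1 mN md]] := admissible_of_code d0 codeC locC.
have adm : admissible n d m by split=> //; exact: leq_trans Nn.
have gl : all gl5 symmetries by vm_compute.
have permsE : symmetry_perms = [seq [seq act g i | i <- iota 0 32] | g <- symmetries].
  by vm_compute.
exact: checkP gl permsE ck adm (admissible_initial adm).
Qed.

Lemma is_min_length_loc_intro n d s t :
  0 < d -> realizes n d s ->
  check symmetry_perms n.-1 d (initial_bounds n.-1) t -> is_min_length_loc 'F_2 5 d 1 n.
Proof.
move=> d0 rs ck; split; first exact: code_of_realizes d0 rs.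
move=> N [C [codeC locC]].
by apply: leq_trans (leqSpred n) (local_code_lower_bound d0 ck codeC locC).
Qed.

Definition small_lengths : seq nat :=
  [:: 10; 10; 12; 12; 17; 18; 19; 20; 24; 25; 27; 28; 30; 30; 32;
      32; 37; 38; 41; 42; 45; 46; 47; 48; 52; 54; 55; 56; 59; 60; 62].

(** A single evaluation validates all 31 codes and all 31 trees. *)
Lemma small_lengths_check d : 1 <= d <= 31 ->
  let n := nth 0 small_lengths d.-1 in
  realizes n d (nth [::] multiplicity_table d.-1) /\
  check symmetry_perms n.-1 d (initial_bounds n.-1) (nth certificate_1 certificates d.-1).
Proof.
move=> dI.
have /allP/(_ d) : all (fun d => let n := nth 0 small_lengths d.-1 in
    realizes n d (nth [::] multiplicity_table d.-1) &&
    check symmetry_perms n.-1 d (initial_bounds n.-1) (nth certificate_1 certificates d.-1))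
    (iota 1 31) by vm_compute.
by rewrite mem_iota ltnS => /(_ dI) /andP.
Qed.

(** The refuted length 71 is the Griesmer value of 36, so the general bound does not settle this
    case. For 38 the same holds with 75. *)
Lemma check_36 :
  realizes 72 36 (nth [::] multiplicity_table 35) /\
  check symmetry_perms 72.-1 36 (initial_bounds 72.-1) certificate_36.
Proof. by apply/andP; vm_compute. Qed.

Lemma check_38 :
  realizes 76 38 (nth [::] multiplicity_table 37) /\
  check symmetry_perms 76.-1 38 (initial_bounds 76.-1) certificate_38.
Proof. by apply/andP; vm_compute. Qed.

Theorem theorem38 :
  (forall d : nat, 1 <= d <= 31 ->
     is_min_length_loc 'F_2 5 d 1
       (nth 0 [:: 10; 10; 12; 12; 17; 18; 19; 20; 24; 25; 27; 28; 30; 30; 32;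
                  32; 37; 38; 41; 42; 45; 46; 47; 48; 52; 54; 55; 56; 59; 60;
                  62] d.-1)) /\
  is_min_length_loc 'F_2 5 36 1 72 /\
  is_min_length_loc 'F_2 5 38 1 76 /\
  (forall d : nat, 31 < d -> d <> 36 -> d <> 38 ->
     exists n : nat,
       is_min_length_loc 'F_2 5 d 1 n /\ is_min_length 'F_2 5 d n).
Proof.
split.
  move=> d dI; have [rs ck] := small_lengths_check dI.
  by case/andP: dI => d0 _; exact: is_min_length_loc_intro d0 rs ck.
split; first by have [rs ck] := check_36; exact: (is_min_length_loc_intro (d := 36) isT rs ck).
split; first by have [rs ck] := check_38; exact: (is_min_length_loc_intro (d := 38) isT rs ck).
move=> d d31 d36 d38; have d0 : 0 < d by apply: leq_ltn_trans d31.
have [s rs] := griesmer_realizable d31 d36 d38.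
have [C [codeC locC]] := code_of_realizes d0 rs.
(* The code with locality attains a lower bound valid for all codes of dimension 5, so both minima
   are equal to it. *)
exists (griesmer 5 d); split; split.
- by exists C.
- by move=> N [C' [codeC' _]]; exact: griesmer_code codeC'.
- by exists C.
- by move=> N [C' codeC']; exact: griesmer_code codeC'.
Qed.
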